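(* Let $E$ be an arbitrary directed graph and $K$ any field, and let $L=L_K(E)$ be the Leavitt path algebra. The following are equivalent: (i) $L$ is CIRT; (ii) $L$ is the union of a well-ordered smooth (strictly) ascending chain of countable length consisting of graded ideals $$0=I_0<I_1<\cdots<I_\alpha<I_{\alpha+1}<\cdots\qquad(\alpha<\tau),$$ where $\tau$ is a countable ordinal and, for each $0\le\alpha<\tau$, $I_{\alpha+1}/I_\alpha$ is isomorphic to a direct sum of at most countably many matrix rings $M_\Lambda(R)$, where the index sets $\Lambda$ are of arbitrary size and each $R$ is either $K$ or $K[x,x^{-1}]$; moreover, $K$ is a countable field whenever $E$ contains cycles.
   Context: A directed graph $E=(E^0,E^1,r,s)$ consists of a set $E^0$ of vertices, a set $E^1$ of edges and maps $r,s:E^1\to E^0$ (range and source); there are no restrictions on the cardinalities of $E^0$, $E^1$ or of the sets $s^{-1}(v)$. A vertex $v$ is regular if $0<|s^{-1}(v)|<\infty$. Given a field $K$, the Leavitt path algebra $L_K(E)$ is the (not necessarily unital) $K$-algebra generated by pairwise orthogonal idempotents $\{v:v\in E^0\}$ and elements $\{e,e^*:e\in E^1\}$ subject to: (1) $s(e)e=e=er(e)$; (2) $r(e)e^*=e^*=e^*s(e)$; (3) $e^*e=r(e)$ and $e^*f=0$ for edges $e\ne f$; (4) $v=\sum_{e\in E^1,\,s(e)=v}ee^*$ for every regular vertex $v$. It is $\mathbb{Z}$-graded with $\deg v=0$, $\deg e=1$, $\deg e^*=-1$; a graded ideal is a two-sided ideal that is generated by (equivalently, is the sum of) its homogeneous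 components with respect to this grading. $L_K(E)$ is called CIRT (of countable irreducible representation type) if it has at most countably many distinct isomorphism classes of simple left (equivalently, by the standard involution of $L_K(E)$, simple right) $L_K(E)$-modules. A left module $S$ over a ring $R$ (not necessarily unital) is simple if $RS\neq 0$ and $S$ has no submodules other than $0$ and $S$; similarly for right modules. The chain consists of the ideals $I_\alpha$ and $I_{\alpha+1}$ for $\alpha<\tau$. Smooth means $I_\gamma=\bigcup_{\alpha<\gamma}I_\alpha$ for every limit ordinal $\gamma$ indexing the chain. For a ring $R$ and a set $\Lambda$, $M_\Lambda(R)$ is the ring of $\Lambda\times\Lambda$ matrices over $R$ having only finitely many nonzero entries. ''Countable'' (for ordinals and fields) means finite or countably infinite. A path $e_1\cdots e_n$ ($n\ge 1$, $r(e_i)=s(e_{i+1})$) is closed if $r(e_n)=s(e_1)$, and a closed path is a cycle if $s(e_i)\neq s(e_j)$ for all $i\neq j$. *)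

(* Defs.v *)
From HB Require Import structures.
From mathcomp Require Import all_boot all_order all_algebra.
From mathcomp Require Import finmap.
From mathcomp Require Import boolp classical_sets functions cardinality fsbigop.

Set Implicit Arguments.
Unset Strict Implicit.
Unset Printing Implicit Defensive.

Import Order.TTheory GRing.Theory.

Local Open Scope classical_set_scope.
Local Open Scope ring_scope.
Local Open Scope quotient_scope.

Declare Scope rng_scope.
Reserved Notation "x ** y" (at level 40, left associativity).

HB.mixin Record Zmodule_isRng R of GRing.Zmodule R := {
  rmul : R -> R -> R;
  rmulA : associative rmul;
  rmulDl : left_distributive rmul +%R;
  rmulDr : right_distributive rmul +%R
}.

#[short(type="rngType")]
HB.structure Definition Rng := {R of Zmodule_isRng R & GRing.Zmodule R}.

Notation "x ** y" := (rmul x y) : rng_scope.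
Local Open Scope rng_scope.

Section RngTheory.
Variable R : rngType.
Implicit Types x y z : R.

Lemma rmul0l x : 0 ** x = 0.
Proof. by apply: (addrI (0 ** x)); rewrite -rmulDl !addr0. Qed.

Lemma rmul0r x : x ** 0 = 0.
Proof. by apply: (addrI (x ** 0)); rewrite -rmulDr !addr0. Qed.

Lemma rmulNl x y : (- x) ** y = - (x ** y).
Proof. by apply/eqP; rewrite -addr_eq0 -rmulDl addNr rmul0l. Qed.

Lemma rmulNr x y : x ** (- y) = - (x ** y).
Proof. by apply/eqP; rewrite -addr_eq0 -rmulDr addNr rmul0r. Qed.

Lemma rmulBl x y z : (x - y) ** z = x ** z - y ** z.
Proof. by rewrite rmulDl rmulNl. Qed.

Lemma rmulBr x y z : z ** (x - y) = z ** x - z ** y.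
Proof. by rewrite rmulDr rmulNr. Qed.

End RngTheory.

Definition rng_iso (R S : rngType) : Prop :=
  exists f : R -> S,
    [/\ bijective f, {morph f : x y / x + y} & {morph f : x y / x ** y}].

HB.mixin Record isRngIdeal (R : rngType) (I : {pred R}) := {
  rng_idealMl : forall r x, x \in I -> r ** x \in I;
  rng_idealMr : forall r x, x \in I -> x ** r \in I
}.

#[short(type="rngIdeal")]
HB.structure Definition RngIdeal (R : rngType) :=
  {I of isRngIdeal R I & GRing.ZmodClosed R I}.

Section RngQuotient.
Variables (R : rngType) (J : rngIdeal R).

Definition rng_quot : Type := Quotient.quot J.
HB.instance Definition _ := GRing.Zmodule.on rng_quot.

Definition rng_quot_pi (x : R) : rng_quot := \pi_(Quotient.quot J) x.
Definition rng_quot_repr (x : rng_quot) : R := repr (x : Quotient.quot J).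
Definition rng_quot_mul (x y : rng_quot) : rng_quot :=
  rng_quot_pi (rng_quot_repr x ** rng_quot_repr y).

Lemma rng_quot_reprK : cancel rng_quot_repr rng_quot_pi.
Proof. by move=> x; apply: reprK. Qed.

Lemma rng_quot_piP x y : rng_quot_pi x = rng_quot_pi y <-> x - y \in J.
Proof. by rewrite Quotient.idealrBE; split=> /eqP. Qed.

Lemma rng_quot_piD : {morph rng_quot_pi : x y / x + y}.
Proof. exact: (@Quotient.pi_add R J). Qed.

Lemma rng_quot_piM x y :
  rng_quot_mul (rng_quot_pi x) (rng_quot_pi y) = rng_quot_pi (x ** y).
Proof.
apply/rng_quot_piP.
set x' := rng_quot_repr _; set y' := rng_quot_repr _.
have hx : x' - x \in J by apply/rng_quot_piP; rewrite rng_quot_reprK.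
have hy : y' - y \in J by apply/rng_quot_piP; rewrite rng_quot_reprK.
have -> : x' ** y' - x ** y = (x' - x) ** y' + x ** (y' - y).
  by rewrite rmulBl rmulBr addrA addrNK.
by apply: rpredD; [apply: rng_idealMr | apply: rng_idealMl].
Qed.

Lemma rng_quot_mulA : associative rng_quot_mul.
Proof.
move=> x y z; rewrite -[x]rng_quot_reprK -[y]rng_quot_reprK.
by rewrite -[z]rng_quot_reprK !rng_quot_piM rmulA.
Qed.

Lemma rng_quot_mulDl : left_distributive rng_quot_mul +%R.
Proof.
move=> x y z; rewrite -[x]rng_quot_reprK -[y]rng_quot_reprK.
by rewrite -[z]rng_quot_reprK -rng_quot_piD !rng_quot_piM -rng_quot_piD rmulDl.
Qed.

Lemma rng_quot_mulDr : right_distributive rng_quot_mul +%R.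
Proof.
move=> x y z; rewrite -[x]rng_quot_reprK -[y]rng_quot_reprK.
by rewrite -[z]rng_quot_reprK -rng_quot_piD !rng_quot_piM -rng_quot_piD rmulDr.
Qed.

HB.instance Definition _ := Zmodule_isRng.Build rng_quot
  rng_quot_mulA rng_quot_mulDl rng_quot_mulDr.

End RngQuotient.

Section IdealAsRng.
Variables (R : rngType) (I : rngIdeal R).

Record ideal_rng := IdealRng { ideal_val : R; _ : ideal_val \in I }.

HB.instance Definition _ := [isSub for ideal_val].
HB.instance Definition _ := [Choice of ideal_rng by <:].
HB.instance Definition _ := [SubChoice_isSubZmodule of ideal_rng by <:].

Definition ideal_mul (x y : ideal_rng) : ideal_rng :=
  IdealRng (rng_idealMl (\val x) (\val y) (valP y)).

Lemma ideal_mulA : associative ideal_mul.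
Proof. by move=> x y z; apply: val_inj; rewrite /= rmulA. Qed.

Lemma ideal_mulDl : left_distributive ideal_mul +%R.
Proof. by move=> x y z; apply: val_inj; rewrite /= rmulDl. Qed.

Lemma ideal_mulDr : right_distributive ideal_mul +%R.
Proof. by move=> x y z; apply: val_inj; rewrite /= rmulDr. Qed.

HB.instance Definition _ := Zmodule_isRng.Build ideal_rng
  ideal_mulA ideal_mulDl ideal_mulDr.

End IdealAsRng.

Section Subquotient.
Variables (R : rngType) (I J : rngIdeal R).

Definition ideal_trace : {pred ideal_rng I} := [pred x | \val x \in J].

Lemma ideal_trace_zmod_closed : zmod_closed ideal_trace.
Proof.
by split=> [|x y]; rewrite !inE ?rpred0 // => Jx Jy; apply: rpredB.
Qed.
HB.instance Definition _ := GRing.isZmodClosed.Build (ideal_rng I) ideal_trace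
  ideal_trace_zmod_closed.

Lemma ideal_traceMl (r x : ideal_rng I) :
  x \in ideal_trace -> r ** x \in ideal_trace.
Proof. by rewrite !inE => Jx; apply: rng_idealMl. Qed.

Lemma ideal_traceMr (r x : ideal_rng I) :
  x \in ideal_trace -> x ** r \in ideal_trace.
Proof. by rewrite !inE => Jx; apply: rng_idealMr. Qed.

HB.instance Definition _ := isRngIdeal.Build (ideal_rng I) ideal_trace
  ideal_traceMl ideal_traceMr.

(* The ring I / (I `&` J), that is I / J when J is contained in I. *)
Definition subquotient : rngType := rng_quot ideal_trace.

End Subquotient.

Record rngModule (R : rngType) := RngModule {
  mod_sort :> zmodType;
  act : R -> mod_sort -> mod_sort;
  actDr : forall r, {morph act r : m n / m + n};
  actDl : forall m, {morph act^~ m : r s / r + s};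
  actM : forall r s m, act (r ** s) m = act r (act s m)
}.

Definition submodule (R : rngType) (M : rngModule R) (N : set M) : Prop :=
  [/\ N 0, (forall m n, N m -> N n -> N (m - n))
    & (forall r m, N m -> N (act r m))].

Definition simple_module (R : rngType) (M : rngModule R) : Prop :=
  (exists r (m : M), act r m <> 0) /\
  (forall N : set M, submodule N -> N = [set 0] \/ N = setT).

Definition module_iso (R : rngType) (M N : rngModule R) : Prop :=
  exists f : M -> N,
    [/\ bijective f, {morph f : m n / m + n}
      & forall r, {morph f : m / act r m}].

(* F is an injection into nat of the isomorphism classes of simple modules. *)
Definition CIRT (R : rngType) : Prop :=
  exists F : rngModule R -> nat, forall S T : rngModule R,
    simple_module S -> simple_module T -> (F S = F T <-> module_iso S T).

Section FinMatrix.
Variables (X : choiceType) (R : nzRingType).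
Implicit Types A B C : X -> X -> R.

Definition fin_entries : {pred X -> X -> R} :=
  fun A => `[< finite_set [set p : X * X | A p.1 p.2 != 0] >].

Lemma fin_entriesP A : reflect
  (exists Y : {fset X}, forall i j, (i \notin Y) || (j \notin Y) -> A i j = 0)
  (A \in fin_entries).
Proof.
apply: (iffP (asboolP _)) => [fA|[Y hY]].
  exists ([fset p.1 | p in fset_set [set p | A p.1 p.2 != 0]]%fset
    `|` [fset p.2 | p in fset_set [set p | A p.1 p.2 != 0]]%fset)%fset.
  move=> i j hij; apply/eqP; apply: contraTT hij => nz.
  have hp : (i, j) \in fset_set [set p | A p.1 p.2 != 0].
    by rewrite in_fset_set // inE.
  rewrite negb_or !negbK !in_fsetU; apply/andP; split; apply/orP.
    by left; apply/imfsetP; exists (i, j).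
  by right; apply/imfsetP; exists (i, j).
apply: (@sub_finite_set _ _ [set` Y `*` Y]%fset); last exact: finite_fset.
move=> [i j] /= nz; rewrite in_fsetM /=; apply/andP; split;
  by apply: contraNT nz => hi; rewrite hY ?hi ?orbT.
Qed.

Lemma fin_entries_zmod_closed : zmod_closed fin_entries.
Proof.
split=> [|A B]; first by apply/fin_entriesP; exists fset0.
move=> /fin_entriesP[Y hA] /fin_entriesP[Z hB]; apply/fin_entriesP.
exists (Y `|` Z)%fset => i j; rewrite !in_fsetU !negb_or => hij.
have -> : (A - B) i j = A i j - B i j by [].
by rewrite hA ?hB ?subr0 //; move: hij => /orP[]/andP[hY hZ];
  rewrite ?hY ?hZ ?orbT.
Qed.
HB.instance Definition _ := GRing.isZmodClosed.Build (X -> X -> R) fin_entries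
  fin_entries_zmod_closed.

Record fin_matrix := FinMatrix {
  fin_matrix_val : X -> X -> R;
  _ : fin_matrix_val \in fin_entries
}.

HB.instance Definition _ := [isSub for fin_matrix_val].
HB.instance Definition _ := [Choice of fin_matrix by <:].
HB.instance Definition _ := [SubChoice_isSubZmodule of fin_matrix by <:].

(* For finitely supported A and B this is a finite sum: \sum_(_ \in _) ranges
   over the indices where the summand is nonzero. *)
Definition fmx_mul A B : X -> X -> R :=
  fun i j => \sum_(k \in [set: X]) A i k * B k j.

Lemma fmx_mulE (Y : {fset X}) A B i j :
  (forall k, k \notin Y -> A i k * B k j = 0) ->
  fmx_mul A B i j = \sum_(k <- Y) A i k * B k j.
Proof.
move=> hY; rewrite /fmx_mul -(fsbig_widen [set` Y] setT) //.
  by rewrite fsbig_finite ?set_fsetK //; exact: finite_fset.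
by move=> k [_ /= /negP hk]; apply: hY.
Qed.

Lemma fmx_mul_fin A B :
  A \in fin_entries -> B \in fin_entries -> fmx_mul A B \in fin_entries.
Proof.
move=> /fin_entriesP[Y hA] /fin_entriesP[Z hB]; apply/fin_entriesP.
exists (Y `|` Z)%fset => i j; rewrite !in_fsetU !negb_or => hij.
rewrite /fmx_mul fsbig1 // => k _; case/orP: hij => /andP[hY hZ].
  by rewrite hA ?hY ?mul0r.
by rewrite hB ?hZ ?orbT ?mulr0.
Qed.

Definition fin_matrix_mul (A B : fin_matrix) : fin_matrix :=
  FinMatrix (fmx_mul_fin (valP A) (valP B)).

Lemma fin_matrix_mulA : associative fin_matrix_mul.
Proof.
move=> A B C; apply: val_inj => /=; apply/funext => i; apply/funext => j.
have /fin_entriesP[Y hA] := valP A; have /fin_entriesP[Z hB] := valP B.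
have /fin_entriesP[W hC] := valP C; pose V := (Y `|` Z `|` W)%fset.
have hV k : k \notin V -> [/\ k \notin Y, k \notin Z & k \notin W].
  by rewrite !in_fsetU !negb_or => /andP[/andP[]].
rewrite (@fmx_mulE V) => [|k /hV[hY _ _]]; last by rewrite hA ?hY ?orbT ?mul0r.
rewrite (@fmx_mulE V) => [|k /hV[_ _ hW]]; last first.
  by rewrite [X in _ * X]hC ?hW ?mulr0.
under eq_bigr => k _.
  rewrite (@fmx_mulE V) => [|l /hV[_ hZ _]]; last first.
    by rewrite hB ?hZ ?orbT ?mul0r.
  rewrite big_distrr /=; over.
under [RHS]eq_bigr => k _.
  rewrite (@fmx_mulE V) => [|l /hV[hY _ _]]; last first.
    by rewrite hA ?hY ?orbT ?mul0r.
  rewrite big_distrl /=; over.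
by rewrite exchange_big; apply: eq_bigr => k _; apply: eq_bigr => l _;
  rewrite mulrA.
Qed.

Lemma fin_matrix_mulDl : left_distributive fin_matrix_mul +%R.
Proof.
move=> A B C; apply: val_inj => /=; apply/funext => i; apply/funext => j.
have /fin_entriesP[W hC] := valP C.
have hW D k : k \notin W -> D i k * \val C k j = 0.
  by move=> hk; rewrite hC ?hk ?mulr0.
have -> : forall F G : X -> X -> R, (F + G) i j = F i j + G i j by [].
rewrite !(@fmx_mulE W) => [|k|k|k]; try exact: hW.
by rewrite -big_split; apply: eq_bigr => k _; exact: mulrDl.
Qed.

Lemma fin_matrix_mulDr : right_distributive fin_matrix_mul +%R.
Proof.
move=> C A B; apply: val_inj => /=; apply/funext => i; apply/funext => j.
have /fin_entriesP[W hC] := valP C.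
have hW D k : k \notin W -> \val C i k * D k j = 0.
  by move=> hk; rewrite hC ?hk ?orbT ?mul0r.
have -> : forall F G : X -> X -> R, (F + G) i j = F i j + G i j by [].
rewrite !(@fmx_mulE W) => [|k|k|k]; try exact: hW.
by rewrite -big_split; apply: eq_bigr => k _; exact: mulrDr.
Qed.

HB.instance Definition _ := Zmodule_isRng.Build fin_matrix
  fin_matrix_mulA fin_matrix_mulDl fin_matrix_mulDr.

End FinMatrix.

Section DirectSum.
Variables (J : choiceType) (A : J -> rngType).

Record direct_sum := DirectSum {
  dsum_val :> forall j, A j;
  dsum_fin : finite_set [set j | dsum_val j != 0]
}.

HB.instance Definition _ := gen_eqMixin direct_sum.
HB.instance Definition _ := gen_choiceMixin direct_sum.

Implicit Types f g h : direct_sum.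

Lemma dsumP f g : (forall j, f j = g j) -> f = g.
Proof.
case: f g => [f hf] [g hg] /= fg.
have {}fg : f = g by apply: functional_extensionality_dep.
by subst g; rewrite (Prop_irrelevance hf hg).
Qed.

Lemma dsum0_fin : finite_set [set j | (0 : A j) != 0].
Proof.
by rewrite (_ : mkset _ = set0) // -subset0 => j /=; rewrite eqxx.
Qed.
Definition dsum0 := DirectSum dsum0_fin.

Lemma dsum_opp_fin f : finite_set [set j | - f j != 0].
Proof.
by apply: sub_finite_set (dsum_fin f) => j /=; rewrite oppr_eq0.
Qed.
Definition dsum_opp f := DirectSum (dsum_opp_fin f).

Lemma dsum_add_fin f g : finite_set [set j | f j + g j != 0].
Proof.
apply: (@sub_finite_set _ _ ([set j | f j != 0] `|` [set j | g j != 0])).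
  move=> j /= nz; have [f0|] := eqVneq (f j) 0; last by left.
  by right; rewrite f0 add0r in nz.
by rewrite finite_setU; split; apply: dsum_fin.
Qed.
Definition dsum_add f g := DirectSum (dsum_add_fin f g).

Lemma dsum_mul_fin f g : finite_set [set j | f j ** g j != 0].
Proof.
apply: sub_finite_set (dsum_fin f) => j /=.
by apply: contraNneq => ->; rewrite rmul0l.
Qed.
Definition dsum_mul f g := DirectSum (dsum_mul_fin f g).

Lemma dsum_addA : associative dsum_add.
Proof. by move=> f g h; apply: dsumP => j /=; rewrite addrA. Qed.
Lemma dsum_addC : commutative dsum_add.
Proof. by move=> f g; apply: dsumP => j /=; rewrite addrC. Qed.
Lemma dsum_add0 : left_id dsum0 dsum_add.
Proof. by move=> f; apply: dsumP => j /=; rewrite add0r. Qed.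
Lemma dsum_addN : left_inverse dsum0 dsum_opp dsum_add.
Proof. by move=> f; apply: dsumP => j /=; rewrite addNr. Qed.

HB.instance Definition _ := GRing.isZmodule.Build direct_sum
  dsum_addA dsum_addC dsum_add0 dsum_addN.

Lemma dsum_mulA : associative dsum_mul.
Proof. by move=> f g h; apply: dsumP => j /=; rewrite rmulA. Qed.
Lemma dsum_mulDl : left_distributive dsum_mul +%R.
Proof. by move=> f g h; apply: dsumP => j /=; rewrite rmulDl. Qed.
Lemma dsum_mulDr : right_distributive dsum_mul +%R.
Proof. by move=> f g h; apply: dsumP => j /=; rewrite rmulDr. Qed.

HB.instance Definition _ := Zmodule_isRng.Build direct_sum
  dsum_mulA dsum_mulDl dsum_mulDr.

End DirectSum.

Section Laurent.
Variable K : fieldType.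

Local Notation "p %:F" := (@FracField.tofrac {poly K} p).

(* K[x, x^-1], as the subring of K(x) of the fractions p / x^n. *)
Definition laurent_pred : {pred {fraction {poly K}}} :=
  fun f => `[< exists (p : {poly K}) (n : nat), f = p%:F / 'X%:F ^+ n >].

Lemma laurent_subring_closed : subring_closed laurent_pred.
Proof.
have X0 n : 'X%:F ^+ n != 0 :> {fraction {poly K}}.
  by rewrite expf_neq0 // tofrac_eq0 polyX_eq0.
split=> [|_ _ /asboolP[p [m ->]] /asboolP[q [n ->]]|
          _ _ /asboolP[p [m ->]] /asboolP[q [n ->]]]; apply/asboolP.
- by exists 1, 0; rewrite expr0 divr1 tofrac1.
- exists (p * 'X^n - q * 'X^m), (m + n)%N.
  by rewrite -mulNr addf_div // tofracB !tofracM !tofracXn exprD mulNr.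
- by exists (p * q), (m + n)%N; rewrite tofracM exprD mulf_div.
Qed.
HB.instance Definition _ := GRing.isSubringClosed.Build
  {fraction {poly K}} laurent_pred laurent_subring_closed.

Record laurent := Laurent {
  laurent_val : {fraction {poly K}};
  _ : laurent_val \in laurent_pred
}.

HB.instance Definition _ := [isSub for laurent_val].
HB.instance Definition _ := [Choice of laurent by <:].
HB.instance Definition _ := [SubChoice_isSubComNzRing of laurent by <:].

End Laurent.

Variant coef_kind := BaseField | LaurentRing.

Definition coef_ring (K : fieldType) (k : coef_kind) : nzRingType :=
  match k with BaseField => K | LaurentRing => laurent K end.

(* Any type can be made a choiceType classically, so asking for choiceTypes
   puts no restriction on the sets of vertices and edges. *)
Record graph := Graph {
  vertex : choiceType;
  edge : choiceType;
  src : edge -> vertex;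
  rge : edge -> vertex
}.

Definition out_edges (E : graph) (v : vertex E) : set (edge E) :=
  [set e | src e = v].

Definition regular (E : graph) (v : vertex E) : Prop :=
  out_edges v !=set0 /\ finite_set (out_edges v).

Definition graph_cycle (E : graph) (c : seq (edge E)) : Prop :=
  [/\ c != [::], cycle (fun e f => rge e == src f) c & uniq (map (@src E) c)].

Section Leavitt.
Variables (K : fieldType) (E : graph).

Inductive term : Type :=
| Tvertex of vertex E
| Tedge of edge E
| Tghost of edge E
| Tzero
| Topp of term
| Tadd of term & term
| Tscale of K & term
| Tmul of term & term.

(* The least congruence making the terms a non-unital K-algebra in which the
   defining relations of the Leavitt path algebra hold. *)
Inductive leavitt_rel : term -> term -> Prop :=
| Rrefl a : leavitt_rel a a
| Rsym a b : leavitt_rel a b -> leavitt_rel b a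
| Rtrans b a c : leavitt_rel a b -> leavitt_rel b c -> leavitt_rel a c
| Ropp a b : leavitt_rel a b -> leavitt_rel (Topp a) (Topp b)
| Radd a b c d : leavitt_rel a b -> leavitt_rel c d ->
    leavitt_rel (Tadd a c) (Tadd b d)
| Rscale k a b : leavitt_rel a b -> leavitt_rel (Tscale k a) (Tscale k b)
| Rmul a b c d : leavitt_rel a b -> leavitt_rel c d ->
    leavitt_rel (Tmul a c) (Tmul b d)
| RaddA a b c : leavitt_rel (Tadd a (Tadd b c)) (Tadd (Tadd a b) c)
| RaddC a b : leavitt_rel (Tadd a b) (Tadd b a)
| Radd0 a : leavitt_rel (Tadd Tzero a) a
| RaddN a : leavitt_rel (Tadd (Topp a) a) Tzero
| RscaleA k l a : leavitt_rel (Tscale k (Tscale l a)) (Tscale (k * l) a)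
| Rscale1 a : leavitt_rel (Tscale 1 a) a
| RscaleDr k a b :
    leavitt_rel (Tscale k (Tadd a b)) (Tadd (Tscale k a) (Tscale k b))
| RscaleDl k l a :
    leavitt_rel (Tscale (k + l) a) (Tadd (Tscale k a) (Tscale l a))
| RmulA a b c : leavitt_rel (Tmul a (Tmul b c)) (Tmul (Tmul a b) c)
| RmulDl a b c : leavitt_rel (Tmul (Tadd a b) c) (Tadd (Tmul a c) (Tmul b c))
| RmulDr a b c : leavitt_rel (Tmul a (Tadd b c)) (Tadd (Tmul a b) (Tmul a c))
| RscaleMl k a b : leavitt_rel (Tscale k (Tmul a b)) (Tmul (Tscale k a) b)
| RscaleMr k a b : leavitt_rel (Tscale k (Tmul a b)) (Tmul a (Tscale k b))
| Rvertex v : leavitt_rel (Tmul (Tvertex v) (Tvertex v)) (Tvertex v)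
| Rvertex0 v w : v <> w -> leavitt_rel (Tmul (Tvertex v) (Tvertex w)) Tzero
| Rsrc_edge e : leavitt_rel (Tmul (Tvertex (src e)) (Tedge e)) (Tedge e)
| Redge_rge e : leavitt_rel (Tmul (Tedge e) (Tvertex (rge e))) (Tedge e)
| Rrge_ghost e : leavitt_rel (Tmul (Tvertex (rge e)) (Tghost e)) (Tghost e)
| Rghost_src e : leavitt_rel (Tmul (Tghost e) (Tvertex (src e))) (Tghost e)
| Rghost_edge e : leavitt_rel (Tmul (Tghost e) (Tedge e)) (Tvertex (rge e))
| Rghost_edge0 e f : e <> f -> leavitt_rel (Tmul (Tghost e) (Tedge f)) Tzero
| Rregular v : regular v -> leavitt_rel (Tvertex v)
    (\big[Tadd/Tzero]_(e <- fset_set (out_edges v)) Tmul (Tedge e) (Tghost e)).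

Definition leavitt_relb (a b : term) : bool := `[< leavitt_rel a b >].

Lemma leavitt_rel_equiv : equiv_class_of leavitt_relb.
Proof.
split=> [a|a b|b a c]; first by apply/asboolP; exact: Rrefl.
  by apply/asboolP/asboolP; exact: Rsym.
by move=> /asboolP ab /asboolP bc; apply/asboolP; exact: Rtrans ab bc.
Qed.

HB.instance Definition _ := gen_eqMixin term.
HB.instance Definition _ := gen_choiceMixin term.

Canonical leavitt_equiv := EquivRelPack leavitt_rel_equiv.

Definition leavitt : Type := {eq_quot leavitt_equiv}.
HB.instance Definition _ := Choice.on leavitt.

Definition lpi (a : term) : leavitt := \pi_({eq_quot leavitt_equiv}) a.
Definition lrepr (x : leavitt) : term := repr (x : {eq_quot leavitt_equiv}).

Lemma lreprK : cancel lrepr lpi. Proof. by move=> x; apply: reprK. Qed.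

Lemma lpiP a b : lpi a = lpi b <-> leavitt_rel a b.
Proof.
rewrite /lpi; split=> [/eqmodP/asboolP //|ab].
by apply/eqmodP/asboolP.
Qed.

Lemma lrepr_pi a : leavitt_rel (lrepr (lpi a)) a.
Proof. by apply/lpiP; rewrite lreprK. Qed.

Definition leavitt_zero : leavitt := lpi Tzero.
Definition leavitt_opp (x : leavitt) : leavitt := lpi (Topp (lrepr x)).
Definition leavitt_add (x y : leavitt) : leavitt :=
  lpi (Tadd (lrepr x) (lrepr y)).
Definition leavitt_scale (k : K) (x : leavitt) : leavitt :=
  lpi (Tscale k (lrepr x)).
Definition leavitt_mul (x y : leavitt) : leavitt :=
  lpi (Tmul (lrepr x) (lrepr y)).

Lemma leavitt_oppE a : leavitt_opp (lpi a) = lpi (Topp a).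
Proof. by apply/lpiP/Ropp/lrepr_pi. Qed.
Lemma leavitt_addE a b : leavitt_add (lpi a) (lpi b) = lpi (Tadd a b).
Proof. by apply/lpiP/Radd; apply: lrepr_pi. Qed.
Lemma leavitt_scaleE k a : leavitt_scale k (lpi a) = lpi (Tscale k a).
Proof. by apply/lpiP/Rscale/lrepr_pi. Qed.
Lemma leavitt_mulE a b : leavitt_mul (lpi a) (lpi b) = lpi (Tmul a b).
Proof. by apply/lpiP/Rmul; apply: lrepr_pi. Qed.

Definition leavittE := (leavitt_oppE, leavitt_addE, leavitt_scaleE,
  leavitt_mulE).

Lemma leavittW (P : leavitt -> Prop) : (forall a, P (lpi a)) -> forall x, P x.
Proof. by move=> Pa x; rewrite -[x]lreprK. Qed.

Lemma leavitt_addA : associative leavitt_add.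
Proof.
elim/leavittW=> a; elim/leavittW=> b; elim/leavittW=> c.
by rewrite !leavittE; apply/lpiP/RaddA.
Qed.
Lemma leavitt_addC : commutative leavitt_add.
Proof.
by elim/leavittW=> a; elim/leavittW=> b; rewrite !leavittE; apply/lpiP/RaddC.
Qed.
Lemma leavitt_add0 : left_id leavitt_zero leavitt_add.
Proof. by elim/leavittW=> a; rewrite !leavittE; apply/lpiP/Radd0. Qed.
Lemma leavitt_addN : left_inverse leavitt_zero leavitt_opp leavitt_add.
Proof. by elim/leavittW=> a; rewrite !leavittE; apply/lpiP/RaddN. Qed.

HB.instance Definition _ := GRing.isZmodule.Build leavitt
  leavitt_addA leavitt_addC leavitt_add0 leavitt_addN.

Lemma lpiD a b : lpi (Tadd a b) = lpi a + lpi b.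
Proof. exact/esym/leavitt_addE. Qed.

Lemma leavitt_mulA : associative leavitt_mul.
Proof.
elim/leavittW=> a; elim/leavittW=> b; elim/leavittW=> c.
by rewrite !leavittE; apply/lpiP/RmulA.
Qed.
Lemma leavitt_mulDl : left_distributive leavitt_mul +%R.
Proof.
elim/leavittW=> a; elim/leavittW=> b; elim/leavittW=> c.
by rewrite -lpiD !leavittE -lpiD; apply/lpiP/RmulDl.
Qed.
Lemma leavitt_mulDr : right_distributive leavitt_mul +%R.
Proof.
elim/leavittW=> a; elim/leavittW=> b; elim/leavittW=> c.
by rewrite -lpiD !leavittE -lpiD; apply/lpiP/RmulDr.
Qed.

HB.instance Definition _ := Zmodule_isRng.Build leavitt
  leavitt_mulA leavitt_mulDl leavitt_mulDr.

Lemma leavitt_scaleA k l x :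
  leavitt_scale k (leavitt_scale l x) = leavitt_scale (k * l) x.
Proof.
by elim/leavittW: x => a; rewrite !leavittE; apply/lpiP/RscaleA.
Qed.
Lemma leavitt_scale1 : left_id 1 leavitt_scale.
Proof. by elim/leavittW=> a; rewrite !leavittE; apply/lpiP/Rscale1. Qed.
Lemma leavitt_scaleDr : right_distributive leavitt_scale +%R.
Proof.
move=> k; elim/leavittW=> a; elim/leavittW=> b.
by rewrite -lpiD !leavittE -lpiD; apply/lpiP/RscaleDr.
Qed.
Lemma leavitt_scaleDl x : {morph leavitt_scale^~ x : k l / k + l}.
Proof.
by elim/leavittW: x => a k l; rewrite !leavittE -lpiD; apply/lpiP/RscaleDl.
Qed.

HB.instance Definition _ := GRing.Zmodule_isLmodule.Build K leavitt
  leavitt_scaleA leavitt_scale1 leavitt_scaleDr leavitt_scaleDl.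

Definition lvertex (v : vertex E) : leavitt := lpi (Tvertex v).
Definition ledge (e : edge E) : leavitt := lpi (Tedge e).
Definition lghost (e : edge E) : leavitt := lpi (Tghost e).

(* homogeneous n is the degree n component: the least family of subspaces
   compatible with products and containing the generators in the prescribed
   degrees. *)
Inductive homogeneous : int -> leavitt -> Prop :=
| hom_vertex v : homogeneous 0 (lvertex v)
| hom_edge e : homogeneous 1 (ledge e)
| hom_ghost e : homogeneous (- 1) (lghost e)
| hom_zero n : homogeneous n 0
| hom_add n x y : homogeneous n x -> homogeneous n y -> homogeneous n (x + y)
| hom_scale n k x : homogeneous n x -> homogeneous n (k *: x)
| hom_mul m n x y :
    homogeneous m x -> homogeneous n y -> homogeneous (m + n) (x ** y).

(* I is the sum of its homogeneous components. *)
Definition graded_ideal (I : rngIdeal leavitt) : Prop :=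
  forall x, x \in I -> exists s : seq leavitt,
    (forall y, y \in s -> y \in I /\ exists n, homogeneous n y) /\
    x = \sum_(y <- s) y.

End Leavitt.

Arguments leavitt : clear implicits.

Section Ordinals.
Variables (d : Order.disp_t) (T : tbOrderType d).
Local Open Scope order_scope.

(* A well-ordered T with a greatest element stands for the ordinals up to
   tau = \top; its countability amounts to that of tau. *)
Definition well_ordered : Prop := well_founded (fun a b : T => a < b).

Definition is_succ (a b : T) : Prop := a < b /\ ~ exists c, a < c < b.

Definition is_limit (c : T) : Prop := c != \bot /\ ~ exists a, is_succ a c.

(* The ordinals 0, a and a + 1 for a < tau: tau itself is among them unless it
   is a limit. *)
Definition indexes_chain (c : T) : Prop :=
  [\/ c = \bot, c < \top | exists a, is_succ a c].

End Ordinals.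

(* Main.v *)
Require Import Defs.
From HB Require Import structures.
From mathcomp Require Import all_boot all_order all_algebra.
From mathcomp Require Import finmap.
From mathcomp Require Import boolp classical_sets functions cardinality.

(* If L is CIRT and I is a proper graded ideal, let H be the set of vertices in
   I.  Either the quotient graph has (i) a vertex v whose finitely many edges f
   with range outside H leave v - sum f f^* nonzero modulo I, or (ii) a vertex
   from which a single infinite path leaves, or (iii) every vertex outside H
   reaches a bifurcation.  In case (iii) one diagonalises an infinite path whose
   Chen module differs from all members of a countable list of simple modules,
   contradicting CIRT.  In cases (i) and (ii) there is a homogeneous e of degree
   0, idempotent modulo I, with corner K or K[x, x^-1], and (I + L e L) / I is a
   matrix ring over this corner, indexed by monomials ending at e up to units of
   the corner.  Iterating I |-> I + L e L along a Zermelo tower gives the chain,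
   with a single matrix block at each step; every step contributes a new simple
   module, so the chain is countable, and a corner K[x, x^-1] contributes a
   family of simple modules indexed by the nonzero scalars.

   Conversely a simple module S sees exactly one step of the chain, and is
   determined by the annihilator, in the coefficient ring of a block, of a vector
   of S fixed by a diagonal matrix unit.  If E has no cycle, every element of L
   lies in a finite-dimensional subalgebra, so L is strongly pi-regular and no
   block K[x, x^-1] can occur. *)

Set Implicit Arguments.
Unset Strict Implicit.
Unset Printing Implicit Defensive.

Import Order.TTheory GRing.Theory.

(** * Simple modules *)

(** The obstacle is that neither a basis of L nor a description of L / I by a quotient graph is at
    hand. Everything is computed with monomials modulo I, and a vertex counts as present when its
    class in L / I is nonzero. Linear independence comes only from degrees: a graded ideal
    containing a sum of elements of different degrees contains each of them. That a vertex is
    nonzero in L itself has to be known only for a vertex on a closed path, and is read off an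
    action on infinite paths. As L has no unit, a simple module is obtained from a left ideal
    modular for an element e that is idempotent modulo I; e then fixes a nonzero vector, which
    serves to tell modules apart. A cycle makes K countable because a vertex on it enters the chain
    at a successor step, and a block over K admits no new vertex on a closed path, so that step must
    have corner K[x, x^-1]. In the converse the blocks are arbitrary, and the link between cycles
    and blocks over K[x, x^-1] has to be recovered from ring theory: x + 1 is not strongly
    pi-regular. *)

Section ModuleTheory.
Local Open Scope classical_set_scope.
Local Open Scope ring_scope.
Local Open Scope rng_scope.
Variable R : rngType.
Implicit Types (M S T : rngModule R).

Lemma act0r M (r : R) : act r (0 : M) = 0.
Proof. by apply: (addrI (act r 0)); rewrite -actDr !addr0. Qed.

Lemma act0l M (m : M) : act 0 m = 0.
Proof. by apply: (addrI (act 0 m)); rewrite -actDl !addr0. Qed.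

Lemma actNr M (r : R) (m : M) : act r (- m) = - act r m.
Proof. by apply/eqP; rewrite -addr_eq0 -actDr addNr act0r. Qed.

Lemma actNl M (r : R) (m : M) : act (- r) m = - act r m.
Proof. by apply/eqP; rewrite -addr_eq0 -actDl addNr act0l. Qed.

Lemma actBl M (r s : R) (m : M) : act (r - s) m = act r m - act s m.
Proof. by rewrite actDl actNl. Qed.

Lemma actBr M (r : R) (m n : M) : act r (m - n) = act r m - act r n.
Proof. by rewrite actDr actNr. Qed.

Lemma submodule_ann_all M : submodule [set m : M | forall r, act r m = 0].
Proof.
split=> [r|m n hm hn r|r m hm r'] /=; first exact: act0r.
  by rewrite actBr hm hn subr0.
by rewrite hm act0r.
Qed.

Lemma submodule_orbit M (m : M) : submodule [set n | exists r, n = act r m].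
Proof.
split=> [|_ _ [r ->] [s ->]|r _ [s ->]] /=; first by exists 0; rewrite act0l.
  by exists (r - s); rewrite actBl.
by exists (r ** s); rewrite actM.
Qed.

Lemma simple_act_neq0 S (x : S) : simple_module S -> x <> 0 ->
  exists r, act r x <> 0.
Proof.
move=> [[r [m rm]] sub] x0; apply: contrapT => /forallNP hx.
have {}hx r' : act r' x = 0 by apply: contrapT; apply: hx.
have [N0|NT] := sub _ (submodule_ann_all S).
  apply: x0; have : [set m : S | forall r, act r m = 0] x by [].
  by rewrite N0.
apply: rm; have : [set m : S | forall r, act r m = 0] m by rewrite NT.
exact.
Qed.

Lemma simple_gen S (x y : S) : simple_module S -> x <> 0 ->
  exists r, act r x = y.
Proof.
move=> simS x0; have [r rx] := simple_act_neq0 simS x0.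
have [N0|NT] := simS.2 _ (submodule_orbit x).
  exfalso; apply: rx.
  have : [set n | exists r, n = act r x] (act r x) by exists r.
  by rewrite N0.
have [s ys] : [set n | exists r, n = act r x] y by rewrite NT.
by exists s.
Qed.

(** Both modules are R modulo the common annihilator of [s] and [t]; [g] chooses a multiplier for
    each vector, and [annE] makes the choice harmless. *)
Lemma module_iso_of_ann S T (s : S) (t : T) :
  simple_module S -> simple_module T -> s <> 0 -> t <> 0 ->
  (forall r, act r s = 0 <-> act r t = 0) -> module_iso S T.
Proof.
move=> simS simT s0 t0 ann.
have annE r r' : act r s = act r' s <-> act r t = act r' t.
  split=> /eqP; rewrite -subr_eq0 -actBl => /eqP /ann /eqP;
    by rewrite actBl subr_eq0 => /eqP.
have [g gE] := choice (fun x : S => simple_gen x simS s0).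
have fE r : act (g (act r s)) t = act r t by apply/annE; rewrite gE.
have [h hE] := choice (fun y : T => simple_gen y simT t0).
exists (fun x => act (g x) t); split.
- exists (fun y => act (h y) s) => [x|y]; last by rewrite fE hE.
  by rewrite -[RHS]gE; apply/annE; rewrite hE.
- by move=> x y; rewrite -{1}(gE x) -{1}(gE y) -actDl fE actDl.
- by move=> r x; rewrite -{1}(gE x) -actM fE actM.
Qed.

Lemma module_iso_sym S T : module_iso S T -> module_iso T S.
Proof.
move=> [f [[g fK gK] fD fM]]; exists g; split; first by exists f.
  by move=> x y; apply: (can_inj fK); rewrite fD !gK.
by move=> r x; apply: (can_inj fK); rewrite fM !gK.
Qed.

Lemma module_iso_trans S T U : module_iso S T -> module_iso T U ->
  module_iso S U.
Proof.
move=> [f [bf fD fM]] [g [bg gD gM]]; exists (g \o f); split.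
- exact: bij_comp.
- by move=> x y /=; rewrite fD gD.
- by move=> r x /=; rewrite fM gM.
Qed.

Lemma module_iso_refl S : module_iso S S.
Proof. by exists id; split=> //; exists id. Qed.

End ModuleTheory.

Section LeftQuotient.
Local Open Scope classical_set_scope.
Local Open Scope ring_scope.
Local Open Scope rng_scope.
Variable R : rngType.

Definition left_ideal (N : set R) : Prop :=
  [/\ N 0, (forall x y, N x -> N y -> N (x - y)) & forall r x, N x -> N (r ** x)].

Variables (N : set R) (lN : left_ideal N).

Definition left_pred of left_ideal N : {pred R} := fun x => `[< N x >].

Lemma left_pred_zmod_closed : zmod_closed (left_pred lN).
Proof.
have [N0 NB _] := lN; split=> [|x y /asboolP Nx /asboolP Ny]; apply/asboolP => //.
exact: NB.
Qed.
HB.instance Definition _ :=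
  GRing.isZmodClosed.Build R (left_pred lN) left_pred_zmod_closed.

Definition left_quot : Type := Quotient.quot (left_pred lN).
HB.instance Definition _ := GRing.Zmodule.on left_quot.

Definition left_pi (x : R) : left_quot :=
  (\pi_(Quotient.quot (left_pred lN)) x)%qT.
Definition left_repr (x : left_quot) : R :=
  repr (x : Quotient.quot (left_pred lN)).

Lemma left_reprK : cancel left_repr left_pi.
Proof. by move=> x; apply: reprK. Qed.

Lemma left_piP x y : left_pi x = left_pi y <-> N (x - y).
Proof.
have -> : N (x - y) = (x - y \in left_pred lN) :> Prop by rewrite -(asboolE (N _)).
by rewrite Quotient.idealrBE; split=> /eqP.
Qed.

Lemma left_piD : {morph left_pi : x y / x + y}.
Proof. exact: (@Quotient.pi_add R (left_pred lN)). Qed.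

Definition left_act r (m : left_quot) : left_quot :=
  left_pi (r ** left_repr m).

Lemma left_actE r x : left_act r (left_pi x) = left_pi (r ** x).
Proof.
have [_ _ NM] := lN; apply/left_piP; rewrite -rmulBr; apply: NM.
by apply/left_piP; rewrite left_reprK.
Qed.

Lemma left_actDr r : {morph left_act r : m n / m + n}.
Proof.
move=> m n; rewrite -[m]left_reprK -[n]left_reprK -left_piD !left_actE.
by rewrite rmulDr left_piD.
Qed.

Lemma left_actDl m : {morph left_act^~ m : r s / r + s}.
Proof.
by move=> r s; rewrite -[m]left_reprK !left_actE rmulDl left_piD.
Qed.

Lemma left_actM r s m : left_act (r ** s) m = left_act r (left_act s m).
Proof. by rewrite -[m]left_reprK !left_actE rmulA. Qed.

Definition left_module : rngModule R :=
  RngModule left_actDr left_actDl left_actM.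

End LeftQuotient.

Section Modular.
Local Open Scope classical_set_scope.
Local Open Scope ring_scope.
Local Open Scope rng_scope.
Variable R : rngType.

(* The condition on [e] makes R / N a cyclic module generated by the class of
   [e], so that any left ideal over N avoiding [e] lies in a maximal one. *)
Lemma simple_of_modular (N : set R) (e : R) :
  left_ideal N -> (forall x, N (x - x ** e)) -> ~ N e ->
  exists (S : rngModule R) (x : S),
    [/\ simple_module S, x <> 0, (forall r, N r -> act r x = 0) & act e x = x].
Proof.
move=> lN mod_e Ne.
pose P (A : set R) := [/\ left_ideal A, N `<=` A & ~ A e] \/ A = set0.
have [F FP Ftot|M [[]]] := @Zorn_bigcup R P.
- have [[A FA [x Ax]]|F0] := pselect (exists2 A, F A & A !=set0); last first.
    right; rewrite -subset0 => x [A FA Ax]; apply: F0; exists A => //.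
    by exists x.
  have lF B x' : F B -> B x' -> [/\ left_ideal B, N `<=` B & ~ B e].
    by move=> /FP[//|->].
  have [[A0 _ _] NA _] := lF _ _ FA Ax.
  left; split; last by move=> [B FB Be]; have [_ _] := lF _ _ FB Be; apply.
    split; first by exists A.
      move=> y z [B FB By] [C FC Cz].
      have [[_ Bsub _] _ _] := lF _ _ FB By; have [[_ Csub _] _ _] := lF _ _ FC Cz.
      have [BC|CB] := Ftot _ _ FB FC.
        by exists C => //; apply: Csub => //; apply: BC.
      by exists B => //; apply: Bsub => //; apply: CB.
    move=> r y [B FB By]; exists B => //.
    by have [[_ _ BM] _ _] := lF _ _ FB By; apply: BM.
  by move=> y Ny; exists A => //; apply: NA.
- move=> [lM NM Me] maxM; exists (left_module lM), (left_pi lM e : left_module lM).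
  have pi0 x : left_pi lM x = 0 <-> M x.
    have -> : 0 = left_pi lM 0 :> left_quot lM.
      by apply: (addrI (left_pi lM 0)); rewrite -left_piD !addr0.
    by rewrite left_piP subr0.
  have [M0 MB MM] := lM.
  have ee x : left_act x (left_pi lM e) = left_pi lM x.
    rewrite left_actE; apply/left_piP; rewrite -opprB -[- _]sub0r.
    by apply: MB => //; apply: NM.
  split=> //=; last 1 first.
  + by move=> r Nr; rewrite ee; apply/pi0; apply: NM.
  + split; first by exists e, (left_pi lM e); rewrite /= ee => /pi0.
    move=> A [A0 AB AM].
    pose B := [set x | A (left_pi lM x)].
    have lB : left_ideal B.
      split; rewrite /B /=; first by have -> : left_pi lM 0 = 0 by apply/pi0.
        move=> x y Ax Ay; have -> : left_pi lM (x - y) = left_pi lM x - left_pi lM y.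
          by apply/eqP; rewrite eq_sym subr_eq -left_piD subrK.
        exact: AB.
      by move=> r x Ax; rewrite -left_actE; apply: AM.
    have MB' : M `<=` B by move=> x /pi0; rewrite /B /= => ->.
    have [Be|nBe] := pselect (B e).
      right; apply/seteqP; split=> // x _; rewrite -[x](left_reprK).
      by rewrite -ee; apply: AM.
    left; apply/seteqP; split=> [x Ax|_ ->] //=.
    rewrite -[x](left_reprK); apply/pi0; apply: contrapT => Mx.
    apply: (maxM B); last by left; split=> //; exact: subset_trans MB'.
    split=> // /(_ (left_repr x)) BM; apply: Mx; apply: BM.
    by rewrite /B /= left_reprK.
  + by move/pi0.
- move=> M0 maxM; exfalso; apply: (maxM N); last by left; split.
  by rewrite M0; split=> // /(_ 0); apply; have [N0 _ _] := lN.
Qed.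

End Modular.

Section CountableClasses.
Local Open Scope classical_set_scope.
Variable R : rngType.
Implicit Types (P : rngModule R -> Prop) (S T : rngModule R).

(* A code determines the isomorphism class, but a module may have many codes. *)
Definition countably_many P : Prop :=
  exists code : rngModule R -> nat -> Prop,
    (forall S, P S -> exists n, code S n) /\
    (forall S T n, P S -> P T -> code S n -> code T n -> module_iso S T).

Lemma countably_many_rel P (C : Type) (code : rngModule R -> C -> Prop) :
  countable [set: C] -> (forall S, P S -> exists c, code S c) ->
  (forall S T c, P S -> P T -> code S c -> code T c -> module_iso S T) ->
  countably_many P.
Proof.
move=> /countable_injP[f f_inj] cE cI.
exists (fun S n => exists2 c, code S c & n = f c); split.
  by move=> S /cE[c Sc]; exists (f c); exists c.
move=> S T n PS PT [c Sc ->] [d Td] /f_inj; rewrite !inE => /(_ I I) cd.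
by apply: (cI S T c) => //; rewrite cd.
Qed.

Lemma countably_many_bigcup P (I : Type) (Q : I -> rngModule R -> Prop) :
  countable [set: I] -> (forall i, countably_many (Q i)) ->
  (forall S, P S -> exists i, Q i S) -> countably_many P.
Proof.
move=> cI cQ PQ; have [code hcode] := choice cQ.
apply: (@countably_many_rel P (I * nat)%type
    (fun S c => Q c.1 S /\ code c.1 S c.2)).
- by rewrite -setXTT; apply: countableX.
- by move=> S /PQ[i QiS]; have [n] := (hcode i).1 S QiS; exists (i, n).
- move=> S T [i n] _ _ /= [QS cS] [QT cT].
  exact: (hcode i).2 QS QT cS cT.
Qed.

(** A code need not be constant on an isomorphism class, so [F S] is the least code of a simple
    module isomorphic to [S]. *)
Lemma CIRT_of_countably_many :
  countably_many (@simple_module R) -> CIRT R.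
Proof.
move=> [code [cE cI]].
pose D S n := exists T, [/\ simple_module T, module_iso S T & code T n].
have minD S : exists m, simple_module S -> D S m /\ forall n, D S n -> m <= n.
  have [/cE[n Sn]|nS] := pselect (simple_module S); last by exists 0.
  have [simS|nS] := pselect (simple_module S); last by exists 0.
  have DS : exists n, `[< D S n >].
    by exists n; apply/asboolP; exists S; split=> //; apply: module_iso_refl.
  case: (ex_minnP DS) => m /asboolP Dm mmin; exists m => _; split=> // k Dk.
  by apply: mmin; apply/asboolP.
have [F hF] := choice minD; exists F => S T simS simT; split.
  have [[S' [sS' SS' S'n]] _] := hF S simS.
  have [[T' [sT' TT' T'n]] _] := hF T simT => FST.
  apply: module_iso_trans SS' _; apply: module_iso_trans (module_iso_sym TT').
  by apply: (cI S' T' (F S)) => //; rewrite FST.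
move=> ST; have DST n : D S n <-> D T n.
  split=> -[U [sU iU Un]]; exists U; split=> //; apply: module_iso_trans iU => //.
  exact: module_iso_sym.
have [DS Smin] := hF S simS; have [DT Tmin] := hF T simT.
by apply/eqP; rewrite eqn_leq Smin ?Tmin //; apply/DST.
Qed.

End CountableClasses.

(** * Towers of sets *)

(* Zermelo's tower: the sets obtained from [A0] by iterating [next] and taking
   unions, which inclusion well-orders without any appeal to ordinals. *)
Section Tower.
Local Open Scope classical_set_scope.
Variables (U : Type) (A0 : set U) (next : set U -> set U).
Hypothesis next_ext : forall A, A `<=` next A.

Inductive tower : set U -> Prop :=
| tower_next A : tower A -> tower (next A)
| tower_union (C : set (set U)) :
    (forall A, C A -> tower A) -> tower (A0 `|` \bigcup_(A in C) A).

Lemma tower_bottom : tower A0.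
Proof.
have -> : A0 = A0 `|` \bigcup_(A in set0) A by rewrite bigcup_set0 setU0.
by apply: tower_union.
Qed.

Lemma tower_ge A : tower A -> A0 `<=` A.
Proof.
elim=> [B _ IH|C _ _]; last by left.
exact: subset_trans IH (@next_ext B).
Qed.

(** The extreme elements of the Bourbaki-Witt argument. An extreme element of the tower is
    comparable with all others in the strong form of [extreme_cmp], and an induction shows that all
    elements are extreme. *)
Let extreme C := forall A, tower A -> A `<=` C -> A <> C -> next A `<=` C.

Let extreme_cmp C A : tower C -> extreme C -> tower A ->
  A `<=` C \/ next C `<=` A.
Proof.
move=> tC eC; elim=> [B tB [BC|CB]|D tD IH].
- have [->|BneC] := pselect (B = C); first by right.
  by left; apply: eC.
- by right; apply: subset_trans CB (@next_ext B).
- have [[B DB CB]|noB] := pselect (exists2 B, D B & next C `<=` B).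
    by right=> x /CB Bx; right; exists B.
  left=> x [A0x|[B DB Bx]]; first exact: tower_ge A0x.
  by have [BC|CB] := IH B DB; [apply: BC | case: noB; exists B].
Qed.

Let tower_extreme C : tower C -> extreme C.
Proof.
elim=> [B tB eB A tA AnB AneB|D tD IH A tA AD AneD].
  have [AB|BA] := extreme_cmp tB eB tA.
    have [->//|AneB'] := pselect (A = B).
    exact: subset_trans (eB _ tA AB AneB') (@next_ext B).
  by case: AneB; apply/seteqP.
have [[B DB nBA]|noB] := pselect (exists2 B, D B & ~ (B `<=` A)).
  have [AB|BA] := extreme_cmp (tD _ DB) (IH _ DB) tA.
    move=> x Ax; right; exists B => //; apply: (IH B DB A tA AB) Ax => AB'.
    by apply: nBA; rewrite AB'.
  by case: nBA; apply: subset_trans BA; apply: next_ext.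
case: AneD; apply/seteqP; split=> // x [A0x|[B DB Bx]]; first exact: tower_ge A0x.
by apply: contrapT => Ax; apply: noB; exists B => // /(_ x Bx).
Qed.

Lemma tower_cmp A B : tower A -> tower B -> A `<=` B \/ next B `<=` A.
Proof. by move=> tA tB; apply: extreme_cmp => //; apply: tower_extreme. Qed.

Lemma tower_total A B : tower A -> tower B -> A `<=` B \/ B `<=` A.
Proof.
move=> tA tB; have [|BA] := tower_cmp tA tB; [by left | right].
exact: subset_trans (@next_ext B) BA.
Qed.

(** What lies strictly below [next B] lies below or equals [B]; what lies strictly below a union
    fails to contain some member and so lies strictly below that member. Accessibility is inherited
    in both cases. *)
Lemma tower_wf A : tower A -> Acc (fun A B => tower A /\ A `<` B) A.
Proof.
elim=> [B tB IH|D tD IH]; constructor=> C [tC CB].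
  have [CsubB|BC] := tower_cmp tC tB; last by have := CB.2 BC.
  have [->//|CneB] := pselect (C = B); apply: (Acc_inv IH); split=> //.
  by split=> // BC; apply: CneB; apply/seteqP.
have [[B DB nBC]|noB] := pselect (exists2 B, D B & ~ (B `<=` C)).
  have CsubB : C `<=` B by have [|BC] := tower_total tC (tD _ DB).
  by apply: (Acc_inv (IH _ DB)).
exfalso; apply: CB.2 => x [A0x|[B DB Bx]]; first exact: tower_ge A0x.
by apply: contrapT => Cx; apply: noB; exists B => // /(_ x Bx).
Qed.

Record tower_type := TowerType { tower_val :> set U; towerP : tower tower_val }.

Lemma tower_type_inj (a b : tower_type) : tower_val a = tower_val b -> a = b.
Proof.
by case: a b => [A tA] [B tB] /= AB; subst B; rewrite (Prop_irrelevance tA tB).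
Qed.

HB.instance Definition _ := gen_eqMixin tower_type.
HB.instance Definition _ := gen_choiceMixin tower_type.

Definition tower_le (a b : tower_type) : bool := `[< tower_val a `<=` tower_val b >].

Lemma tower_le_anti : antisymmetric tower_le.
Proof.
move=> a b /andP[/asboolP ab /asboolP ba]; apply: tower_type_inj.
exact/seteqP.
Qed.

Lemma tower_le_trans : transitive tower_le.
Proof.
move=> b a c /asboolP ab /asboolP bc; apply/asboolP.
exact: subset_trans ab bc.
Qed.

Lemma tower_le_total : total tower_le.
Proof.
move=> a b; have [ab|ba] := tower_total (towerP a) (towerP b); apply/orP;
  [left | right]; exact/asboolP.
Qed.

Fact tower_display : Order.disp_t. Proof. exact: (Order.Disp tt tt). Qed.

HB.instance Definition _ := Order.Le_isPOrder.Build tower_display tower_type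
  (fun a => asboolT (@subset_refl _ a)) tower_le_anti tower_le_trans.

HB.instance Definition _ := Order.POrder_isTotal.Build tower_display tower_type
  tower_le_total.

Definition tower_bot : tower_type := TowerType tower_bottom.
Definition tower_top : tower_type := TowerType (@tower_union tower (fun A tA => tA)).

Lemma tower_bot_le a : (tower_bot <= a)%O.
Proof. by apply/asboolP; apply: tower_ge; apply: towerP. Qed.

Lemma tower_le_top a : (a <= tower_top)%O.
Proof.
by apply/asboolP => x ax; right; exists (tower_val a) => //; apply: towerP.
Qed.

HB.instance Definition _ := Order.hasBottom.Build tower_display tower_type tower_bot_le.
HB.instance Definition _ := Order.hasTop.Build tower_display tower_type tower_le_top.

Definition tower_order : tbOrderType tower_display := tower_type.

Lemma tower_leP (a b : tower_type) : reflect (a `<=` b) (a <= b)%O.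
Proof. exact: asboolP. Qed.

Lemma tower_ltP (a b : tower_type) : reflect (a `<` b) (a < b)%O.
Proof.
rewrite lt_neqAle; apply: (iffP andP) => [[/eqP ab /tower_leP leab]|[ab nba]].
  by split=> // ba; apply: ab; apply: tower_type_inj; apply/seteqP.
split; last exact/tower_leP.
by apply/eqP => eqab; apply: nba; rewrite eqab.
Qed.

Lemma tower_well_ordered : well_ordered tower_type.
Proof.
case=> A tA; have accA := tower_wf tA.
elim: accA tA => {}A _ IH tA; constructor; case=> B tB /tower_ltP /= BA.
exact: IH.
Qed.

Lemma tower_succ (a b : tower_type) :
  ~ (next a `<=` a) -> is_succ a b -> b = TowerType (tower_next (towerP a)).
Proof.
move=> na [/tower_ltP[ab nba] noc].
have [ba|nab] := tower_cmp (towerP b) (towerP a); first by case: nba.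
apply/eqP/negP => /negP neq; apply: noc.
exists (TowerType (tower_next (towerP a))); apply/andP; split.
  by apply/tower_ltP; split; [apply: next_ext | exact: na].
by rewrite lt_neqAle eq_sym neq; apply/tower_leP.
Qed.

Lemma tower_limit (c : tower_type) : is_limit c ->
  forall x, tower_val c x <-> exists2 a : tower_type, (a < c)%O & tower_val a x.
Proof.
move=> [cbot nosucc] x; split; last first.
  by move=> [a /tower_ltP[ac _]]; apply: ac.
(* [u] is the supremum of the elements strictly below [c]. If [u] differed from [c], then [c] would
   be the immediate successor of [u]. *)
pose C := [set A | tower A /\ A `<` c].
have tC A : C A -> tower A by case.
pose u := TowerType (tower_union tC).
have uc : (u <= c)%O.
  apply/tower_leP => y [A0y|[A [_ [Ac _]] /Ac]] //.
  by apply: tower_ge A0y; apply: towerP.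
have [cu|neq] := eqVneq c u.
  rewrite {1}cu => -[A0x|[A [tA Ac] Ax]]; last first.
    by exists (TowerType tA) => //; apply/tower_ltP.
  exists tower_bot => //.
  by rewrite lt_neqAle eq_sym cbot /=; apply: tower_bot_le.
exfalso; apply: nosucc; exists u; split; first by rewrite lt_neqAle eq_sym neq.
move=> [b /andP[ub /tower_ltP bc]]; move/tower_ltP: ub => [_]; apply.
by move=> y By; right; exists b => //; split=> //; apply: towerP.
Qed.

Lemma tower_indexes_top : ~ indexes_chain (\top : tower_type)%O ->
  is_limit (\top : tower_type)%O.
Proof.
move=> nidx; split.
  by apply/eqP => tb; apply: nidx; constructor 1.
by move=> hs; apply: nidx; constructor 3.
Qed.

(** The top is the union of the whole tower, so it contains its own successor. *)
Lemma tower_top_full :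
  (forall A, tower A -> A <> setT -> ~ (next A `<=` A)) ->
  tower_val tower_top = setT.
Proof.
move=> nextN; apply: contrapT => nT.
apply: (nextN _ (towerP tower_top) nT) => x nx; right.
by exists (next tower_top) => //; apply: tower_next; apply: towerP.
Qed.

End Tower.

Section RngSums.
Local Open Scope ring_scope.
Local Open Scope rng_scope.
Variable R : rngType.

Lemma rmul_suml (I : Type) (s : seq I) (P : pred I) (F : I -> R) (y : R) :
  (\sum_(i <- s | P i) F i) ** y = \sum_(i <- s | P i) (F i ** y).
Proof.
exact: (big_morph (fun x => x ** y) (fun a b => rmulDl a b y) (rmul0l y)).
Qed.

Lemma rmul_sumr (I : Type) (s : seq I) (P : pred I) (F : I -> R) (x : R) :
  x ** (\sum_(i <- s | P i) F i) = \sum_(i <- s | P i) (x ** F i).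
Proof. exact: (big_morph (rmul x) (rmulDr x) (rmul0r x)). Qed.

End RngSums.

(** * Monomials and the grading of a Leavitt path algebra *)

Section LeavittBasics.
Local Open Scope classical_set_scope.
Local Open Scope ring_scope.
Local Open Scope rng_scope.
Variables (K : fieldType) (E : graph).
Local Notation L := (leavitt K E).
Local Notation V := (@lvertex K E).
Local Notation Ed := (@ledge K E).
Local Notation Gh := (@lghost K E).
Implicit Types (x y z : L) (v w : vertex E) (e f : edge E) (r s t : seq (edge E)).

Lemma lpiM a b : lpi (Tmul a b) = lpi a ** lpi b :> L.
Proof. exact/esym/leavitt_mulE. Qed.
Lemma lpiZ k a : lpi (Tscale k a) = k *: lpi a :> L.
Proof. exact/esym/leavitt_scaleE. Qed.
Lemma lpiN a : lpi (Topp a) = - (lpi a) :> L.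
Proof. exact/esym/leavitt_oppE. Qed.
Lemma lpi0 : lpi (Tzero K E) = 0 :> L. Proof. by []. Qed.

Lemma lscaleAl (k : K) x y : (k *: x) ** y = k *: (x ** y).
Proof.
elim/leavittW: x => a; elim/leavittW: y => b.
by rewrite -(lpiZ k a) -!lpiM -lpiZ; apply/esym/lpiP/RscaleMl.
Qed.
Lemma lscaleAr (k : K) x y : x ** (k *: y) = k *: (x ** y).
Proof.
elim/leavittW: x => a; elim/leavittW: y => b.
by rewrite -(lpiZ k b) -!lpiM -lpiZ; apply/esym/lpiP/RscaleMr.
Qed.

Lemma VV v : V v ** V v = V v.
Proof. by rewrite -lpiM; apply/lpiP/Rvertex. Qed.
Lemma VV0 v w : v != w -> V v ** V w = 0.
Proof. by move=> /eqP vw; rewrite -lpiM; apply/lpiP/Rvertex0. Qed.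
Lemma VEd e : V (src e) ** Ed e = Ed e.
Proof. by rewrite -lpiM; apply/lpiP/Rsrc_edge. Qed.
Lemma EdV e : Ed e ** V (rge e) = Ed e.
Proof. by rewrite -lpiM; apply/lpiP/Redge_rge. Qed.
Lemma VGh e : V (rge e) ** Gh e = Gh e.
Proof. by rewrite -lpiM; apply/lpiP/Rrge_ghost. Qed.
Lemma GhV e : Gh e ** V (src e) = Gh e.
Proof. by rewrite -lpiM; apply/lpiP/Rghost_src. Qed.
Lemma GhEd e : Gh e ** Ed e = V (rge e).
Proof. by rewrite -lpiM; apply/lpiP/Rghost_edge. Qed.
Lemma GhEd0 e f : e != f -> Gh e ** Ed f = 0.
Proof. by move=> /eqP ef; rewrite -lpiM; apply/lpiP/Rghost_edge0. Qed.
Lemma VEd0 v e : v != src e -> V v ** Ed e = 0.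
Proof. by move=> ve; rewrite -VEd rmulA VV0 // rmul0l. Qed.
Lemma EdV0 e v : rge e != v -> Ed e ** V v = 0.
Proof. by move=> ve; rewrite -EdV -rmulA VV0 // rmul0r. Qed.
Lemma GhV0 e v : src e != v -> Gh e ** V v = 0.
Proof. by move=> ve; rewrite -GhV -rmulA VV0 // rmul0r. Qed.
Lemma VGh0 v e : v != rge e -> V v ** Gh e = 0.
Proof. by move=> ve; rewrite -VGh rmulA VV0 // rmul0l. Qed.

(* [pth l w] is the product of the edges of [l] followed by the vertex [w], and
   [gth l w] is its image under the involution; both vanish unless [l] is a
   path ending at [w]. *)
Fixpoint pth l w : L := if l is e :: l' then Ed e ** pth l' w else V w.
Fixpoint gth l w : L := if l is e :: l' then gth l' w ** Gh e else V w.

Definition start l w : vertex E := if l is e :: _ then src e else w.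
Fixpoint ispath l w : bool :=
  if l is e :: l' then (rge e == start l' w) && ispath l' w else true.

Lemma pthV l w : pth l w ** V w = pth l w.
Proof. by elim: l => [|e l IH] /=; rewrite ?VV // -rmulA IH. Qed.
Lemma Vgth l w : V w ** gth l w = gth l w.
Proof. by elim: l => [|e l IH] /=; rewrite ?VV // rmulA IH. Qed.
Lemma Vpth l w : V (start l w) ** pth l w = pth l w.
Proof. by case: l => [|e l] /=; rewrite ?VV // rmulA VEd. Qed.
Lemma gthV l w : gth l w ** V (start l w) = gth l w.
Proof. by case: l => [|e l] /=; rewrite ?VV // -rmulA GhV. Qed.
Lemma Vpth0 v l w : v != start l w -> V v ** pth l w = 0.
Proof. by move=> vl; rewrite -Vpth rmulA VV0 // rmul0l. Qed.
Lemma gthV0 v l w : start l w != v -> gth l w ** V v = 0.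
Proof. by move=> vl; rewrite -gthV -rmulA VV0 // rmul0r. Qed.

Lemma ispath_pth0 l w : ~~ ispath l w -> pth l w = 0.
Proof.
elim: l => //= e l IH; rewrite negb_and => /orP[re|/IH ->]; last by rewrite rmul0r.
by rewrite -Vpth rmulA EdV0 // rmul0l.
Qed.
Lemma ispath_gth0 l w : ~~ ispath l w -> gth l w = 0.
Proof.
elim: l => //= e l IH; rewrite negb_and => /orP[re|/IH ->]; last by rewrite rmul0l.
by rewrite -gthV -rmulA VGh0 1?eq_sym // rmul0r.
Qed.

Lemma start_cat r t w : start (r ++ t) w = start r (start t w).
Proof. by case: r. Qed.
Lemma ispath_cat r t w : ispath (r ++ t) w = ispath r (start t w) && ispath t w.
Proof. by elim: r => //= e r ->; rewrite start_cat andbA. Qed.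

Lemma pth_cat r t w : pth (r ++ t) w = pth r (start t w) ** pth t w.
Proof. by elim: r => [|e r IH] /=; rewrite ?Vpth // IH rmulA. Qed.
Lemma gth_cat r t w : gth (r ++ t) w = gth t w ** gth r (start t w).
Proof. by elim: r => [|e r IH] /=; rewrite ?gthV // IH rmulA. Qed.

Lemma gth_pth_catr s t w w' : ispath s w ->
  gth s w ** pth (s ++ t) w' = V w ** pth t w'.
Proof.
elim: s => //= e s IH /andP[/eqP re ps].
rewrite -rmulA (rmulA (Gh e)) GhEd rmulA re gthV; exact: IH.
Qed.
Lemma gth_pth_catl s t w w' : ispath s w ->
  gth (s ++ t) w' ** pth s w = gth t w' ** V w.
Proof.
elim: s => //= e s IH /andP[/eqP re ps].
rewrite -rmulA (rmulA (Gh e)) GhEd re Vpth; exact: IH.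
Qed.
Lemma gth_pth s w : ispath s w -> gth s w ** pth s w = V w.
Proof. by move=> ps; rewrite -{2}[s]cats0 gth_pth_catr //= VV. Qed.

(** Ghost edges cancel against edges from the middle outwards, until a mismatch gives 0 or one of
    the words is used up. What remains is the unmatched tail of the longer word. *)
Lemma gth_pth_cases s r w w' :
  [\/ gth s w ** pth r w' = 0,
      exists t, [/\ r = s ++ t, ispath s w, w = start t w' &
                    gth s w ** pth r w' = pth t w'] |
      exists t, [/\ s = r ++ t, ispath r w', w' = start t w &
                    gth s w ** pth r w' = gth t w]].
Proof.
have [ps|/ispath_gth0 ->] := boolP (ispath s w); last by constructor 1; rewrite rmul0l.
have [pr|/ispath_pth0 ->] := boolP (ispath r w'); last by constructor 1; rewrite rmul0r.
have [/prefixP[t rE]|nsr] := boolP (prefix s r).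
  have := gth_pth_catr t w' ps; rewrite -rE => ->.
  have [wE|ne] := eqVneq w (start t w'); last by constructor 1; exact: Vpth0.
  by constructor 2; exists t; split=> //; rewrite wE Vpth.
have [/prefixP[t sE]|nrs] := boolP (prefix r s).
  have := gth_pth_catl t w pr; rewrite -sE => ->.
  have [wE|ne] := eqVneq w' (start t w).
    by constructor 3; exists t; split=> //; rewrite wE gthV.
  by constructor 1; apply: gthV0; rewrite eq_sym.
constructor 1; elim: s r ps pr nsr nrs => [|e s IH] [|f r] //=.
move=> /andP[/eqP re ps] /andP[/eqP rf pr]; rewrite -rmulA (rmulA (Gh e)).
have [<-|ef] := eqVneq e f; last by rewrite GhEd0 // rmul0l rmul0r.
by rewrite GhEd rmulA re gthV; apply: IH.
Qed.

Definition mon r w s : L := pth r w ** gth s w.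

Lemma pth_mul r w t w' :
  pth r w ** pth t w' = if w == start t w' then pth (r ++ t) w' else 0.
Proof.
have [->|ne] := eqVneq; first by rewrite pth_cat.
by rewrite -(pthV r w) -(Vpth t w') -rmulA (rmulA (V w)) VV0 // rmul0l rmul0r.
Qed.
Lemma gth_mul r w t w' :
  gth r w ** gth t w' = if start r w == w' then gth (t ++ r) w else 0.
Proof.
have [<-|ne] := eqVneq; first by rewrite gth_cat.
by rewrite -(gthV r w) -(Vgth t w') -rmulA (rmulA (V _) (V w')) VV0 // rmul0l rmul0r.
Qed.

Lemma mon_mul r w s r' w' s' :
  mon r w s ** mon r' w' s' = 0 \/
  exists r'' w'' s'', mon r w s ** mon r' w' s' = mon r'' w'' s''.
Proof.
rewrite /mon -rmulA (rmulA (gth s w)).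
have [->|[t [_ _ wE ->]]|[t [_ _ wE ->]]] := gth_pth_cases s r' w w'.
- by left; rewrite rmul0l rmul0r.
- right; exists (r ++ t), w', s'.
  by rewrite rmulA pth_mul wE eqxx.
- right; exists r, w, (s' ++ t).
  by rewrite gth_mul wE eqxx.
Qed.

Inductive mon_span : L -> Prop :=
| mon_span0 : mon_span 0
| mon_spanD x y : mon_span x -> mon_span y -> mon_span (x + y)
| mon_spanZ (k : K) r w s : mon_span (k *: mon r w s).

Lemma mon_span_scale (k : K) x : mon_span x -> mon_span (k *: x).
Proof.
elim=> [|y z _ IHy _ IHz|l r w s]; first by rewrite scaler0; exact: mon_span0.
  by rewrite scalerDr; exact: mon_spanD.
by rewrite scalerA; exact: mon_spanZ.
Qed.

Lemma mon_span_mul x y : mon_span x -> mon_span y -> mon_span (x ** y).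
Proof.
move=> sx sy; elim: sx => [|a b _ IHa _ IHb|k r w s].
- by rewrite rmul0l; exact: mon_span0.
- by rewrite rmulDl; exact: mon_spanD.
elim: sy => [|a b _ IHa _ IHb|l r' w' s'].
- by rewrite rmul0r; exact: mon_span0.
- by rewrite rmulDr; exact: mon_spanD.
rewrite lscaleAl lscaleAr; do 2 apply: mon_span_scale.
have [->|[r'' [w'' [s'' ->]]]] := mon_mul r w s r' w' s'; first exact: mon_span0.
by rewrite -[mon _ _ _]scale1r; exact: mon_spanZ.
Qed.

Lemma mon_spanP x : mon_span x.
Proof.
have mon1 r w s : mon_span (mon r w s).
  by rewrite -[mon _ _ _]scale1r; exact: mon_spanZ.
elim/leavittW: x; elim=> [v|e|e||a IH|a IHa b IHb|k a IH|a IHa b IHb].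
- by have := mon1 [::] v [::]; rewrite /mon /= VV.
- by have := mon1 [:: e] (rge e) [::]; rewrite /mon /= !EdV.
- by have := mon1 [::] (rge e) [:: e]; rewrite /mon /= !VGh.
- exact: mon_span0.
- by rewrite lpiN -scaleN1r; exact: mon_span_scale.
- by rewrite lpiD; exact: mon_spanD.
- by rewrite lpiZ; exact: mon_span_scale.
- by rewrite lpiM; exact: mon_span_mul.
Qed.

Lemma leavitt_ind (P : L -> Prop) : P 0 -> (forall x y, P x -> P y -> P (x + y)) ->
  (forall k r w s, P (k *: mon r w s)) -> forall x, P x.
Proof.
move=> P0 PD PZ x; elim: (mon_spanP x) => [//|y z _ Py _ Pz|k r w s]; last exact: PZ.
exact: PD.
Qed.

Lemma local_unit x : exists u : L, u ** x = x /\ x ** u = x.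
Proof.
pose eU (U : {fset vertex E}) : L := \sum_(v <- U) V v.
have eUl U v x' : v \in U -> V v ** x' = x' -> eU U ** x' = x'.
  move=> vU vx; rewrite -{1}vx rmulA rmul_suml (big_fsetD1 v) //= VV.
  rewrite big_seq big1 ?addr0 // => w; rewrite !inE => /andP[/VV0 //].
have eUr U v x' : v \in U -> x' ** V v = x' -> x' ** eU U = x'.
  move=> vU vx; rewrite -{1}vx -rmulA rmul_sumr (big_fsetD1 v) //= VV.
  rewrite big_seq big1 ?addr0 // => w; rewrite !inE => /andP[wv _].
  by rewrite VV0 // eq_sym.
(* The claim is made for every larger set of vertices, so that the sets found for two summands can
   be joined. *)
suff [U hU] : exists U : {fset vertex E}, forall W : {fset vertex E},
    (U `<=` W)%fset -> eU W ** x = x /\ x ** eU W = x.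
  by exists (eU U); apply: hU.
elim/leavitt_ind: x => [|x y [U hU] [U' hU']|k r w s].
- by exists fset0 => W _; rewrite rmul0l rmul0r.
- exists (U `|` U')%fset => W; rewrite fsubUset => /andP[/hU[xl xr] /hU'[yl yr]].
  by rewrite rmulDr rmulDl xl yl xr yr.
- exists [fset start r w; start s w]%fset => W /fsubsetP sW.
  rewrite lscaleAl lscaleAr /mon; split; congr (_ *: _).
    by apply: (eUl _ (start r w)); rewrite ?sW ?inE ?eqxx // rmulA Vpth.
  by apply: (eUr _ (start s w)); rewrite ?sW ?inE ?eqxx ?orbT // -rmulA gthV.
Qed.

(** An ideal is only assumed to be closed under ring operations; a local unit [u] turns scaling into
    left multiplication by [k *: u]. *)
Lemma ideal_scale (I : rngIdeal L) (k : K) x : x \in I -> k *: x \in I.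
Proof.
move=> xI; have [u [ux _]] := local_unit x.
by rewrite -ux -lscaleAl; apply: rng_idealMl.
Qed.

(* L acts on the functions from int to L, an edge raising degrees by one; in
   this way the grading is seen to be a direct sum. *)
Fixpoint tact (a : term K E) (g : int -> L) : int -> L :=
  match a with
  | Tvertex v => fun n => V v ** g n
  | Tedge e => fun n => Ed e ** g (n - 1)
  | Tghost e => fun n => Gh e ** g (n + 1)
  | Tzero => fun n => 0
  | Topp a => fun n => - tact a g n
  | Tadd a b => fun n => tact a g n + tact b g n
  | Tscale k a => fun n => k *: tact a g n
  | Tmul a b => tact a (tact b g)
  end.

Lemma eq_tact a g h : g =1 h -> tact a g =1 tact a h.
Proof.
elim: a g h => [v|e|e||a IH|a IHa b IHb|k a IH|a IHa b IHb] g h gh n //=.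
- by rewrite gh.
- by rewrite gh.
- by rewrite gh.
- by rewrite (IH g h).
- by rewrite (IHa g h) // (IHb g h).
- by rewrite (IH g h).
- by apply: IHa => m; apply: IHb.
Qed.

Lemma tactD a g h n : tact a (fun m => g m + h m) n = tact a g n + tact a h n.
Proof.
elim: a g h n => [v|e|e||a IH|a IHa b IHb|k a IH|a IHa b IHb] g h n /=.
- exact: rmulDr.
- exact: rmulDr.
- exact: rmulDr.
- by rewrite addr0.
- by rewrite IH opprD.
- by rewrite IHa IHb addrACA.
- by rewrite IH scalerDr.
- by rewrite -IHa; apply: eq_tact => m; apply: IHb.
Qed.

Lemma tactZ a (k : K) g n : tact a (fun m => k *: g m) n = k *: tact a g n.
Proof.
elim: a g n => [v|e|e||a IH|a IHa b IHb|l a IH|a IHa b IHb] g n /=.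
- exact: lscaleAr.
- exact: lscaleAr.
- exact: lscaleAr.
- by rewrite scaler0.
- by rewrite IH scalerN.
- by rewrite IHa IHb scalerDr.
- by rewrite IH !scalerA mulrC.
- by rewrite -IHa; apply: eq_tact => m; apply: IHb.
Qed.

(** Every defining relation is homogeneous, so the shifts on its two sides agree, and it holds for
    functions because it holds in L. *)
Lemma tact_rel a b : leavitt_rel a b -> forall g, tact a g =1 tact b g.
Proof.
elim=> {a b}.
- by [].
- by move=> a b _ IH g n; rewrite IH.
- by move=> b a c _ IH1 _ IH2 g n; rewrite IH1 IH2.
- by move=> a b _ IH g n /=; rewrite IH.
- by move=> a b c d _ IH1 _ IH2 g n /=; rewrite IH1 IH2.
- by move=> k a b _ IH g n /=; rewrite IH.
- by move=> a b c d _ IH1 _ IH2 g n /=; rewrite IH1; apply: eq_tact => m; apply: IH2.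
- by move=> a b c g n /=; rewrite addrA.
- by move=> a b g n /=; rewrite addrC.
- by move=> a g n /=; rewrite add0r.
- by move=> a g n /=; rewrite addNr.
- by move=> k l a g n /=; rewrite scalerA.
- by move=> a g n /=; rewrite scale1r.
- by move=> k a b g n /=; rewrite scalerDr.
- by move=> k l a g n /=; rewrite scalerDl.
- by [].
- by [].
- by move=> a b c g n /=; rewrite tactD.
- by [].
- by move=> k a b g n /=; rewrite tactZ.
- by move=> v g n /=; rewrite rmulA VV.
- by move=> v w /eqP vw g n /=; rewrite rmulA VV0 // rmul0l.
- by move=> e g n /=; rewrite rmulA VEd.
- by move=> e g n /=; rewrite rmulA EdV.
- by move=> e g n /=; rewrite rmulA VGh.
- by move=> e g n /=; rewrite rmulA GhV.
- by move=> e g n /=; rewrite rmulA GhEd addrK.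
- by move=> e f /eqP ef g n /=; rewrite rmulA GhEd0 // rmul0l.
- move=> v rv g n /=.
  have -> : V v = \sum_(e <- fset_set (out_edges v)) Ed e ** Gh e.
    rewrite [LHS](iffRL (lpiP _ _) (Rregular K rv)).
    rewrite (big_morph (@lpi K E) (@lpiD K E) lpi0).
    by apply: eq_bigr => e _; rewrite lpiM.
  rewrite rmul_suml; elim: (fset_set _ : seq _) => [|e l IH].
    by rewrite !big_nil.
  by rewrite !big_cons /= subrK rmulA IH.
Qed.

Definition gact x g := tact (lrepr x) g.

Lemma gact_pi a g : gact (lpi a) g =1 tact a g.
Proof. exact/tact_rel/lrepr_pi. Qed.

Lemma gact0 g n : gact 0 g n = 0.
Proof. exact: gact_pi. Qed.

Lemma gactD x y g n : gact (x + y) g n = gact x g n + gact y g n.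
Proof. by rewrite -{1}[x]lreprK -{1}[y]lreprK -lpiD gact_pi. Qed.

Lemma gactZ (k : K) x g n : gact (k *: x) g n = k *: gact x g n.
Proof. by rewrite -{1}[x]lreprK -lpiZ gact_pi. Qed.

Lemma gactM x y g n : gact (x ** y) g n = gact x (gact y g) n.
Proof. by rewrite -{1}[x]lreprK -{1}[y]lreprK -lpiM gact_pi. Qed.

Lemma gact_hom d x g n : homogeneous d x -> gact x g n = x ** g (n - d).
Proof.
move=> hx; elim: hx g n => [v|e|e|m|m a b _ IHa _ IHb|m k a _ IH|m m' a b _ IHa _ IHb] g n.
- by rewrite gact_pi /= subr0.
- by rewrite gact_pi.
- by rewrite gact_pi /= opprK.
- by rewrite gact0 rmul0l.
- by rewrite gactD IHa IHb rmulDl.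
- by rewrite gactZ IH lscaleAl.
- by rewrite gactM IHa IHb rmulA opprD addrA.
Qed.

Lemma gact_graded (I : rngIdeal L) x g n :
  graded_ideal I -> x \in I -> gact x g n \in I.
Proof.
move=> gI /gI[s [sI ->]]; elim: s sI => [|y s IH] sI.
  by rewrite big_nil gact0 rpred0.
rewrite big_cons gactD rpredD //.
  have [yI [d hy]] := sI y (mem_head _ _).
  by rewrite (gact_hom _ _ hy); apply: rng_idealMr.
by apply: IH => z zs; apply: sI; rewrite inE zs orbT.
Qed.

Lemma graded_component (I : rngIdeal L) m (y : nat -> L) (d : nat -> int) :
  graded_ideal I -> injective d -> (forall i, homogeneous (d i) (y i)) ->
  \sum_(i < m) y i \in I -> forall i, (i < m)%N -> y i \in I.
Proof.
move=> gI dinj hy yI i im; have [u [_ yu]] := local_unit (y i).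
(* On the function concentrated in degree 0 with value a right unit [u] of [y i], the sum of the
   [y j] yields [y i] alone at the degree [d i]; by gradedness this value lies in [I]. *)
pose g (n : int) := if n == 0 then u else 0.
have := gact_graded g (d i) gI yI.
rewrite (big_morph (fun x => gact x g (d i)) (fun x z => gactD x z g _) (gact0 g _)).
rewrite (bigD1 (Ordinal im)) //= (gact_hom _ _ (hy i)) subrr /g eqxx yu.
rewrite big1 ?addr0 // => j ji.
rewrite (gact_hom _ _ (hy j)) subr_eq0 ifN ?rmul0r //.
by apply: contraNneq ji => /dinj ij; apply/eqP/val_inj.
Qed.

Lemma hom_pth l w : homogeneous (size l)%:Z (pth l w).
Proof.
elim: l => [|e l IH] /=; first exact: hom_vertex.
by rewrite -add1n PoszD; apply: hom_mul => //; apply: hom_edge.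
Qed.
Lemma hom_gth l w : homogeneous (- (size l)%:Z) (gth l w).
Proof.
elim: l => [|e l IH] /=; first by rewrite oppr0; exact: hom_vertex.
by rewrite -addn1 PoszD opprD; apply: hom_mul => //; apply: hom_ghost.
Qed.
Lemma hom_mon r w s : homogeneous ((size r)%:Z - (size s)%:Z) (mon r w s).
Proof. by apply: hom_mul; [apply: hom_pth | apply: hom_gth]. Qed.

End LeavittBasics.

(** * Ideals generated by an idempotent as matrix rings *)

Section RngQuotientTheory.
Local Open Scope ring_scope.
Local Open Scope rng_scope.
Variables (R : rngType) (I : rngIdeal R).
Local Notation q := (@rng_quot_pi R I).

Lemma qD x y : q (x + y) = q x + q y. Proof. exact: rng_quot_piD. Qed.
Lemma qM x y : q (x ** y) = q x ** q y. Proof. exact/esym/rng_quot_piM. Qed.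
Lemma q0 : q 0 = 0. Proof. by apply: (addrI (q 0)); rewrite -qD !addr0. Qed.
Lemma qN x : q (- x) = - q x.
Proof. by apply/eqP; rewrite -addr_eq0 -qD addNr q0. Qed.
Lemma qB x y : q (x - y) = q x - q y. Proof. by rewrite qD qN. Qed.
Lemma q_eq0 x : q x = 0 <-> x \in I.
Proof. by rewrite -q0 rng_quot_piP subr0. Qed.
Lemma q_sum (J : Type) (s : seq J) (P : pred J) (F : J -> R) :
  q (\sum_(i <- s | P i) F i) = \sum_(i <- s | P i) q (F i).
Proof. exact: (big_morph q qD q0). Qed.
Lemma q_surj (x : rng_quot I) : exists y, x = q y.
Proof. by exists (rng_quot_repr x); rewrite rng_quot_reprK. Qed.

End RngQuotientTheory.

Section RngIso.
Local Open Scope ring_scope.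
Local Open Scope rng_scope.

Lemma rng_iso_sym (R S : rngType) : rng_iso R S -> rng_iso S R.
Proof.
move=> [f [[g fK gK] fD fM]]; exists g; split; first by exists f.
  by move=> x y; apply: (can_inj fK); rewrite fD !gK.
by move=> x y; apply: (can_inj fK); rewrite fM !gK.
Qed.

Lemma rng_iso_trans (R S T : rngType) :
  rng_iso R S -> rng_iso S T -> rng_iso R T.
Proof.
move=> [f [bf fD fM]] [g [bg gD gM]]; exists (g \o f); split.
- exact: bij_comp.
- by move=> x y /=; rewrite fD gD.
- by move=> x y /=; rewrite fM gM.
Qed.

(** The quotient of [J] by its trace of [I] is a nested construction; it suffices to embed [M] in R
    / I with image the classes of the elements of [J]. *)
Lemma subquotient_iso (R : rngType) (I J : rngIdeal R) (M : rngType)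
    (h : M -> rng_quot I) :
  {morph h : x y / x + y} -> {morph h : x y / x ** y} ->
  (forall x, h x = 0 -> x = 0) ->
  (forall y, y \in J <-> exists x, rng_quot_pi I y = h x) ->
  rng_iso (subquotient J I) M.
Proof.
move=> hD hM hI hJ; apply: rng_iso_sym.
have gE x : exists y : ideal_rng J, rng_quot_pi I (\val y) = h x.
  have [z zE] := q_surj (h x).
  have zJ : z \in J by apply/hJ; exists x.
  by exists (IdealRng zJ).
have [g gP] := choice gE.
pose f x : subquotient J I := rng_quot_pi _ (g x).
have fE x (y : ideal_rng J) : h x = rng_quot_pi I (\val y) -> f x = rng_quot_pi _ y.
  by rewrite -gP /f => /rng_quot_piP gy; apply/rng_quot_piP.
have hinj x y : h x = h y -> x = y.
  move=> hxy; apply/eqP; rewrite -subr_eq0; apply/eqP; apply: hI.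
  have hN z : h (- z) = - h z.
    have h0 : h 0 = 0 by apply: (addrI (h 0)); rewrite -hD !addr0.
    by apply/eqP; rewrite -addr_eq0 -hD addNr h0.
  by rewrite hD hN hxy subrr.
have kE (y : subquotient J I) : exists x, f x = y.
  have [z ->] := q_surj y.
  by have [x xE] := (hJ (\val z)).1 (valP z); exists x; apply: fE.
have [k kP] := choice kE.
exists f; split.
- exists k => // x; apply: hinj.
  have /rng_quot_piP : f (k (f x)) = f x by rewrite kP.
  by rewrite inE => /rng_quot_piP; rewrite !gP.
- by move=> x y; rewrite /f -qD; apply: fE; rewrite hD -!gP -qD.
- by move=> x y; rewrite /f -qM; apply: fE; rewrite hM -!gP -qM.
Qed.

Lemma direct_sum_unit (R : rngType) : rng_iso R (direct_sum (fun _ : unit => R)).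
Proof.
have fin (x : R) : finite_set [set j : unit | x != 0]%classic.
  by apply: finite_finset.
exists (fun x => DirectSum (A := fun _ => R) (fin x)); split.
- exists (fun g : direct_sum (fun _ : unit => R) => g tt) => // g.
  by apply: dsumP; case.
- by move=> x y; apply: dsumP.
- by move=> x y; apply: dsumP.
Qed.

End RngIso.

(** * Matrix rings from dual families over a corner *)

Section CornerMatrix.
Local Open Scope ring_scope.
Local Open Scope rng_scope.
Variables (Q : rngType) (e : Q) (R : nzRingType) (theta : R -> Q).
Hypotheses (thetaD : {morph theta : r s / r + s})
  (thetaM : forall r s, theta (r * s) = theta r ** theta s)
  (theta_inj : forall r, theta r = 0 -> r = 0)
  (theta1 : theta 1 = e).

Lemma theta0 : theta 0 = 0.
Proof. by apply: (addrI (theta 0)); rewrite -thetaD !addr0. Qed.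
Lemma theta_el r : e ** theta r = theta r.
Proof. by rewrite -theta1 -thetaM mul1r. Qed.
Lemma theta_er r : theta r ** e = theta r.
Proof. by rewrite -theta1 -thetaM mulr1. Qed.
Lemma theta_sum (I : Type) (s : seq I) (P : pred I) (F : I -> R) :
  theta (\sum_(i <- s | P i) F i) = \sum_(i <- s | P i) theta (F i).
Proof. exact: (big_morph theta thetaD theta0). Qed.

Section DualFamilies.
Variables (X : choiceType) (b b' : X -> Q).
Hypotheses (dual : forall i j, b' i ** b j = if i == j then e else 0).

Definition supports (Y : {fset X}) (A : X -> X -> R) : Prop :=
  forall i j, (i \notin Y) || (j \notin Y) -> A i j = 0.

Lemma fin_matrix_supports (A : fin_matrix X R) : exists Y, supports Y (\val A).
Proof. by have /fin_entriesP[Y hY] := valP A; exists Y. Qed.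

Lemma supportsS (Y Z : {fset X}) A :
  (Y `<=` Z)%fset -> supports Y A -> supports Z A.
Proof.
move=> /fsubsetP YZ hY i j hij; apply: hY; apply: contraTT hij.
by rewrite !negb_or !negbK => /andP[/YZ -> /YZ ->].
Qed.

Let sumY (Y : {fset X}) (A : X -> X -> R) : Q :=
  \sum_(i <- Y) \sum_(j <- Y) b i ** theta (A i j) ** b' j.

Let sumYE Y Z A : supports Y A -> (Y `<=` Z)%fset -> sumY Z A = sumY Y A.
Proof.
move=> hY YZ; rewrite /sumY.
rewrite -(big_fset_incl _ YZ) => [|i _ iY]; last first.
  by rewrite big1 // => j _; rewrite hY ?iY // theta0 rmul0r rmul0l.
apply: eq_bigr => i _; rewrite -(big_fset_incl _ YZ) // => j _ jY.
by rewrite hY ?jY ?orbT // theta0 rmul0r rmul0l.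
Qed.

Definition mx_sum (A : fin_matrix X R) : Q :=
  sumY (projT1 (cid (fin_matrix_supports A))) (\val A).

Lemma mx_sumE (Y : {fset X}) (A : fin_matrix X R) : supports Y (\val A) ->
  mx_sum A = \sum_(i <- Y) \sum_(j <- Y) b i ** theta (\val A i j) ** b' j.
Proof.
move=> hY; rewrite /mx_sum; case: cid => Z hZ /=.
by rewrite -[RHS](sumYE hY (fsubsetUl Y Z)) (sumYE hZ (fsubsetUr Y Z)).
Qed.

Lemma mx_sum2 (A B : fin_matrix X R) :
  exists Y, supports Y (\val A) /\ supports Y (\val B).
Proof.
have [Y hY] := fin_matrix_supports A; have [Z hZ] := fin_matrix_supports B.
exists (Y `|` Z)%fset; split; first exact: supportsS (fsubsetUl _ _) hY.
exact: supportsS (fsubsetUr _ _) hZ.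
Qed.

Lemma mx_sumD : {morph mx_sum : A B / A + B}.
Proof.
move=> A B; have [Y [hA hB]] := mx_sum2 A B.
have AB i j : \val (A + B) i j = \val A i j + \val B i j by [].
rewrite (mx_sumE hA) (mx_sumE hB) (@mx_sumE Y) => [|i j hij]; last first.
  by rewrite AB hA // hB // addr0.
rewrite -big_split; apply: eq_bigr => i _; rewrite -big_split.
by apply: eq_bigr => j _; rewrite AB thetaD rmulDr rmulDl.
Qed.

Lemma mx_sumM : {morph mx_sum : A B / A ** B}.
Proof.
move=> A B; have [Y [hA hB]] := mx_sum2 A B.
have ABE i j : \val (A ** B) i j = \sum_(k <- Y) \val A i k * \val B k j.
  by apply: fmx_mulE => k kY; rewrite hA ?kY ?orbT // mul0r.
rewrite (mx_sumE hA) (mx_sumE hB) (@mx_sumE Y) => [|i j]; last first.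
  move=> hij; rewrite ABE big1 // => k _; case/orP: hij => hij.
    by rewrite hA ?hij // mul0r.
  by rewrite hB ?hij ?orbT // mulr0.
rewrite rmul_suml; apply: eq_bigr => i _.
(* By duality only the terms with [k' = k] survive, and there the middle factor [e] is absorbed by
   the corner elements. *)
have rowE k : k \in Y -> b i ** theta (\val A i k) ** b' k **
    (\sum_(k' <- Y) \sum_(j <- Y) b k' ** theta (\val B k' j) ** b' j) =
    \sum_(j <- Y) b i ** theta (\val A i k * \val B k j) ** b' j.
  move=> kY; rewrite (big_fsetD1 k) //= rmulDr [X in _ + X](_ : _ = 0) ?addr0.
    rewrite rmul_sumr; apply: eq_bigr => j _.
    rewrite -!rmulA (rmulA (b' k)) dual eqxx (rmulA e) theta_el (rmulA (theta _)).
    by rewrite -thetaM.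
  rewrite rmul_sumr big_seq big1 // => l; rewrite !inE => /andP[lk _].
  rewrite rmul_sumr big1 // => j _.
  by rewrite -!rmulA (rmulA (b' k)) dual eq_sym (negbTE lk) rmul0l !rmul0r.
rewrite rmul_suml [RHS](eq_big_seq _ rowE).
rewrite exchange_big; apply: eq_bigr => j _.
by rewrite ABE theta_sum rmul_sumr rmul_suml.
Qed.

(** Cutting with the dual elements on both sides isolates one entry, which is why the map is
    injective. *)
Lemma mx_sum_coef (A : fin_matrix X R) k l :
  b' k ** mx_sum A ** b l = theta (\val A k l).
Proof.
have [Y0 hY0] := fin_matrix_supports A; pose Y := (Y0 `|` [fset k; l])%fset.
have hY : supports Y (\val A) by apply: supportsS hY0; apply: fsubsetUl.
have kY : k \in Y by rewrite !inE eqxx orbT.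
have lY : l \in Y by rewrite !inE eqxx !orbT.
rewrite (mx_sumE hY) (big_fsetD1 k) //= rmulDr rmulDl.
rewrite [X in _ + X](_ : _ = 0) ?addr0; last first.
  rewrite rmul_sumr rmul_suml big_seq big1 // => i; rewrite !inE => /andP[ik _].
  rewrite rmul_sumr rmul_suml big1 // => j _.
  by rewrite !rmulA dual eq_sym (negbTE ik) !rmul0l.
rewrite (big_fsetD1 l) //= rmulDr rmulDl.
rewrite [X in _ + X](_ : _ = 0) ?addr0; last first.
  rewrite rmul_sumr rmul_suml big_seq big1 // => j; rewrite !inE => /andP[jl _].
  by rewrite -!rmulA dual (negbTE jl) !rmul0r.
by rewrite !rmulA dual eqxx theta_el -rmulA dual eqxx theta_er.
Qed.

Lemma mx_sum_inj A : mx_sum A = 0 -> A = 0.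
Proof.
move=> A0; apply: val_inj; apply/funext => i; apply/funext => j.
by apply: theta_inj; rewrite -mx_sum_coef A0 rmul0r rmul0l.
Qed.

Lemma mx_sum_delta i j r : exists A, mx_sum A = b i ** theta r ** b' j.
Proof.
pose D k l : R := if (k == i) && (l == j) then r else 0.
have hD : supports [fset i; j]%fset D.
  move=> k l; rewrite /D; have [->|//] := eqVneq k i; have [->|//] := eqVneq l j.
  by rewrite fset21 fset22.
have Dfin : D \in @fin_entries X R by apply/fin_entriesP; exists [fset i; j]%fset.
exists (FinMatrix Dfin); rewrite (mx_sumE (Y := [fset i; j]%fset)) //=.
rewrite (big_fsetD1 i) ?fset21 //=.
rewrite [X in _ + X](_ : _ = 0) ?addr0; last first.
  rewrite big_seq big1 // => k; rewrite !inE => /andP[ki _].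
  by rewrite big1 // => l _; rewrite /D (negbTE ki) theta0 rmul0r rmul0l.
rewrite (big_fsetD1 j) ?fset22 //=.
rewrite [X in _ + X](_ : _ = 0) ?addr0; last first.
  rewrite big_seq big1 // => l; rewrite !inE => /andP[lj _].
  by rewrite /D (negbTE lj) andbF theta0 rmul0r rmul0l.
by rewrite /D !eqxx.
Qed.

End DualFamilies.

(* The families beta and beta' need only be dual up to units of the corner:
   one index is then retained in each class of proportional elements. *)
Section UnitClasses.
Variables (T0 : choiceType) (be be' : T0 -> Q).
Hypotheses (be_e : forall i, be i ** e = be i) (be'_e : forall i, e ** be' i = be' i)
  (dual1 : forall i, be i <> 0 -> be' i ** be i = e)
  (dual2 : forall i j, be i <> 0 -> be j <> 0 -> be' i ** be j = 0 \/
     exists r s, [/\ r * s = 1, s * r = 1, be j = be i ** theta r &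
                     be' j = theta s ** be' i]).

Definition unit_equiv i j : Prop := exists r s,
  [/\ r * s = 1, s * r = 1, be j = be i ** theta r & be' j = theta s ** be' i].

Lemma unit_equiv_refl i : unit_equiv i i.
Proof. by exists 1, 1; rewrite mulr1 theta1 be_e be'_e. Qed.
Lemma unit_equiv_sym i j : unit_equiv i j -> unit_equiv j i.
Proof.
move=> [r [s [rs sr ij ij']]]; exists s, r; split=> //.
  by rewrite ij -rmulA -thetaM rs theta1 be_e.
by rewrite ij' rmulA -thetaM rs theta1 be'_e.
Qed.
Lemma unit_equiv_trans i j k : unit_equiv i j -> unit_equiv j k -> unit_equiv i k.
Proof.
move=> [r [s [rs sr ij ij']]] [r' [s' [rs' sr' jk jk']]].
exists (r * r'), (s' * s); split.
- by rewrite mulrA -(mulrA r) rs' mulr1.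
- by rewrite mulrA -(mulrA s') sr mulr1.
- by rewrite jk ij -rmulA -thetaM.
- by rewrite jk' ij' rmulA -thetaM.
Qed.

Let rep i : T0 := choose (fun j => `[< unit_equiv i j >]) i.

Let repP i : unit_equiv i (rep i).
Proof.
have : `[< unit_equiv i (rep i) >].
  by apply: (@chooseP _ (fun j => `[< unit_equiv i j >])); apply/asboolP/unit_equiv_refl.
by move/asboolP.
Qed.

Let rep_eq i j : unit_equiv i j -> rep i = rep j.
Proof.
move=> ij; have eqP k : `[< unit_equiv i k >] = `[< unit_equiv j k >].
  apply/asboolP/asboolP => h; last exact: unit_equiv_trans ij h.
  exact: unit_equiv_trans (unit_equiv_sym ij) h.
rewrite /rep (eq_choose eqP); apply: choose_id; last exact/asboolP/unit_equiv_refl.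
exact/asboolP/unit_equiv_sym.
Qed.

(** Zero elements are discarded because the duality [dual1] is known only where [be] is nonzero; in
    each other class the index chosen by [rep] is kept. *)
Record unit_class := UnitClass {
  unit_rep : T0;
  _ : `[< be unit_rep <> 0 >] && (rep unit_rep == unit_rep) }.
HB.instance Definition _ := [isSub for unit_rep].
HB.instance Definition _ := [Choice of unit_class by <:].

Lemma unit_class_dual (i j : unit_class) :
  be' (\val i) ** be (\val j) = if i == j then e else 0.
Proof.
have /andP[/asboolP i0 /eqP ri] := valP i; have /andP[/asboolP j0 /eqP rj] := valP j.
have [->|ij] := eqVneq i j; first exact: dual1.
have [//|/rep_eq] := dual2 i0 j0.
by rewrite ri rj => /val_inj ij'; rewrite ij' eqxx in ij.
Qed.

Lemma unit_class_ex i : be i <> 0 -> exists j : unit_class, unit_equiv (\val j) i.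
Proof.
move=> i0; have ir := repP i.
have r0 : be (rep i) <> 0.
  by have [r [s [_ _ iE _]]] := unit_equiv_sym ir => z; apply: i0; rewrite iE z rmul0l.
have hr : `[< be (rep i) <> 0 >] && (rep (rep i) == rep i).
  by apply/andP; split; [apply/asboolP | rewrite -(rep_eq ir)].
by exists (UnitClass hr); apply: unit_equiv_sym.
Qed.

End UnitClasses.

End CornerMatrix.

Section AddIdeal.
Local Open Scope ring_scope.
Local Open Scope rng_scope.
Variables (R : rngType) (I : rngIdeal R) (e : R).

(** This is I + R e R. Without a unit, [e] need not lie in R e R, but it does so modulo [I] when it
    is idempotent modulo [I]. *)
Definition add_ideal : {pred R} := fun x =>
  `[< exists s : seq (R * R), x - \sum_(p <- s) p.1 ** e ** p.2 \in I >].

Lemma add_ideal_zmod_closed : zmod_closed add_ideal.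
Proof.
split=> [|x y /asboolP[s xs] /asboolP[t yt]]; apply/asboolP.
  by exists [::]; rewrite big_nil subr0 rpred0.
exists (s ++ [seq (- p.1, p.2) | p <- t]); rewrite big_cat big_map /=.
under [X in _ - (_ + X)]eq_bigr => p _ do rewrite !rmulNl.
by rewrite sumrN opprD addrACA -opprD rpredB.
Qed.
HB.instance Definition _ := GRing.isZmodClosed.Build R add_ideal add_ideal_zmod_closed.

Lemma add_idealMl r x : x \in add_ideal -> r ** x \in add_ideal.
Proof.
move=> /asboolP[s xs]; apply/asboolP; exists [seq (r ** p.1, p.2) | p <- s].
rewrite big_map /=; under eq_bigr => p _ do rewrite -!rmulA (rmulA _ e).
by rewrite -rmul_sumr -rmulBr; apply: rng_idealMl.
Qed.

Lemma add_idealMr r x : x \in add_ideal -> x ** r \in add_ideal.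
Proof.
move=> /asboolP[s xs]; apply/asboolP; exists [seq (p.1, p.2 ** r) | p <- s].
rewrite big_map /=; under eq_bigr => p _ do rewrite rmulA.
by rewrite -rmul_suml -rmulBl; apply: rng_idealMr.
Qed.
HB.instance Definition _ := isRngIdeal.Build R add_ideal add_idealMl add_idealMr.

Lemma add_ideal_sub x : x \in I -> x \in add_ideal.
Proof. by move=> xI; apply/asboolP; exists [::]; rewrite big_nil subr0. Qed.

Lemma add_ideal_gen x y : x ** e ** y \in add_ideal.
Proof.
by apply/asboolP; exists [:: (x, y)]; rewrite big_seq1 subrr rpred0.
Qed.

Lemma add_idealP x : x \in add_ideal <->
  exists s : seq (R * R), rng_quot_pi I x =
    \sum_(p <- s) rng_quot_pi I p.1 ** rng_quot_pi I e ** rng_quot_pi I p.2.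
Proof.
split=> [/asboolP[s /q_eq0 sE]|[s sE]].
  exists s; move/eqP: sE; rewrite qB subr_eq0 q_sum => /eqP ->.
  by apply: eq_bigr => p _; rewrite !qM.
apply/asboolP; exists s; apply/q_eq0; rewrite qB q_sum; apply/eqP.
rewrite subr_eq0 sE; apply/eqP.
by apply: eq_bigr => p _; rewrite !qM.
Qed.

End AddIdeal.

Section LeavittQuotient.
Local Open Scope ring_scope.
Local Open Scope rng_scope.
Variables (K : fieldType) (E : graph) (I : rngIdeal (leavitt K E)).
Local Notation L := (leavitt K E).

Definition lquot : Type := rng_quot I.
HB.instance Definition _ := Rng.on lquot.

Definition lq (x : L) : lquot := rng_quot_pi I x.
Definition lquot_scale (k : K) (x : lquot) : lquot := lq (k *: rng_quot_repr x).

Lemma lqD x y : lq (x + y) = lq x + lq y. Proof. exact: qD. Qed.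
Lemma lqB x y : lq (x - y) = lq x - lq y. Proof. exact: qB. Qed.
Lemma lq0 : lq 0 = 0. Proof. exact: q0. Qed.
Lemma lqM x y : lq (x ** y) = lq x ** lq y. Proof. exact: qM. Qed.
Lemma lq_eq0 x : lq x = 0 <-> x \in I. Proof. exact: q_eq0. Qed.
Lemma lq_sum (J : Type) (s : seq J) (P : pred J) (F : J -> L) :
  lq (\sum_(i <- s | P i) F i) = \sum_(i <- s | P i) lq (F i).
Proof. exact: q_sum. Qed.
Lemma lq_surj (x : lquot) : exists y, x = lq y. Proof. exact: q_surj. Qed.

Lemma lquot_scaleE k x : lquot_scale k (lq x) = lq (k *: x).
Proof.
apply/rng_quot_piP; rewrite -scalerBr; apply: ideal_scale.
by apply/rng_quot_piP; rewrite rng_quot_reprK.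
Qed.

Lemma lquot_scaleA k l x : lquot_scale k (lquot_scale l x) = lquot_scale (k * l) x.
Proof. by have [y ->] := lq_surj x; rewrite !lquot_scaleE scalerA. Qed.
Lemma lquot_scale1 : left_id 1 lquot_scale.
Proof. by move=> x; have [y ->] := lq_surj x; rewrite lquot_scaleE scale1r. Qed.
Lemma lquot_scaleDr : right_distributive lquot_scale +%R.
Proof.
move=> k x y; have [a ->] := lq_surj x; have [b ->] := lq_surj y.
by rewrite -lqD !lquot_scaleE scalerDr lqD.
Qed.
Lemma lquot_scaleDl x : {morph lquot_scale^~ x : k l / k + l}.
Proof.
by move=> k l; have [a ->] := lq_surj x; rewrite !lquot_scaleE scalerDl lqD.
Qed.
HB.instance Definition _ := GRing.Zmodule_isLmodule.Build K lquot
  lquot_scaleA lquot_scale1 lquot_scaleDr lquot_scaleDl.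

Lemma lqZ (k : K) x : lq (k *: x) = k *: lq x.
Proof. exact/esym/lquot_scaleE. Qed.

Lemma qscaleAl (k : K) (x y : lquot) : (k *: x) ** y = k *: (x ** y).
Proof.
have [a ->] := lq_surj x; have [b ->] := lq_surj y.
by rewrite -lqZ -!lqM -lqZ lscaleAl.
Qed.
Lemma qscaleAr (k : K) (x y : lquot) : x ** (k *: y) = k *: (x ** y).
Proof.
have [a ->] := lq_surj x; have [b ->] := lq_surj y.
by rewrite -lqZ -!lqM -lqZ lscaleAr.
Qed.

Section CornerIso.
Variables (e : L) (R : nzRingType) (theta : R -> lquot).
Hypotheses (thetaD : {morph theta : r s / r + s})
  (thetaM : forall r s, theta (r * s) = theta r ** theta s)
  (theta_inj : forall r, theta r = 0 -> r = 0)
  (theta1 : theta 1 = lq e)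
  (thetaZ : forall (k : K) r, exists s, k *: theta r = theta s).
Variables (T0 : choiceType) (be be' : T0 -> lquot).
Hypotheses (be_e : forall i, be i ** lq e = be i)
  (be'_e : forall i, lq e ** be' i = be' i)
  (dual1 : forall i, be i <> 0 -> be' i ** be i = lq e)
  (dual2 : forall i j, be i <> 0 -> be j <> 0 -> be' i ** be j = 0 \/
     exists r s, [/\ r * s = 1, s * r = 1, be j = be i ** theta r &
                     be' j = theta s ** be' i])
  (spanl : forall r w s, lq (mon K r w s) ** lq e = 0 \/
     exists i c, be i <> 0 /\ lq (mon K r w s) ** lq e = be i ** theta c)
  (spanr : forall r w s, lq e ** lq (mon K r w s) = 0 \/
     exists i c, be i <> 0 /\ lq e ** lq (mon K r w s) = theta c ** be' i).

(** Products of two monomials around [e] span the new ideal modulo [I]. By [spanl] and [spanr] each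
    is 0 or some [be i ** theta c ** be' j], and passing to the representatives of the classes of
    [i] and [j] changes [c] only by units. *)
Lemma corner_iso : exists X : choiceType,
  rng_iso (subquotient (add_ideal I e) I) (fin_matrix X R).
Proof.
pose X : choiceType := unit_class theta be be'; exists X.
pose b (i : X) := be (\val i); pose b' (i : X) := be' (\val i).
have dual (i j : X) : b' i ** b j = if i == j then lq e else 0.
  exact: (unit_class_dual thetaM theta1 be_e be'_e dual1 dual2).
have clsP i : be i <> 0 -> exists j : X, unit_equiv theta be be' (\val j) i.
  exact: (unit_class_ex thetaM theta1 be_e be'_e).
pose h := mx_sum theta b b'.
have hD : {morph h : x y / x + y} by exact: mx_sumD.
have hdelta i j r : exists A, h A = b i ** theta r ** b' j by exact: mx_sum_delta.
have h0 : h 0 = 0 by apply: (addrI (h 0)); rewrite -hD !addr0.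
(* [h] is only additive by construction; as monomials span over [K], its image must also absorb
   scalars. *)
have hZ (k : K) A : exists B, k *: h A = h B.
  have [Y hY] := fin_matrix_supports A; rewrite /h (mx_sumE thetaD _ _ hY).
  pose P (z : lquot) := exists B, k *: z = h B.
  apply: (big_ind P) => [|x y [B xB] [C yC]|i _]; first by exists 0; rewrite scaler0.
    by exists (B + C); rewrite hD scalerDr xB yC.
  apply: (big_ind P) => [|x y [B xB] [C yC]|j _]; first by exists 0; rewrite scaler0.
    by exists (B + C); rewrite hD scalerDr xB yC.
  have [s sE] := thetaZ k (\val A i j); have [B BE] := hdelta i j s.
  by exists B; rewrite BE -sE qscaleAr qscaleAl.
apply: (@subquotient_iso _ _ _ _ h) => //.
- exact: (mx_sumM thetaD thetaM theta1 dual).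
- exact: (mx_sum_inj thetaD thetaM theta_inj theta1 dual).
- move=> y; split.
    move=> /add_idealP[s ->].
    apply: (big_ind (fun z => exists x, z = h x)); first by exists 0.
      by move=> x z [A ->] [B ->]; exists (A + B); rewrite hD.
    move=> [u v] _ /=; rewrite -!/(lq _).
    elim/leavitt_ind: u => [|u u' [A uA] [B uB]|k r w t].
    + by exists 0; rewrite lq0 !rmul0l.
    + by exists (A + B); rewrite hD -uA -uB lqD !rmulDl.
    elim/leavitt_ind: v => [|v v' [A vA] [B vB]|k' r' w' t'].
    + by exists 0; rewrite lq0 !rmul0r.
    + by exists (A + B); rewrite hD -vA -vB lqD !rmulDr.
    suff [A AE] : exists A, lq (mon K r w t) ** lq e ** lq (mon K r' w' t') = h A.
      have [B BE] := hZ (k' * k) A; exists B.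
      by rewrite !lqZ qscaleAr !qscaleAl scalerA AE.
    have [->|[i [c [i0 iE]]]] := spanl r w t; first by exists 0; rewrite rmul0l.
    have eeE : lq e ** lq e = lq e by rewrite -theta1 -thetaM mulr1.
    (* [e] is doubled so that each of the two monomials gets its own copy. *)
    rewrite -[lq e]eeE (rmulA (lq _)) -(rmulA (_ ** _)).
    have [->|[j [d [j0 jE]]]] := spanr r' w' t'; first by exists 0; rewrite rmul0r.
    rewrite iE jE.
    have [i' [r1 [s1 [_ _ -> _]]]] := clsP i i0.
    have [j' [r2 [s2 [_ _ _ ->]]]] := clsP j j0.
    have [A AE] := hdelta i' j' (r1 * c * d * s2); exists A.
    by rewrite AE !thetaM !rmulA.
  move=> [A yA]; suff [z zJ zA] : exists2 z, z \in add_ideal I e & lq z = h A.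
    have -> : y = (y - z) + z by rewrite subrK.
    apply: rpredD => //; apply: add_ideal_sub; apply/rng_quot_piP.
    by rewrite yA -zA.
  have [Y hY] := fin_matrix_supports A; rewrite /h (mx_sumE thetaD _ _ hY).
  pose P (x : lquot) := exists2 z, z \in add_ideal I e & lq z = x.
  have PD x x' : P x -> P x' -> P (x + x').
    by move=> [z zJ <-] [z' zJ' <-]; exists (z + z'); rewrite ?rpredD ?lqD.
  have P0 : P 0 by exists 0; rewrite ?rpred0 ?lq0.
  apply: (big_ind P) => // i _; apply: (big_ind P) => // j _.
  have [u uE] := lq_surj (b i); have [v vE] := lq_surj (theta (\val A i j) ** b' j).
  exists (u ** e ** v); first exact: add_ideal_gen.
  by rewrite !lqM -uE -vE be_e rmulA.
Qed.

End CornerIso.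
End LeavittQuotient.

(** * Laurent polynomials in a corner *)

Section Powers.
Local Open Scope ring_scope.
Local Open Scope rng_scope.
Variables (Q : rngType) (e : Q).
Hypothesis ee : e ** e = e.

Definition pw (u : Q) n : Q := iter n (rmul u) e.

Lemma pwS u n : pw u n.+1 = u ** pw u n. Proof. by []. Qed.
Lemma pw_el u n : e ** u = u -> e ** pw u n = pw u n.
Proof. by move=> eu; case: n => [|n] //; rewrite pwS rmulA eu. Qed.
Lemma pw_er u n : pw u n ** e = pw u n.
Proof. by elim: n => [|n IH] //; rewrite pwS -rmulA IH. Qed.
Lemma pwD u m n : e ** u = u -> pw u (m + n) = pw u m ** pw u n.
Proof.
move=> eu; elim: m => [|m IH]; first by rewrite add0n pw_el.
by rewrite addSn !pwS IH rmulA.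
Qed.
Lemma pwSr u n : e ** u = u -> u ** e = u -> pw u n.+1 = pw u n ** u.
Proof. by move=> eu ue; rewrite -addn1 pwD // pwS /= ue. Qed.
Lemma pw_inv u u' n : e ** u = u -> u ** e = u -> e ** u' = u' -> u' ** e = u' ->
  u ** u' = e -> pw u n ** pw u' n = e.
Proof.
move=> eu ue eu' u'e uu'; elim: n => [|n IH]; first exact: ee.
by rewrite pwSr // pwS -rmulA (rmulA u) uu' pw_el.
Qed.

End Powers.

(** * Evaluation of Laurent polynomials at a unit of a corner *)

Section LaurentEval.
Local Open Scope ring_scope.
Local Open Scope rng_scope.
Variables (K : fieldType) (E : graph) (I : rngIdeal (leavitt K E)).
Local Notation Q := (lquot I).
Variables (e u u' : Q).
Hypotheses (ee : e ** e = e) (eu : e ** u = u) (ue : u ** e = u)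
  (eu' : e ** u' = u') (u'e : u' ** e = u') (uu' : u ** u' = e) (u'u : u' ** u = e).
Implicit Types p r : {poly K}.

Definition ev p : Q := \sum_(i < size p) p`_i *: pw e u i.

Lemma evE n p : (size p <= n)%N -> ev p = \sum_(i < n) p`_i *: pw e u i.
Proof.
move=> pn; rewrite /ev (big_ord_widen n (fun i => p`_i *: pw e u i) pn).
rewrite big_mkcond; apply: eq_bigr => i _; case: ltnP => // pi.
by rewrite nth_default // scale0r.
Qed.

Lemma evD p r : ev (p + r) = ev p + ev r.
Proof.
rewrite (@evE (maxn (size p) (size r))) ?size_polyD //.
rewrite (evE (leq_maxl (size p) (size r))) (evE (leq_maxr (size p) (size r))) -big_split.
by apply: eq_bigr => i _; rewrite coefD scalerDl.
Qed.

Lemma evZ k p : ev (k *: p) = k *: ev p.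
Proof.
rewrite (@evE (size p)) ?size_scale_leq // scaler_sumr.
by apply: eq_bigr => i _; rewrite coefZ scalerA.
Qed.

Lemma evC k : ev k%:P = k *: e.
Proof.
by rewrite (@evE 1) ?size_polyC ?leq_b1 // big_ord1 coefC eqxx.
Qed.

Lemma evMX p : ev (p * 'X) = ev p ** u.
Proof.
rewrite (@evE (size p).+1); last first.
  by rewrite (leq_trans (size_polyMleq _ _)) // size_polyX addn2.
rewrite big_ord_recl coefMX eqxx scale0r add0r rmul_suml.
by apply: eq_bigr => i _; rewrite lift0 coefMX qscaleAl -(pwSr ee).
Qed.

Lemma ev_er p : ev p ** e = ev p.
Proof.
by rewrite rmul_suml; apply: eq_bigr => i _; rewrite qscaleAl pw_er.
Qed.

Lemma evM p r : ev (p * r) = ev p ** ev r.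
Proof.
elim/poly_ind: r => [|r c IH].
  by rewrite mulr0 /ev size_poly0 big_ord0 rmul0r.
rewrite mulrDr mulrA evD evMX IH mulrC mul_polyC evZ.
by rewrite evD evMX evC rmulDr qscaleAr ev_er rmulA.
Qed.

Lemma ev1 : ev 1 = e. Proof. by rewrite evC scale1r. Qed.
Lemma ev_el p : e ** ev p = ev p.
Proof. by rewrite -{1}ev1 -evM mul1r. Qed.
Lemma evXn n : ev 'X^n = pw e u n.
Proof.
elim: n => [|n IH]; first by rewrite expr0 ev1.
by rewrite exprSr evMX IH (pwSr ee).
Qed.

Lemma ev_comm_inv p n : ev p ** pw e u' n = pw e u' n ** ev p.
Proof.
elim: n => [|n IH]; first by rewrite /= ev_er ev_el.
have uev : u ** ev p = ev p ** u.
  by rewrite -evMX mulrC evM -['X]expr1 evXn /= ue.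
have cu : u' ** ev p = ev p ** u'.
  rewrite -{1}[ev p]ev_er -uu' !rmulA -(rmulA u') -uev.
  by rewrite (rmulA u') u'u ev_el.
by rewrite pwS rmulA -cu -!rmulA IH.
Qed.

Local Notation "p %:F" := (@FracField.tofrac {poly K} p).

Lemma laurent_ex (f : laurent K) : exists pn : {poly K} * nat,
  \val f = pn.1%:F / 'X%:F ^+ pn.2.
Proof. by have /asboolP[p [n fE]] := valP f; exists (p, n). Qed.

Definition lnum (f : laurent K) := (projT1 (cid (laurent_ex f))).1.
Definition lden (f : laurent K) := (projT1 (cid (laurent_ex f))).2.
Lemma laurentE f : \val f = (lnum f)%:F / 'X%:F ^+ (lden f).
Proof. by rewrite /lnum /lden; case: cid. Qed.

Lemma tofracX_neq0 n : 'X%:F ^+ n != 0 :> {fraction {poly K}}.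
Proof. by rewrite expf_neq0 // tofrac_eq0 polyX_eq0. Qed.

Lemma laurent_mk p n : exists f : laurent K, \val f = p%:F / 'X%:F ^+ n.
Proof.
have h : p%:F / 'X%:F ^+ n \in @laurent_pred K by apply/asboolP; exists p, n.
by exists (Laurent h).
Qed.

Definition lev (f : laurent K) : Q := ev (lnum f) ** pw e u' (lden f).

(** Numerator and exponent are picked by choice, and the fraction need not be reduced.
    Cross-multiplication in K[x] and the invertibility of [u] show that the value does not depend on
    them. *)
Lemma levE f p n : \val f = p%:F / 'X%:F ^+ n -> lev f = ev p ** pw e u' n.
Proof.
rewrite laurentE => /eqP; rewrite eqr_div ?tofracX_neq0 // -!tofracXn -!tofracM.
rewrite tofrac_eq => /eqP pE; rewrite /lev.
set r := lnum f in pE *; set m := lden f in pE *.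
have rE : ev r = ev p ** pw e u m ** pw e u' n.
  by rewrite -evXn -evM -pE evM evXn -rmulA (pw_inv ee) // ev_er.
rewrite rE -!rmulA -(pwD ee _ _ eu') addnC (pwD ee _ _ eu') (rmulA (pw e u m)).
by rewrite (pw_inv ee) // (pw_el ee _ eu').
Qed.

Lemma levD : {morph lev : f g / f + g}.
Proof.
move=> f g.
have fgE : \val (f + g) = (lnum f * 'X^(lden g) + lnum g * 'X^(lden f))%:F /
    'X%:F ^+ (lden f + lden g).
  rewrite [\val (f + g)](_ : _ = \val f + \val g) // !laurentE.
  by rewrite addf_div ?tofracX_neq0 // tofracD !tofracM !tofracXn exprD.
have red p m n : ev p ** pw e u n ** pw e u' (n + m) = ev p ** pw e u' m.
  rewrite (pwD ee _ _ eu') -!rmulA (rmulA (pw e u _)) (pw_inv ee) //.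
  by rewrite (pw_el ee _ eu').
by rewrite (levE fgE) evD !evM !evXn rmulDl red addnC red.
Qed.

Lemma levM f g : lev (f * g) = lev f ** lev g.
Proof.
have fgE : \val (f * g) = (lnum f * lnum g)%:F / 'X%:F ^+ (lden f + lden g).
  rewrite [\val (f * g)](_ : _ = \val f * \val g) // !laurentE.
  by rewrite tofracM exprD mulf_div.
rewrite (levE fgE) evM (pwD ee _ _ eu') /lev -!rmulA; congr (_ ** _).
by rewrite !rmulA ev_comm_inv.
Qed.

Lemma lev_poly f p : \val f = p%:F -> lev f = ev p.
Proof. by move=> fE; rewrite (@levE f p 0) ?expr0 ?divr1 //= ev_er. Qed.

Lemma lev1 : lev 1 = e.
Proof. by rewrite (@lev_poly 1 1) ?ev1 // tofrac1. Qed.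

Lemma levZ (k : K) f : exists g, k *: lev f = lev g.
Proof.
have [c cE] := laurent_mk k%:P 0; exists (c * f).
rewrite levM (@lev_poly c k%:P) ?cE ?expr0 ?divr1 // evC qscaleAl.
by rewrite -{1}lev1 -levM mul1r.
Qed.

Lemma lev_inj : (forall p, ev p = 0 -> p = 0) -> forall f, lev f = 0 -> f = 0.
Proof.
move=> evI f f0; have : ev (lnum f) = 0.
  rewrite -[ev _]ev_er -(pw_inv ee (lden f) eu' u'e eu ue u'u).
  by rewrite rmulA -/(lev f) f0 rmul0l.
move/evI => p0; apply: val_inj; rewrite laurentE p0 tofrac0 mul0r.
by [].
Qed.

Lemma lev_unit n : exists r s : laurent K,
  [/\ r * s = 1, s * r = 1, lev r = pw e u n & lev s = pw e u' n].
Proof.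
have [r rE] := laurent_mk 'X^n 0; have [s sE] := laurent_mk 1 n.
have rs : r * s = 1.
  apply: val_inj; rewrite [LHS](_ : _ = \val r * \val s) // rE sE.
  by rewrite expr0 divr1 tofrac1 mul1r tofracXn divff ?tofracX_neq0.
exists r, s; split=> //; first by rewrite mulrC.
  by rewrite (@lev_poly r 'X^n) ?evXn // rE expr0 divr1.
by rewrite (levE sE) ev1 (pw_el ee _ eu').
Qed.

(* An inverse p / X^n of X - k would give k^n = 0 on evaluation at k. *)
Lemma lev_sub_nunit (k : K) f : k != 0 -> (forall p, ev p = 0 -> p = 0) ->
  lev f ** (u - k *: e) <> e.
Proof.
move=> k0 evI.
have -> : u - k *: e = ev ('X - k%:P).
  by rewrite -[- k%:P]polyCN evD evC scaleNr -['X]expr1 evXn /= ue.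
have [g gE] := laurent_mk ('X - k%:P) 0.
rewrite -(@lev_poly g) ?gE ?expr0 ?divr1 // -levM -lev1 => h.
have /eqP : f * g - 1 = 0.
  apply: (lev_inj evI); apply: (addIr (lev 1)).
  by rewrite -levD subrK h add0r.
rewrite subr_eq0 => /eqP /(congr1 val).
rewrite [\val _](_ : _ = \val f * \val g) // laurentE gE expr0 divr1.
rewrite [\val 1](_ : _ = 1) // mulrAC -tofracM => /(canRL (divfK (tofracX_neq0 _))).
rewrite mul1r -tofracXn => /eqP; rewrite tofrac_eq => /eqP /(congr1 (horner^~ k)).
rewrite hornerM hornerXsubC subrr mulr0 hornerXn => /esym/eqP.
by rewrite expf_eq0 (negbTE k0) andbF.
Qed.

End LaurentEval.

(** * Simple modules and cycles at a corner *)

Section CornerModules.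
Local Open Scope classical_set_scope.
Local Open Scope ring_scope.
Local Open Scope rng_scope.
Variables (K : fieldType) (E : graph) (I : rngIdeal (leavitt K E)).
Local Notation L := (leavitt K E).
Local Notation Q := (lquot I).
Local Notation q := (@lq K E I).

(** The left ideal of all [a] with a e in [I] is modular for [e]. It contains [a ** b] whenever [a]
    is in [I], so [I] kills the whole module and not just its generator. *)
Lemma corner_simple (e : L) : q e ** q e = q e -> q e <> 0 ->
  exists (S : rngModule L) (x : S),
    [/\ simple_module S, x <> 0, (forall a (y : S), a \in I -> act a y = 0) &
        act e x = x].
Proof.
move=> ee e0.
have lN : left_ideal [set a : L | q a ** q e = 0].
  split=> [|a b /= a0 b0|a b /= b0]; first by rewrite /= lq0 rmul0l.
    by rewrite lqB rmulBl a0 b0 subr0.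
  by rewrite lqM -rmulA b0 rmul0r.
have [|//=|S [x [simS x0 Nx ex]]] := simple_of_modular (e := e) lN.
- by move=> a /=; rewrite lqB lqM rmulBl -rmulA ee subrr.
- by rewrite ee.
exists S, x; split=> // a y aI; have [b <-] := simple_gen y simS x0.
rewrite -actM; apply: Nx => /=; rewrite lqM.
by have /lq_eq0 -> := aI; rewrite !rmul0l.
Qed.

Section LaurentCorner.
Variables (e u0 : L) (u' : Q).
Local Notation u := (q u0).
Hypotheses (e0 : q e <> 0) (ee : q e ** q e = q e)
  (eu : q e ** u = u) (ue : u ** q e = u)
  (eu' : q e ** u' = u') (u'e : u' ** q e = u')
  (uu' : u ** u' = q e) (u'u : u' ** u = q e)
  (ev_inj : forall p : {poly K}, ev (q e) u p = 0 -> p = 0)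
  (corner : forall a, exists b, q e ** a ** q e = lev (q e) u u' b).

(** The left ideal consists of the [a] with a e a left multiple of [z] modulo [I]. It avoids [e]
    because x - k is not invertible in K[x, x^-1]. A vector fixed by [e] is a corner element applied
    to [x], and [z] passes that element because the corner is commutative. *)
Lemma laurent_corner_simple (k : K) : k != 0 ->
  exists (S : rngModule L) (x : S),
    [/\ simple_module S, x <> 0, act e x = x &
        forall y : S, act e y = y -> act (u0 - k *: e) y = 0].
Proof.
move=> k0; pose z := u0 - k *: e.
have zE : q z = u - k *: q e by rewrite lqB lqZ.
pose N := [set a : L | exists b, q a ** q e = b ** q z].
have lN : left_ideal N.
  split=> [|a b [a' aE] [b' bE]|a b [b' bE]]; rewrite /N /=.
  - by exists 0; rewrite lq0 !rmul0l.
  - by exists (a' - b'); rewrite lqB !rmulBl aE bE.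
  - by exists (q a ** b'); rewrite lqM -!rmulA bE.
have ez : q e ** q z = q z by rewrite zE rmulBr eu qscaleAr ee.
have ze : q z ** q e = q z by rewrite zE rmulBl ue qscaleAl ee.
have levz b : lev (q e) u u' b ** q z = q z ** lev (q e) u u' b.
  have [c cE] := corner (q z).
  have -> : q z = lev (q e) u u' c by rewrite -cE ez ze.
  by rewrite -!(levM ee) // mulrC.
have [a|[b]|S [x [simS x0 Nx ex]]] := simple_of_modular (e := e) lN.
- by exists 0; rewrite /= lqB lqM rmulBl -rmulA ee subrr rmul0l.
- rewrite ee => eE; have [c cE] := corner b.
  apply: (lev_sub_nunit ee eu ue eu' u'e uu' u'u k0 ev_inj (f := c)).
  by rewrite -cE -zE -!rmulA ez -eE ee.
exists S, x; split=> // y ey.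
have [a aE] := simple_gen y simS x0.
have yE : y = act (e ** a ** e) x by rewrite !actM ex aE ey.
rewrite yE -actM; apply: Nx; rewrite /N /= -/z !lqM.
have [c cE] := corner (q a); exists (q e ** q a ** q e).
have aee : q e ** q a ** q e ** q e = q e ** q a ** q e by rewrite -rmulA ee.
by rewrite -rmulA aee cE levz.
Qed.

(** The scalar is an invariant of the module: if [k] and [l] gave isomorphic modules, (k - l) e
    would kill a nonzero vector fixed by [e]. *)
Lemma laurent_corner_countable : CIRT L -> countable [set: K].
Proof.
move=> [F hF].
have ex k : exists S : rngModule L, k != 0 -> simple_module S /\ exists x : S,
    [/\ x <> 0, act e x = x & forall y : S, act e y = y -> act (u0 - k *: e) y = 0].
  have [->|k0] := eqVneq k 0.
    by have [S _] := corner_simple ee e0; exists S.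
  have [S [x [simS x0 ex hx]]] := laurent_corner_simple k0.
  by exists S => _; split=> //; exists x.
have [S hS] := choice ex.
(* The code 0 is reserved for the scalar 0, which has no module of this kind attached to it. *)
apply/countable_injP; exists (fun k => if k == 0 then 0%N else (F (S k)).+1).
move=> k l _ _; have [->|k0] := eqVneq k 0; first by case: eqVneq.
have [->|l0 [Fkl]] := eqVneq l 0 => //.
have [simk [x [x0 ex' zx]]] := hS k k0; have [siml [x1 [_ _ zl]]] := hS l l0.
have [phi [bphi phiD phiM]] := (hF _ _ simk siml).1 Fkl.
apply: contrapT => kl; apply: x0; apply: (bij_inj bphi).
have phi0 : phi 0 = 0 by apply: (addrI (phi 0)); rewrite -phiD !addr0.
have ey : act e (phi x) = phi x by rewrite -phiM ex'.
have := zl _ ey; have := zx _ ex'; move=> /(congr1 phi); rewrite phi0 phiM => zk zl'.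
have : act (((k - l)^-1 *: e) ** ((u0 - l *: e) - (u0 - k *: e))) (phi x) = 0.
  by rewrite actM actBl zk zl' subrr act0r.
have kl0 : k - l != 0 by rewrite subr_eq0; apply/eqP.
have -> : (u0 - l *: e) - (u0 - k *: e) = (k - l) *: e.
  by rewrite opprB addrC addrA subrK scalerBl.
rewrite lscaleAl lscaleAr scalerA mulVf // scale1r.
by rewrite actM !ey.
Qed.

End LaurentCorner.
Lemma wide_kernel m n (A : 'M[K]_(m, n)) : (n < m)%N ->
  exists2 a : 'rV[K]_m, a *m A = 0 & a != 0.
Proof.
move=> nm; have : kermx A != 0.
  rewrite kermx_eq0 -row_leq_rank -ltnNge; exact: leq_ltn_trans (rank_leq_col A) nm.
by move=> /rowV0Pn[a /sub_kermxP aA a0]; exists a.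
Qed.

(* A closed path based at a vertex of I + L e L would have linearly independent
   powers in the span of finitely many x e y. *)
Lemma base_corner_no_cycle (e : L) (c : seq (edge E)) (v : vertex E) :
  graded_ideal I -> (forall a, exists k : K, q e ** a ** q e = k *: q e) ->
  c != [::] -> ispath c v -> start c v = v ->
  lvertex K v \in add_ideal I e -> lvertex K v \in I.
Proof.
move=> gI corner c0 pc sc /add_idealP[s]; rewrite -!/(q _).
have [cf cfE] := choice corner.
pose N := size s; pose x i : Q := q (nth (0, 0) s i).1; pose y i : Q := q (nth (0, 0) s i).2.
have -> : \sum_(p <- s) rng_quot_pi I p.1 ** rng_quot_pi I e ** rng_quot_pi I p.2 =
    \sum_(i < N) x i ** q e ** y i by rewrite (big_nth (0, 0)) big_mkord.
move=> vE; pose Y n := pw (lvertex K v) (pth K c v) n.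
have vY n : lvertex K v ** Y n = Y n.
  by apply: pw_el; [exact: VV | rewrite -{1}sc Vpth].
have Yv n : Y n ** lvertex K v = Y n by apply: pw_er; exact: VV.
have hY n : homogeneous (n * size c)%:Z (Y n).
  elim: n => [|n IH]; first exact: hom_vertex.
  by rewrite mulSn PoszD; apply: hom_mul => //; apply: hom_pth.
(* Writing the vertex as the sum of the [x i ** q e ** y i] on both sides of the power leaves a
   corner element in the middle, which is a scalar. So all powers lie in the span of [N * N]
   products. *)
have YE n : q (Y n) = \sum_(i < N) \sum_(j < N) cf (y i ** q (Y n) ** x j) *: (x i ** q e ** y j).
  rewrite -[in LHS](Yv n) -[in LHS](vY n) !lqM vE rmul_suml rmul_suml.
  apply: eq_bigr => i _; rewrite rmul_sumr; apply: eq_bigr => j _.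
  have := cfE (y i ** q (Y n) ** x j).
  by rewrite -(qscaleAl _ (x i ** q e)) -qscaleAr => <-; rewrite !rmulA.
pose A : 'M[K]_((N * N).+1, N * N) := \matrix_(n < (N * N).+1)
  mxvec (\matrix_(i < N, j < N) cf (y i ** q (Y n) ** x j)).
have [a aA a0] := wide_kernel A (ltnSn _).
have aY : \sum_(n < (N * N).+1) a 0 n *: q (Y n) = 0.
  under eq_bigr => n _ do rewrite YE scaler_sumr.
  rewrite exchange_big big1 // => i _.
  under eq_bigr => n _ do rewrite scaler_sumr.
  rewrite exchange_big big1 // => j _.
  under eq_bigr => n _ do rewrite scalerA.
  rewrite -scaler_suml [X in X *: _](_ : _ = 0) ?scale0r //.
  have := congr1 (fun B : 'rV[K]_(N * N) => B 0 (mxvec_index i j)) aA.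
  rewrite !mxE => aij; rewrite -[RHS]aij; apply: eq_bigr => n _.
  by rewrite mxE mxvecE mxE.
have [m am] : exists m, a 0 m != 0.
  apply: contrapT => /forallNP am; move/eqP: a0; apply; apply/rowP => m.
  by rewrite mxE; apply/eqP; apply: contrapT => h; apply: (am m); apply/negP.
(* The coefficients are extended by 0 to all naturals, since [graded_component] takes a sequence. *)
pose z n := (if insub n is Some n' then a 0 (n' : 'I_((N * N).+1)) else 0) *: Y n.
have zE (n : 'I_((N * N).+1)) : z n = a 0 n *: Y n by rewrite /z valK.
have zI : z m \in I.
  apply: (graded_component gI (d := fun n => (n * size c)%:Z)) (ltn_ord m).
  - by move=> k l [] /eqP; rewrite eqn_pmul2r ?lt0n ?size_eq0 // => /eqP.
  - by move=> n; apply: hom_scale.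
  - apply/lq_eq0; rewrite lq_sum -[RHS]aY; apply: eq_bigr => n _.
    by rewrite zE lqZ.
have YI : Y m \in I.
  by rewrite -[Y m]scale1r -(mulVf am) -scalerA -zE; apply: ideal_scale.
(* The power of the closed path is undone by the same power of its ghost, which brings the vertex
   itself into [I]. *)
have gp : gth K c v ** pth K c v = lvertex K v by rewrite gth_pth.
have Vp := Vpth K c v; have gV := gthV K c v; rewrite sc in Vp gV.
rewrite -(pw_inv (VV K v) m (Vgth K c v) gV Vp (pthV K c v) gp).
by apply: rng_idealMl.
Qed.

End CornerModules.

(** * Idempotents with corner K or K[x, x^-1] *)

Section Corners.
Local Open Scope ring_scope.
Local Open Scope rng_scope.
Variables (K : fieldType) (E : graph) (I : rngIdeal (leavitt K E)).
Local Notation L := (leavitt K E).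
Local Notation Q := (lquot I).
Local Notation V := (@lvertex K E).
Local Notation Ed := (@ledge K E).
Local Notation Gh := (@lghost K E).
Local Notation pth := (@pth K E).
Local Notation gth := (@gth K E).
Local Notation mon := (@mon K E).
Local Notation q := (@lq K E I).
Implicit Types (x y z : L) (v w : vertex E) (f g : edge E) (r s t : seq (edge E)).

Lemma corner_scal_ex (e : Q) (P : Q -> Prop) :
  P 0 -> (forall a b, P a -> P b -> P (a + b)) -> (forall (k : K) a, P a -> P (k *: a)) ->
  (forall r w s, P (e ** q (mon r w s) ** e)) -> forall a, P (e ** a ** e).
Proof.
move=> P0 PD PZ Pm a; have [x ->] := lq_surj a.
elim/leavitt_ind: x => [|x y Px Py|k r w s].
- by rewrite lq0 rmul0r rmul0l.
- by rewrite lqD rmulDr rmulDl; apply: PD.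
- by rewrite lqZ qscaleAr qscaleAl; apply: PZ.
Qed.

Section BaseTheta.
Variable e : Q.
Hypotheses (e0 : e <> 0) (ee : e ** e = e).

Lemma base_thetaD : {morph (fun c : K => c *: e) : r s / r + s}.
Proof. by move=> c d; rewrite scalerDl. Qed.
Lemma base_thetaM (c d : K) : (c * d) *: e = (c *: e) ** (d *: e).
Proof. by rewrite qscaleAl qscaleAr ee scalerA. Qed.
Lemma base_theta_inj (c : K) : c *: e = 0 -> c = 0.
Proof.
move=> ce0; have [//|c0] := eqVneq c 0; case: e0.
by rewrite -[e]scale1r -(mulVf c0) -scalerA ce0 scaler0.
Qed.
Lemma base_thetaZ (k c : K) : exists d : K, k *: (c *: e) = d *: e.
Proof. by exists (k * c); rewrite scalerA. Qed.

End BaseTheta.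

(** * An idempotent that kills all edges: the corner is K *)

Section SinkCorner.
Variables (v : vertex E) (e : L).
Hypotheses (e0 : q e <> 0) (ee : q e ** q e = q e)
  (ve : q (V v) ** q e = q e) (ev : q e ** q (V v) = q e)
  (eEd : forall f, q e ** q (Ed f) = 0) (Ghe : forall f, q (Gh f) ** q e = 0).

Let Ve0 w : w != v -> q (V w) ** q e = 0.
Proof. by move=> wv; rewrite -ve rmulA -lqM VV0 // lq0 rmul0l. Qed.
Let eV0 w : v != w -> q e ** q (V w) = 0.
Proof. by move=> wv; rewrite -ev -rmulA -lqM VV0 // lq0 rmul0r. Qed.
Let e_pth f r w : q e ** q (pth (f :: r) w) = 0.
Proof. by rewrite lqM rmulA eEd rmul0l. Qed.
Let gth_e f r w : q (gth (f :: r) w) ** q e = 0.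
Proof. by rewrite lqM -rmulA Ghe rmul0r. Qed.

Lemma sink_corner a : exists c : K, q e ** a ** q e = c *: q e.
Proof.
pose P (z : Q) := exists c : K, z = c *: q e; rewrite -/(P _).
apply: corner_scal_ex; rewrite /P {P}.
- by exists 0; rewrite scale0r.
- by move=> _ _ [c ->] [d ->]; exists (c + d); rewrite scalerDl.
- by move=> k _ [c ->]; exists (k * c); rewrite scalerA.
move=> [|f r] w s; last first.
  by exists 0; rewrite /mon lqM rmulA e_pth !rmul0l scale0r.
case: s => [|f s]; last first.
  by exists 0; rewrite /mon lqM -!rmulA gth_e !rmul0r scale0r.
rewrite /mon /= VV; have [<-|vw] := eqVneq v w; last first.
  by exists 0; rewrite eV0 // rmul0l scale0r.
by exists 1; rewrite -rmulA ve ee scale1r.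
Qed.

(** Indices are edge words, those with nonzero class being paths ending at [v]. If one path properly
    extends another, the leftover edge is killed by [e], so only equal paths pair to something
    nonzero. *)
Lemma sink_iso : exists X : choiceType,
  rng_iso (subquotient (add_ideal I e) I) (fin_matrix X K).
Proof.
pose be r := q (pth r v) ** q e; pose be' r := q e ** q (gth r v).
have be_path r : be r <> 0 -> ispath r v.
  by apply: contra_notT => /(ispath_pth0 K) r0; rewrite /be r0 lq0 rmul0l.
apply: (@corner_iso _ _ _ _ K (fun c => c *: q e) _ _ _ _ _ _ be be').
- exact: base_thetaD.
- exact: base_thetaM.
- exact: base_theta_inj.
- exact: scale1r.
- exact: base_thetaZ.
- by move=> r; rewrite /be -rmulA ee.
- by move=> r; rewrite /be' rmulA ee.
- move=> r /be_path pr; rewrite /be /be' -rmulA (rmulA (q (gth _ _))) -lqM.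
  by rewrite gth_pth // ve ee.
- move=> r s /be_path pr /be_path ps.
  rewrite {1}/be {1}/be' -rmulA (rmulA (q (gth _ _))) -lqM.
  have [->|[[|f t] [sE _ _ ->]]|[[|f t] [rE _ _ ->]]] := gth_pth_cases K r s v v.
  + by left; rewrite lq0 rmul0l rmul0r.
  + right; exists 1, 1; rewrite !mulr1 !scale1r sE cats0; split=> //.
      by rewrite /be -rmulA ee.
    by rewrite /be' rmulA ee.
  + by left; rewrite rmulA e_pth rmul0l.
  + right; exists 1, 1; rewrite !mulr1 !scale1r rE cats0; split=> //.
      by rewrite /be -rmulA ee.
    by rewrite /be' rmulA ee.
  + by left; rewrite gth_e rmul0r.
- move=> r w [|f s]; last by left; rewrite /mon lqM -rmulA gth_e rmul0r.
  have [->|wv] := eqVneq w v; last first.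
    by left; rewrite /mon lqM -rmulA Ve0 // rmul0r.
  have [r0|r0] := pselect (be r = 0).
    by left; rewrite /mon /= pthV.
  by right; exists r, 1; split=> //; rewrite /mon /= pthV scale1r /be -rmulA ee.
- move=> [|f r] w s; last by left; rewrite /mon lqM rmulA e_pth rmul0l.
  have [<-|wv] := eqVneq v w; last first.
    by left; rewrite /mon lqM rmulA eV0 // rmul0l.
  rewrite /mon /= Vgth; have [s0|s0] := pselect (be s = 0); last first.
    by right; exists s, 1; split=> //; rewrite scale1r /be' rmulA ee.
  left; rewrite ispath_gth0 ?lq0 ?rmul0r //; apply/negP => ps; apply: e0.
  have : q e ** q (gth s v) ** be s = q e.
    by rewrite /be -rmulA (rmulA (q (gth _ _))) -lqM gth_pth // ve ee.
  by rewrite s0 rmul0r.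
Qed.

End SinkCorner.
(* A vertex from which only one path leaves modulo I: the corner at [w 0] is
   spanned by the elements [lstep a l], which compare positions visiting the
   same vertex. *)
Section LineCorner.
Variables (w : nat -> vertex E) (f : nat -> edge E).
Hypotheses (w_live : q (V (w 0)) <> 0)
  (src_f : forall n, src (f n) = w n) (rge_f : forall n, rge (f n) = w n.+1)
  (only_f : forall n g, src g = w n -> q (V (rge g)) <> 0 -> g = f n)
  (ck2 : forall n, q (V (w n)) = q (Ed (f n)) ** q (Gh (f n))).

Definition seg a k : seq (edge E) := [seq f i | i <- iota a k].

Lemma segS a k : seg a k.+1 = f a :: seg a.+1 k. Proof. by []. Qed.
Lemma size_seg a k : size (seg a k) = k.
Proof. by rewrite size_map size_iota. Qed.
Lemma seg_cat a k l : seg a (k + l) = seg a k ++ seg (a + k) l.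
Proof. by rewrite /seg iotaD map_cat. Qed.
Lemma start_seg a k : start (seg a k) (w (a + k)) = w a.
Proof. by case: k => [|k] /=; rewrite ?addn0 ?src_f. Qed.
Lemma ispath_seg a k : ispath (seg a k) (w (a + k)).
Proof.
elim: k a => [|k IH] a //=; rewrite rge_f -addSnnS.
by rewrite start_seg eqxx IH.
Qed.

Let P a k : Q := q (pth (seg a k) (w (a + k))).
Let G a k : Q := q (gth (seg a k) (w (a + k))).

Let GP a k : G a k ** P a k = q (V (w (a + k))).
Proof. by rewrite -lqM gth_pth ?ispath_seg. Qed.
Let PG a k : P a k ** G a k = q (V (w a)).
Proof.
elim: k a => [|k IH] a; first by rewrite /P /G /= addn0 -lqM VV.
rewrite /P /G /= !lqM -rmulA (rmulA (q (pth _ _))) -addSnnS [X in _ ** (X ** _)]IH.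
by rewrite -rge_f rmulA -lqM EdV -ck2.
Qed.
Let Pcat a k l : P a (k + l) = P a k ** P (a + k) l.
Proof. by rewrite /P seg_cat pth_cat addnA start_seg lqM. Qed.
Let Gcat a k l : G a (k + l) = G (a + k) l ** G a k.
Proof. by rewrite /G seg_cat gth_cat addnA start_seg lqM. Qed.
Let VP a k : q (V (w a)) ** P a k = P a k.
Proof. by rewrite -lqM -{1}(start_seg a k) Vpth. Qed.
Let PV a k : P a k ** q (V (w (a + k))) = P a k.
Proof. by rewrite -lqM pthV. Qed.
Let VG a k : q (V (w (a + k))) ** G a k = G a k.
Proof. by rewrite -lqM Vgth. Qed.
Let GV a k : G a k ** q (V (w a)) = G a k.
Proof. by rewrite -lqM -{1}(start_seg a k) gthV. Qed.

(** An edge that leaves the line has its range in [I], so a path that starts on the line and is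
    nonzero modulo [I] must follow it. *)
Lemma live_path a t u : q (pth t u) <> 0 -> start t u = w a ->
  t = seg a (size t) /\ u = w (a + size t).
Proof.
elim: t a => [|g t IH] a /=; first by rewrite addn0.
rewrite lqM => tu0 srcg.
have t0 : q (pth t u) <> 0 by move=> t0; rewrite t0 rmul0r in tu0.
have rs : rge g = start t u.
  apply: contrapT => /eqP rs; apply: tu0.
  by rewrite -lqM -Vpth rmulA EdV0 // rmul0l lq0.
have gE : g = f a.
  apply: only_f => // r0; apply: tu0.
  by rewrite -EdV lqM r0 rmul0r rmul0l.
have [|tE uE] := IH a.+1 t0; first by rewrite -rs gE rge_f.
by rewrite -addSnnS {1}tE gE.
Qed.

Lemma live_gth t u : q (gth t u) <> 0 -> q (pth t u) <> 0.
Proof.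
have [pt|/(ispath_gth0 K) ->] := boolP (ispath t u); last by rewrite lq0.
move=> g0 p0; apply: g0; rewrite -Vgth lqM -(gth_pth K pt) lqM p0.
by rewrite rmul0r rmul0l.
Qed.

Definition lstep a l : Q := P 0 a ** G 0 l.

Lemma line_corner_mon r u s :
  q (V (w 0)) ** q (mon r u s) ** q (V (w 0)) = 0 \/
  exists a l, w a = w l /\ q (V (w 0)) ** q (mon r u s) ** q (V (w 0)) = lstep a l.
Proof.
rewrite /mon lqM rmulA -rmulA.
have [rE|rE] := eqVneq (w 0) (start r u); last first.
  by left; rewrite -lqM Vpth0 // lq0 rmul0l.
have [sE|sE] := eqVneq (start s u) (w 0); last first.
  by left; rewrite -(lqM I (gth _ _)) gthV0 // lq0 rmul0r.
rewrite -(lqM I (V _)) -(lqM I (gth _ _)).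
have -> : V (w 0) ** pth r u = pth r u by rewrite rE Vpth.
have -> : gth s u ** V (w 0) = gth s u by rewrite -sE gthV.
have [->|r0] := pselect (q (pth r u) = 0); first by left; rewrite rmul0l.
have [->|/live_gth s0] := pselect (q (gth s u) = 0); first by left; rewrite rmul0r.
have [rE' ru] := live_path r0 (esym rE); have [sE' su] := live_path s0 sE.
right; exists (size r), (size s); split.
  by rewrite -[size r]add0n -[size s]add0n -ru -su.
by rewrite /lstep /P /G -ru -su -rE' -sE'.
Qed.

Section LineIso.
Variables (R : nzRingType) (theta : R -> Q).
Hypotheses (thetaD : {morph theta : a b / a + b})
  (thetaM : forall a b, theta (a * b) = theta a ** theta b)
  (theta_inj : forall a, theta a = 0 -> a = 0)
  (theta1 : theta 1 = q (V (w 0)))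
  (thetaZ : forall (k : K) a, exists b, k *: theta a = theta b)
  (theta_unit : forall k l, w k = w l -> exists a b,
     [/\ a * b = 1, b * a = 1, theta a = lstep k l & theta b = lstep l k]).

(** The index [(r, k)] stands for a path [r] ending at [w k], followed by the ghost path back to
    [w 0]. Prolonging [r] along the line changes this element only by a unit of the corner, which is
    why duality is available only up to units. *)
Lemma line_iso : exists X : choiceType,
  rng_iso (subquotient (add_ideal I (V (w 0))) I) (fin_matrix X R).
Proof.
pose be (i : seq (edge E) * nat) := q (pth i.1 (w i.2)) ** G 0 i.2.
pose be' (i : seq (edge E) * nat) := P 0 i.2 ** q (gth i.1 (w i.2)).
have be_e i : be i ** q (V (w 0)) = be i by rewrite /be -rmulA GV.
have be'_e i : q (V (w 0)) ** be' i = be' i by rewrite /be' rmulA VP.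
have be_path i : be i <> 0 -> ispath i.1 (w i.2).
  by apply: contra_notT => /(ispath_pth0 K) r0; rewrite /be r0 lq0 rmul0l.
have dualp i : ispath i.1 (w i.2) -> be' i ** be i = q (V (w 0)).
  move=> pr; rewrite /be /be' -rmulA (rmulA (q (gth _ _))) -(lqM I (gth _ _)).
  by rewrite gth_pth // (VG 0) PG.
(* A live [t] starting on the line is a segment of it; the segment cancels against the ghost path up
   to a factor [lstep], which [theta_unit] makes a unit. *)
have unit_ext r k t l : q (pth t (w l)) <> 0 -> w k = start t (w l) ->
    unit_equiv theta be be' (r, k) (r ++ t, l).
  move=> t0 kE; have [tE lE] := live_path t0 (esym kE).
  have [x [y [xy yx xE yE]]] := theta_unit (esym lE).
  have pE : q (pth t (w l)) = P k (size t) by rewrite /P -tE -lE.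
  have gE : q (gth t (w l)) = G k (size t) by rewrite /G -tE -lE.
  exists x, y; split=> //; rewrite ?xE ?yE /be /be' /= /lstep.
    rewrite pth_cat -kE lqM pE -!rmulA; congr (_ ** _).
    by rewrite !rmulA Pcat rmulA GP VP.
  rewrite gth_cat -kE lqM gE -!rmulA; congr (_ ** _).
  by rewrite !rmulA Gcat -(rmulA (G _ _)) GP GV.
apply: (@corner_iso _ _ _ _ R theta _ _ _ _ _ _ be be') => //.
- by move=> i /be_path; apply: dualp.
- move=> [r k] [s l] _ _; rewrite {1}/be {1}/be' /=.
  rewrite -rmulA (rmulA (q (gth _ _))) -(lqM I (gth _ _)).
  have [->|[t [sE _ kE ->]]|[t [rE _ lE ->]]] := gth_pth_cases K r s (w k) (w l).
  + by left; rewrite lq0 rmul0l rmul0r.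
  + have [->|t0] := pselect (q (pth t (w l)) = 0); first by left; rewrite rmul0l rmul0r.
    by right; rewrite sE; apply: unit_ext.
  + have [->|/live_gth t0] := pselect (q (gth t (w k)) = 0).
      by left; rewrite rmul0l rmul0r.
    right; rewrite rE.
    exact: (unit_equiv_sym thetaM theta1 be_e be'_e (unit_ext _ _ _ _ t0 lE)).
- move=> r u s; have [sE|sE] := eqVneq (start s u) (w 0); last first.
    by left; rewrite /mon lqM -rmulA -(lqM I (gth _ _)) gthV0 // lq0 rmul0r.
  rewrite /mon lqM -rmulA -(lqM I (gth _ _)) -sE gthV.
  have [->|/live_gth s0] := pselect (q (gth s u) = 0); first by left; rewrite rmul0r.
  have [sE' su] := live_path s0 sE.
  have beE : q (pth r u) ** q (gth s u) = be (r, size s).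
    by rewrite /be /G /= -su -sE'.
  have [b0|b0] := pselect (be (r, size s) = 0); first by left; rewrite beE.
  by right; exists (r, size s), 1; split=> //; rewrite beE theta1 be_e.
- move=> r u s; have [rE|rE] := eqVneq (w 0) (start r u); last first.
    by left; rewrite /mon lqM rmulA -(lqM I (V _)) Vpth0 // lq0 rmul0l.
  rewrite /mon lqM rmulA -(lqM I (V _)) rE Vpth.
  have [->|r0] := pselect (q (pth r u) = 0); first by left; rewrite rmul0l.
  have [rE' ru] := live_path r0 (esym rE).
  have beE : q (pth r u) ** q (gth s u) = be' (s, size r).
    by rewrite /be' /P /= -ru -rE'.
  have [b0|b0] := pselect (be (s, size r) = 0); last first.
    by right; exists (s, size r), 1; split=> //; rewrite beE theta1 be'_e.
  left; rewrite beE /be' /=.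
  have [ps|/(ispath_gth0 K) ->] := boolP (ispath s (w (size r))); last by rewrite lq0 rmul0r.
  by case: w_live; rewrite -(dualp (s, size r)) // b0 rmul0r.
Qed.

End LineIso.

Let e := q (V (w 0)).
Let ee : e ** e = e. Proof. by rewrite -lqM VV. Qed.

Section Injective.
Hypothesis w_inj : forall k l, w k = w l -> k = l.

Let lstepnn k : lstep k k = e. Proof. exact: PG. Qed.

Lemma line_base_iso : exists X : choiceType,
  rng_iso (subquotient (add_ideal I (V (w 0))) I) (fin_matrix X K).
Proof.
apply: (@line_iso K (fun c => c *: e)).
- exact: base_thetaD.
- exact: base_thetaM.
- exact: base_theta_inj.
- exact: scale1r.
- exact: base_thetaZ.
- move=> k l /w_inj <-; exists 1, 1; rewrite !mulr1 scale1r lstepnn.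
  by split.
Qed.

Lemma line_base_corner a : exists c : K, e ** a ** e = c *: e.
Proof.
pose S (z : Q) := exists c : K, z = c *: e; rewrite -/(S _).
apply: corner_scal_ex; rewrite /S {S}.
- by exists 0; rewrite scale0r.
- by move=> _ _ [c ->] [d ->]; exists (c + d); rewrite scalerDl.
- by move=> k _ [c ->]; exists (k * c); rewrite scalerA.
move=> r u s; have [->|[k [l [/w_inj <- ->]]]] := line_corner_mon r u s.
  by exists 0; rewrite scale0r.
by exists 1; rewrite lstepnn scale1r.
Qed.

End Injective.

Section Periodic.
Variable n : nat.
Hypotheses (gradedI : graded_ideal I) (n_gt0 : (0 < n)%N) (w_per : w n = w 0)
  (w_min : forall k l, w k = w l -> (k <= l)%N -> (n %| l - k)%N).

Let u : Q := P 0 n.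
Let u' : Q := G 0 n.

Let f_per k : f (k + n) = f k /\ w (k + n) = w k.
Proof.
have live m : q (V (w m)) <> 0.
  elim: m => [//|m IH] /= h; apply: IH.
  by rewrite ck2 -EdV rge_f lqM h rmul0r rmul0l.
have fE m : w (m + n) = w m -> f (m + n) = f m.
  by move=> wm; apply: only_f; rewrite ?src_f // rge_f.
elim: k => [|k [fk wk]]; first by split=> //; apply: fE; rewrite add0n.
have wS : w (k.+1 + n) = w k.+1 by rewrite addSn -!rge_f fk.
by split=> //; apply: fE.
Qed.

Let seg_per k m : seg (k + n) m = seg k m.
Proof.
elim: m k => [//|m IH] k; rewrite !segS -addSn IH.
by have [-> _] := f_per k.
Qed.

Let P_per m : P n m = P 0 m.
Proof.
rewrite /P -[in seg n m](add0n n) seg_per; congr (q (pth _ _)).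
by rewrite add0n addnC; have [_ ->] := f_per m.
Qed.
Let G_per m : G n m = G 0 m.
Proof.
rewrite /G -[in seg n m](add0n n) seg_per; congr (q (gth _ _)).
by rewrite add0n addnC; have [_ ->] := f_per m.
Qed.

Let eu : e ** u = u. Proof. exact: VP. Qed.
Let ue : u ** e = u. Proof. by rewrite /u -[in RHS](PV 0 n) add0n w_per. Qed.
Let eu' : e ** u' = u'. Proof. by rewrite /u' -[in RHS](VG 0 n) add0n w_per. Qed.
Let u'e : u' ** e = u'. Proof. exact: GV. Qed.
Let uu' : u ** u' = e. Proof. exact: PG. Qed.
Let u'u : u' ** u = e. Proof. by rewrite /u /u' GP add0n w_per. Qed.

Let P_pow m j : P 0 (j * n + m) = pw e u j ** P 0 m.
Proof.
elim: j => [|j IH]; first by rewrite mul0n add0n VP.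
by rewrite mulSn -addnA Pcat add0n P_per IH rmulA.
Qed.
Let G_pow m j : G 0 (j * n + m) = G 0 m ** pw e u' j.
Proof.
elim: j => [|j IH]; first by rewrite mul0n add0n GV.
by rewrite mulSn -addnA Gcat add0n G_per IH -rmulA (pwSr ee).
Qed.

Let lstep_pow k j : lstep (j * n + k) k = pw e u j /\ lstep k (j * n + k) = pw e u' j.
Proof.
rewrite /lstep P_pow G_pow -rmulA PG rmulA PG; split; first exact: pw_er.
exact: pw_el.
Qed.

(** Two positions at the same vertex differ by a multiple of [n], and going [j] times round the
    cycle is the power [j] of [u]. *)
Let lstep_unit k l : w k = w l -> exists a b : laurent K,
  [/\ a * b = 1, b * a = 1, lev e u u' a = lstep k l & lev e u u' b = lstep l k].
Proof.
wlog kl : k l / (k <= l)%N.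
  move=> H; have [kl|/ltnW lk] := leqP k l; first exact: H.
  by move=> /esym /(H _ _ lk)[a [b [? ? ? ?]]]; exists b, a.
move=> wkl; have /dvdnP[j jE] := w_min wkl kl.
have lE : l = (j * n + k)%N by rewrite -jE subnK.
have [a [b [ab ba aE bE]]] := lev_unit ee eu ue eu' u'e uu' j.
by have [l1 l2] := lstep_pow k j; exists b, a; rewrite lE l1 l2.
Qed.

(** The power [j] of the cycle has degree [j * n], so each term of the sum lies in the graded ideal
    [I] by itself, and a power of [u] is invertible in the corner. The terms are lifted to L, where
    degrees make sense. *)
Let ev_inj p : ev e u p = 0 -> p = 0.
Proof.
move=> p0; apply/polyP => i; rewrite coef0.
have [ip|] := ltnP i (size p); last exact: nth_default.
pose y (j : nat) : L := p`_j *: iter j (rmul (pth (seg 0 n) (w n))) (V (w 0)).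
have yE j : q (y j) = p`_j *: pw e u j.
  rewrite /y lqZ; congr (_ *: _); elim: j => [//|j IH] /=.
  by rewrite lqM IH /u /P add0n.
have hy j : homogeneous ((j * n)%N)%:Z (y j).
  apply: hom_scale; elim: j => [|j IH] /=; first exact: hom_vertex.
  rewrite mulSn PoszD; apply: hom_mul => //.
  by rewrite -{1}(size_seg 0 n); apply: hom_pth.
have yI : y i \in I.
  apply: (graded_component gradedI _ hy _ ip).
    move=> j k /= [] /eqP; rewrite eqn_pmul2r //; exact/eqP.
  apply/lq_eq0; rewrite lq_sum -[RHS]p0 /ev; apply: eq_bigr => j _; exact: yE.
have /lq_eq0 := yI; rewrite yE => yi0.
apply: (base_theta_inj w_live); rewrite -/e -(pw_inv ee i eu ue eu' u'e uu').
by rewrite -qscaleAl yi0 rmul0l.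
Qed.

Lemma line_laurent_iso : exists X : choiceType,
  rng_iso (subquotient (add_ideal I (V (w 0))) I) (fin_matrix X (laurent K)).
Proof.
apply: (@line_iso (laurent K) (lev e u u')).
- exact: levD.
- exact: levM.
- exact: (lev_inj ee eu ue eu' u'e u'u ev_inj).
- exact: lev1.
- exact: levZ.
- exact: lstep_unit.
Qed.

Lemma line_laurent_corner a : exists b, e ** a ** e = lev e u u' b.
Proof.
have lev0 : exists b, 0 = lev e u u' b.
  by exists 0; rewrite theta0 //; exact: levD.
pose S (z : Q) := exists b, z = lev e u u' b; rewrite -/(S _).
apply: corner_scal_ex; rewrite /S {S}.
- exact: lev0.
- by move=> _ _ [c ->] [d ->]; exists (c + d); rewrite levD.
- by move=> k _ [c ->]; apply: levZ.
move=> r v s; have [->|[k [l [/lstep_unit[a' [_ [_ _ aE _]]] ->]]]] := line_corner_mon r v s.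
  exact: lev0.
by exists a'.
Qed.

Lemma line_laurent_countable : CIRT L -> countable [set: K]%classic.
Proof.
exact: (laurent_corner_countable (u0 := pth (seg 0 n) (w (0 + n)))
  w_live ee eu ue eu' u'e uu' u'u ev_inj line_laurent_corner).
Qed.

End Periodic.
End LineCorner.
End Corners.

(** * Finding the next step of the chain or a bifurcation *)

Section Steps.
Local Open Scope classical_set_scope.
Local Open Scope ring_scope.
Local Open Scope rng_scope.
Variables (K : fieldType) (E : graph) (I : rngIdeal (leavitt K E)).
Local Notation L := (leavitt K E).
Local Notation Q := (lquot I).
Local Notation V := (@lvertex K E).
Local Notation Ed := (@ledge K E).
Local Notation Gh := (@lghost K E).
Local Notation pth := (@pth K E).
Local Notation gth := (@gth K E).
Local Notation mon := (@mon K E).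
Local Notation q := (@lq K E I).
Implicit Types (v w : vertex E) (f g : edge E).

(** The last clause prepares the countability of [K]. For a corner [K] it holds vacuously, as no new
    vertex on a closed path can enter; for K[x, x^-1] the simple modules attached to the nonzero
    scalars give it. *)
Definition good_corner (e : L) : Prop :=
  [/\ homogeneous 0 e, q e ** q e = q e, q e <> 0,
      exists (k : coef_kind) (X : choiceType),
        rng_iso (subquotient (add_ideal I e) I) (fin_matrix X (coef_ring K k)) &
      forall c v, c != [::] -> ispath c v -> start c v = v ->
        V v \in add_ideal I e -> V v \notin I -> CIRT L -> countable [set: K]].

Definition live v : Prop := q (V v) <> 0.
Definition live_out v : set (edge E) := [set f | src f = v /\ live (rge f)].

Inductive reach v : vertex E -> Prop :=
| reach_refl : reach v v
| reach_step f : reach v (src f) -> live (rge f) -> reach v (rge f).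

Hypothesis gradedI : graded_ideal I.

Lemma hom_opp n (x : L) : homogeneous n x -> homogeneous n (- x).
Proof. by move=> hx; rewrite -scaleN1r; apply: hom_scale. Qed.

Lemma dead_edge f : ~ live (rge f) -> q (Ed f) = 0 /\ q (Gh f) = 0.
Proof.
move=> /contrapT r0; split; first by rewrite -EdV lqM r0 rmul0r.
by rewrite -VGh lqM r0 rmul0l.
Qed.

(* The idempotent v^H of a breaking vertex v, or v itself if v becomes a sink. *)
Definition gap v : L := V v - \sum_(f <- fset_set (live_out v)) Ed f ** Gh f.

(** Modulo [I] the gap is orthogonal to every edge: edges with dead range vanish, and a live edge
    leaving [v] is cancelled by its own summand. The gap thus behaves like a sink. *)
Lemma gap_good v : live v -> finite_set (live_out v) -> q (gap v) <> 0 ->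
  good_corner (gap v).
Proof.
move=> lv finv gap0.
have mem_out f : (f \in fset_set (live_out v)) = `[< src f = v /\ live (rge f) >].
  by rewrite in_fset_set //; apply/idP/idP => [/set_mem/asboolP|/asboolP/mem_set].
have Vg : V v ** gap v = gap v.
  rewrite /gap rmulBr VV rmul_sumr; congr (_ - _).
  rewrite !big_seq; apply: eq_bigr => f; rewrite mem_out => /asboolP[<- _].
  by rewrite rmulA VEd.
have gV : gap v ** V v = gap v.
  rewrite /gap rmulBl VV rmul_suml; congr (_ - _).
  rewrite !big_seq; apply: eq_bigr => f; rewrite mem_out => /asboolP[<- _].
  by rewrite -rmulA GhV.
have gEd f : q (gap v) ** q (Ed f) = 0.
  have [lf|/dead_edge[-> _]] := pselect (live (rge f)); last by rewrite rmul0r.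
  have [sf|sf] := eqVneq v (src f); last by rewrite -lqM -gV -rmulA VEd0 // rmul0r lq0.
  have fin : f \in fset_set (live_out v) by rewrite mem_out; apply/asboolP.
  rewrite -lqM /gap rmulBl sf VEd -sf rmul_suml (big_fsetD1 f) //=.
  rewrite -rmulA GhEd EdV big_seq big1 ?addr0 ?subrr ?lq0 // => g.
  by rewrite !inE => /andP[gf _]; rewrite -rmulA GhEd0 // rmul0r.
have gGh f : q (Gh f) ** q (gap v) = 0.
  have [lf|/dead_edge[_ ->]] := pselect (live (rge f)); last by rewrite rmul0l.
  have [sf|sf] := eqVneq (src f) v; last by rewrite -lqM -Vg rmulA GhV0 // rmul0l lq0.
  have fin : f \in fset_set (live_out v) by rewrite mem_out; apply/asboolP.
  rewrite -lqM /gap rmulBr -{1}sf GhV rmul_sumr (big_fsetD1 f) //=.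
  rewrite rmulA GhEd VGh big_seq big1 ?addr0 ?subrr ?lq0 // => g.
  by rewrite !inE => /andP[gf _]; rewrite rmulA GhEd0 1?eq_sym // rmul0l.
have gg : q (gap v) ** q (gap v) = q (gap v).
  rewrite [X in _ ** X]lqB rmulBr -lqM gV lq_sum rmul_sumr big1 ?subr0 // => f _.
  by rewrite lqM rmulA gEd rmul0l.
have qVg : q (V v) ** q (gap v) = q (gap v) by rewrite -lqM Vg.
have qgV : q (gap v) ** q (V v) = q (gap v) by rewrite -lqM gV.
split=> //.
- apply: hom_add; first exact: hom_vertex.
  apply: hom_opp; apply: big_ind; first exact: hom_zero.
    by move=> x y; apply: hom_add.
  by move=> f _; rewrite -[0](subrr 1); apply: hom_mul; [apply: hom_edge|apply: hom_ghost].
- by exists BaseField; apply: (sink_iso gap0 gg qVg qgV gEd gGh).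
- move=> c w c0 pc sc wJ /negP wI; case: wI.
  apply: (base_corner_no_cycle gradedI _ c0 pc sc wJ).
  exact: (sink_corner gg qVg qgV gEd gGh).
Qed.

Section UniqueExit.
Variable v : vertex E.
Hypotheses (lv : live v)
  (unique_exit : forall w, reach v w -> exists2 f, live_out w f &
     (forall g, live_out w g -> g = f) /\ q (V w) = q (Ed f) ** q (Gh f)).

Lemma unique_exit_good : exists e, good_corner e.
Proof.
have exP w : exists f, reach v w -> [/\ live_out w f,
    forall g, live_out w g -> g = f & q (V w) = q (Ed f) ** q (Gh f)].
  have [/unique_exit[f fw [uf ck]]|nw] := pselect (reach v w); first by exists f.
  by have [f _] := unique_exit (reach_refl v); exists f.
have [phi phiP] := choice exP.
pose w n := iter n (fun x => rge (phi x)) v; pose f n := phi (w n).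
have wR n : reach v (w n).
  elim: n => [|n IH]; first exact: reach_refl.
  have [[sf lf] _ _] := phiP _ IH.
  by apply: reach_step lf; rewrite sf.
have wS n : rge (f n) = w n.+1 by [].
have f_src n : src (f n) = w n by have [[]] := phiP _ (wR n).
have w_live n : live (w n).
  by case: n => [//|n]; rewrite -wS; have [[]] := phiP _ (wR n).
have f_only n g : src g = w n -> q (V (rge g)) <> 0 -> g = f n.
  by move=> sg lg; have [_ h _] := phiP _ (wR n); apply: h.
have ck n : q (V (w n)) = q (Ed (f n)) ** q (Gh (f n)) by have [] := phiP _ (wR n).
(* Either the path never returns to a vertex and the corner is [K], or it runs into a cycle. *)
have [w_inj|] := pselect (forall k l, w k = w l -> k = l).
  exists (V v); split=> //.
  - exact: hom_vertex.
  - by rewrite -lqM VV.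
  - exists BaseField; exact: (line_base_iso (w := w) lv f_src wS f_only ck w_inj).
  - move=> c u c0 pc sc uJ /negP uI; case: uI.
    apply: (base_corner_no_cycle gradedI _ c0 pc sc uJ) => a.
    exact: (line_base_corner (w := w) wS f_only ck w_inj a).
move=> ninj.
(* [n] will be the least distance between two visits to the same vertex, and [k0] the position of
   such a visit. The path may take some time to enter the cycle, so the corner is taken at [w k0]
   and not at [v]. *)
have exn : exists n, `[< exists k, (0 < n)%N /\ w k = w (k + n)%N >].
  move/existsNP: ninj => [k /existsNP[l /not_implyP[wkl kl]]].
  have [lt_kl|lt_lk|//] := ltngtP k l.
    by exists (l - k)%N; apply/asboolP; exists k; rewrite subn_gt0 subnKC // ltnW.
  by exists (k - l)%N; apply/asboolP; exists l; rewrite subn_gt0 subnKC // ltnW.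
case: (ex_minnP exn) => n /asboolP[k0 [n0 wk0]] nmin.
pose w' m := w (k0 + m)%N; pose f' m := f (k0 + m)%N.
have w'S m : rge (f' m) = w' m.+1 by rewrite /w' addnS.
have f'_src m : src (f' m) = w' m by exact: f_src.
have f'_only m g : src g = w' m -> q (V (rge g)) <> 0 -> g = f' m by exact: f_only.
have ck' m : q (V (w' m)) = q (Ed (f' m)) ** q (Gh (f' m)) by exact: ck.
have per : w' n = w' 0%N by rewrite /w' addn0.
have wper m : w' (m + n)%N = w' m.
  elim: m => [//|m IH]; rewrite addSn -!w'S; congr (rge (phi _)).
  by move: IH; rewrite /w'.
have wperj m j : w' (m + j * n)%N = w' m.
  by elim: j => [|j IH]; rewrite ?mul0n ?addn0 // mulSn addnCA addnC wper.
(* A nonzero remainder of the division by [n] would be a shorter return. *)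
have w'min k l : w' k = w' l -> (k <= l)%N -> (n %| l - k)%N.
  move=> wkl kl; have := divn_eq (l - k) n; set j := (_ %/ n)%N => lE.
  rewrite /dvdn; apply: contrapT => /negP; rewrite -lt0n => r0.
  have : (n <= (l - k) %% n)%N.
    apply: nmin; apply/asboolP; exists (k0 + k)%N; split=> //.
    rewrite -addnA -/(w' _) -/(w' _) -(wperj (k + _)%N j) -addnA.
    by rewrite (addnC ((l - k) %% n)%N) -lE subnKC.
  by rewrite leqNgt ltn_pmod.
have w'_live : q (V (w' 0%N)) <> 0 by exact: w_live.
exists (V (w' 0%N)); split=> //.
- exact: hom_vertex.
- by rewrite -lqM VV.
- exists LaurentRing.
  exact: (line_laurent_iso w'_live f'_src w'S f'_only ck' gradedI n0 per w'min).
- move=> c u _ _ _ _ _.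
  exact: (line_laurent_countable w'_live f'_src w'S f'_only ck' gradedI n0 per w'min).
Qed.

End UniqueExit.

Lemma step_or_bifurcation : (exists e, good_corner e) \/
  forall v, live v -> exists w f g, [/\ reach v w, live_out w f, live_out w g & f <> g].
Proof.
have [/existsNP[v /not_implyP[lv nbif]]|] :=
  pselect (~ forall v, live v -> exists w f g,
    [/\ reach v w, live_out w f, live_out w g & f <> g]);
  last by move/contrapT; right.
(* The vertex [w] of a nonzero gap may be any live one. If there is none, each vertex reachable from
   [v] has at most one live exit, and its vanishing gap shows both that there is one and that the
   vertex is this edge times its ghost modulo [I]. *)
left; have [[w [lw finw gap0]]|ngap] :=
    pselect (exists w, [/\ live w, finite_set (live_out w) & q (gap w) <> 0]).
  by exists (gap w); apply: gap_good.
apply: (unique_exit_good lv) => w rw.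
have lw : live w by case: rw.
have sub f g : live_out w f -> live_out w g -> g = f.
  by move=> lf lg; apply: contrapT => gf; apply: nbif; exists w, f, g; split=> // /esym.
have finw : finite_set (live_out w).
  have [[f lf]|n0] := pselect (live_out w !=set0).
    apply: (@sub_finite_set _ _ [set f]); last exact: finite_set1.
    by move=> g /(sub f g lf).
  by rewrite (_ : live_out w = set0) // -subset0 => f lf; apply: n0; exists f.
have gap0 : q (gap w) = 0.
  by apply: contrapT => g0; apply: ngap; exists w.
have ckw : q (V w) = q (\sum_(f <- fset_set (live_out w)) Ed f ** Gh f).
  by apply/eqP; rewrite -subr_eq0 -lqB gap0.
have [f lf] : live_out w !=set0.
  apply: contrapT => n0; apply: lw; rewrite ckw.
  rewrite (_ : live_out w = set0) ?fset_set0 ?big_seq_fset0 ?big_nil ?lq0 //.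
  by rewrite -subset0 => f lf; apply: n0; exists f.
exists f => //; split; first by move=> g; apply: sub.
rewrite ckw (_ : live_out w = [set f]) ?fset_set1 ?big_seq_fset1 ?lqM //.
by apply/seteqP; split=> [g /(sub f g lf)//|g ->].
Qed.

End Steps.

(** * Infinite paths and bifurcations *)

Section InfinitePaths.
Local Open Scope classical_set_scope.
Local Open Scope ring_scope.
Local Open Scope rng_scope.
Variables (K : fieldType) (E : graph) (I : rngIdeal (leavitt K E)).
Local Notation L := (leavitt K E).
Local Notation V := (@lvertex K E).
Local Notation pth := (@pth K E).
Local Notation gth := (@gth K E).
Local Notation mon := (@mon K E).
Local Notation q := (@lq K E I).
Local Notation live := (@live K E I).
Implicit Types (v w : vertex E) (f g : edge E) (p : nat -> edge E).

Let pre p n := mkseq p n.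
Definition pre_pth p n : L := pth (pre p n) (src (p n)).
Definition pre_gth p n : L := gth (pre p n) (src (p n)).

Definition inf_path p : Prop := forall n, rge (p n) = src (p n.+1).

Let preS p n : pre p n.+1 = rcons (pre p n) (p n).
Proof. by rewrite /pre /mkseq -addn1 iotaD map_cat add0n cats1. Qed.

Lemma ispath_pre p n : inf_path p -> ispath (pre p n) (src (p n)).
Proof.
move=> ip; elim: n => [//|n IH].
by rewrite preS -cats1 ispath_cat /= ip eqxx IH.
Qed.

Lemma start_pre p n : start (pre p n) (src (p n)) = src (p 0%N).
Proof. by case: n. Qed.

Lemma pre_pthS p n : pre_pth p n.+1 = pre_pth p n ** pth [:: p n] (src (p n.+1)).
Proof. by rewrite /pre_pth preS -cats1 pth_cat. Qed.

(* The defining property of the generator of Chen's simple module of the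
   infinite path p. *)
Definition carries (S : rngModule L) (x : S) p : Prop :=
  x <> 0 /\ forall n, act (pre_pth p n ** pre_gth p n) x = x.

(** The left ideal consists of the elements that annihilate some initial segment of [p] modulo [I].
    It avoids the first vertex because the vertices of [p] are live, and it contains that vertex
    minus each initial segment times its ghost, whence [carries]. *)
Lemma path_simple p : inf_path p -> (forall n, live (src (p n))) ->
  exists (S : rngModule L) (x : S), simple_module S /\ carries x p.
Proof.
move=> ip lp; pose v := src (p 0%N).
pose N := [set a : L | exists n, q (a ** pre_pth p n) = 0].
have Nge a m n : (m <= n)%N -> q (a ** pre_pth p m) = 0 -> q (a ** pre_pth p n) = 0.
  move=> /subnK <-; elim: (n - m)%N => [//|k IH] am.
  by rewrite addSn pre_pthS rmulA lqM IH // rmul0l.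
have lN : left_ideal N.
  split=> [|a b [m am] [n bn]|a b [n bn]]; rewrite /N /=.
  - by exists 0%N; rewrite rmul0l lq0.
  - exists (maxn m n); rewrite rmulBl lqB (Nge a m) ?leq_maxl //.
    by rewrite (Nge b n) ?leq_maxr // subr0.
  - by exists n; rewrite -rmulA lqM bn rmul0r.
have [a||S [x [simS x0 Nx vx]]] := simple_of_modular (e := V v) lN.
- by exists 0%N; rewrite /pre_pth /= rmulBl -rmulA VV subrr lq0.
- move=> [n]; rewrite /v -(start_pre p n) Vpth => pn0; apply: (lp n).
  by rewrite -(gth_pth K (ispath_pre n ip)) lqM pn0 rmul0r.
exists S, x; split=> //; split=> // n.
suff : act (V v - pre_pth p n ** pre_gth p n) x = 0.
  by rewrite actBl vx => /eqP; rewrite subr_eq0 => /eqP.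
apply: Nx; exists n; rewrite rmulBl -rmulA gth_pth ?ispath_pre // pthV.
by rewrite /v -(start_pre p n) Vpth subrr lq0.
Qed.

(** If no tails agreed, the ghost of a long initial segment of [p'] would annihilate any given
    [act a x]; this is [kill]. Now [y] is some [act a x] and is fixed by the initial segments of
    [p'] times their ghosts, so [y] would be 0. *)
Lemma carries_tail (S : rngModule L) (x y : S) p p' : simple_module S ->
  carries x p -> carries y p' -> exists m k, forall n, p' (m + n)%N = p (k + n)%N.
Proof.
move=> simS [x0 xp] [y0 yp']; apply: contrapT => notail.
have {}notail m k : exists n, p' (m + n)%N <> p (k + n)%N.
  by apply: contrapT => /forallNP h; apply: notail; exists m, k => n; apply: contrapT.
have kill a : exists n0, forall n, (n0 <= n)%N -> act (pre_gth p' n ** a) x = 0.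
  elim/leavitt_ind: a => [|a b [m am] [n bn]|c r w s].
  - by exists 0%N => n _; rewrite rmul0r act0l.
  - exists (maxn m n) => k; rewrite geq_max => /andP[mk nk].
    by rewrite rmulDr actDl am // bn // addr0.
  (* The monomial strips [s] from [p] and puts [r] in front, so [p'] shifted by the size of [r] is
     compared with [p] shifted by the size of [s]; [n] must reach beyond the disagreement at [j]. *)
  have [j jP] := notail (size r) (size s); exists (size r + j).+1 => n jn.
  have rn : (size r <= n)%N by apply: ltnW; apply: leq_trans jn; rewrite ltnS leq_addr.
  (* With this length, the word left after cancelling [s] and prefixing [r] has exactly [n] edges,
     as many as [pre p' n]. *)
  pose M := (size s + (n - size r))%N.
  suff z : pre_gth p' n ** mon r w s ** pre_pth p M = 0.
    rewrite -(xp M) lscaleAr -actM.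
    by rewrite lscaleAl (rmulA (pre_gth p' n ** mon r w s)) z rmul0l scaler0 act0l.
  rewrite /mon -!rmulA.
  have [->|[t [pE _ wE ->]]|[t [sE _ _ _]]] :=
    gth_pth_cases K s (pre p M) w (src (p M)); first by rewrite !rmul0r.
    rewrite pth_mul wE eqxx.
    have st : size t = (n - size r)%N.
      by have := congr1 size pE; rewrite size_mkseq size_cat /M => /addnI.
    have srt : size (r ++ t) = n by rewrite size_cat st subnKC.
    have pre_ne : pre p' n <> r ++ t.
      move=> ptE; apply: jP.
      have -> : p' (size r + j)%N = nth (p 0%N) (pre p' n) (size r + j) by rewrite nth_mkseq.
      have -> : p (size s + j)%N = nth (p 0%N) (pre p M) (size s + j).
        by rewrite nth_mkseq // /M ltn_add2l ltn_subRL.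
      by rewrite ptE pE !nth_cat !ltnNge !leq_addr /= !addKn.
    have [//|[t' [rtE _ _ _]]|[t' [p'E _ _ _]]] :=
      gth_pth_cases K (pre p' n) (r ++ t) (src (p' n)) (src (p M)).
    + case: pre_ne; have := congr1 size rtE; rewrite srt size_cat size_mkseq.
      by rewrite -{1}[n]addn0 => /addnI/esym/size0nil t'0; rewrite rtE t'0 cats0.
    + case: pre_ne; have := congr1 size p'E; rewrite size_cat srt size_mkseq.
      by rewrite -{1}[n]addn0 => /addnI/esym/size0nil t'0; rewrite p'E t'0 cats0.
  (* Here [s] would be at least as long as [pre p M], which forces [n] to be at most the size of
     [r]. *)
  exfalso; have := congr1 size sE; rewrite size_cat size_mkseq /M => /eqP.
  rewrite -addnA -{1}[size s]addn0 eqn_add2l eq_sym addn_eq0 subn_eq0 => /andP[nr _].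
  by move: jn; rewrite ltnNge (leq_trans nr) ?leq_addr.
have [a aE] := simple_gen y simS x0; have [n hn] := kill a.
by apply: y0; rewrite -(yp' n) -aE -actM -rmulA actM hn ?act0r.
Qed.

Fixpoint lpath v (l : seq (edge E)) : Prop :=
  if l is e :: l' then [/\ src e = v, live (rge e) & lpath (rge e) l'] else True.
Fixpoint lend v (l : seq (edge E)) : vertex E :=
  if l is e :: l' then lend (rge e) l' else v.

Lemma lpath_cat v l l' : lpath v (l ++ l') <-> lpath v l /\ lpath (lend v l) l'.
Proof.
elim: l v => [|e l IH] v /=; first by split=> [|[]].
by split=> [[-> le /IH[? ?]]|[[-> le ?] ?]]; split=> //; apply/IH.
Qed.

Lemma lend_cat v l l' : lend v (l ++ l') = lend (lend v l) l'.
Proof. by elim: l v => /=. Qed.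

Lemma lend_live v l : live v -> lpath v l -> live (lend v l).
Proof. by elim: l v => [|e l IH] v //= _ [_ le /IH]; apply. Qed.

Lemma reach_lpath v w : reach I v w -> exists l, lpath v l /\ lend v l = w.
Proof.
elim=> [|f _ [l [pl el]] lf]; first by exists [::].
exists (l ++ [:: f]); rewrite lend_cat el; split=> //.
by apply/lpath_cat; split=> //=; rewrite el.
Qed.

Lemma lpath_nth e0 v l i : lpath v l -> (i < size l)%N ->
  live (rge (nth e0 l i)) /\ (src (nth e0 l 0%N) = v) /\
  ((i.+1 < size l)%N -> rge (nth e0 l i) = src (nth e0 l i.+1)).
Proof.
elim: l v i => [|e l IH] v [|i] //= [se le pl] il.
  by split=> //; split=> //; case: l pl {IH il} => //= f l [-> _ _] _.
have [h1 [_ h2]] := IH _ i pl il.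
by split.
Qed.

(** * Diagonalisation against a sequence of infinite paths *)

Section Diagonal.
Variable v0 : vertex E.
Hypotheses (lv0 : live v0)
  (bif : forall v, live v -> exists w f g,
     [/\ reach I v w, live_out I w f, live_out I w g & f <> g]).

Lemma lpath_long v m : live v -> exists l, lpath v l /\ (m <= size l)%N.
Proof.
move=> lv; elim: m => [|m [l [pl ml]]]; first by exists [::].
have [w [f [_ [/reach_lpath[l' [pl' el']] [sf lf] _ _]]]] := bif (lend_live lv pl).
exists (l ++ l' ++ [:: f]); split.
  do 2 (apply/lpath_cat; split=> //); rewrite ?el' //=.
by rewrite !size_cat addn1 addnS ltnS (leq_trans ml) ?leq_addr.
Qed.

(** At a bifurcation one of the two edges differs from the edge of [rep] at the corresponding
    position. The path is first prolonged by [l1] so that the position of the bifurcation has the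
    form [m + j]. *)
Lemma lpath_avoid (rep : nat -> edge E) l m k : lpath v0 l ->
  exists l', [/\ lpath v0 (l ++ l'), (size l < size (l ++ l'))%N &
    exists2 j, (m + j < size (l ++ l'))%N &
      forall e0, nth e0 (l ++ l') (m + j)%N <> rep (k + j)%N].
Proof.
move=> pl; have [l1 [pl1 ml1]] := lpath_long m (lend_live lv0 pl).
have ll1 : lpath v0 (l ++ l1) by apply/lpath_cat.
have [w [f [g [/reach_lpath[l2 [pl2 el2]] [sf lf] [sg lg] fg]]]] :=
  bif (lend_live lv0 ll1).
pose l3 := (l ++ l1) ++ l2; have pl3 : lpath v0 l3 by apply/lpath_cat.
have el3 : lend v0 l3 = w by rewrite lend_cat.
pose j := (size l3 - m)%N.
have mj : (m + j = size l3)%N.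
  by rewrite subnKC // !size_cat (leq_trans ml1) // addnAC leq_addl.
have [e [se le ej]] : exists e, [/\ src e = w, live (rge e) & e <> rep (k + j)%N].
  have [fr|] := pselect (f = rep (k + j)%N); last by exists f.
  by exists g; split=> // gr; apply: fg; rewrite fr gr.
exists (l1 ++ l2 ++ [:: e]).
have -> : l ++ l1 ++ l2 ++ [:: e] = l3 ++ [:: e] by rewrite /l3 !catA.
split; first by apply/lpath_cat; split=> //=; rewrite el3.
  by rewrite !size_cat /= addn1 ltnS -addnA leq_addr.
exists j; first by rewrite mj size_cat addn1.
by move=> e0; rewrite mj nth_cat ltnn subnn.
Qed.

(** Stage [i] meets the requirement coded by [i]: from positions [m] and [k] on, the new path and
    [rep n] disagree somewhere. Stages only prolong the path, so a disagreement once reached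
    persists. *)
Lemma diagonal_path (rep : nat -> nat -> edge E) : exists p,
  [/\ inf_path p, forall n, live (src (p n)) &
      forall n m k, exists j, p (m + j)%N <> rep n (k + j)%N].
Proof.
have [_ [e0 _]] := bif lv0.
pose req i : nat * nat * nat := odflt (0, 0, 0)%N (choice.unpickle i).
have ext (li : seq (edge E) * nat) : exists l', lpath v0 li.1 ->
  [/\ lpath v0 (li.1 ++ l'), (size li.1 < size (li.1 ++ l'))%N &
    exists2 j, ((req li.2).1.2 + j < size (li.1 ++ l'))%N &
      forall e0, nth e0 (li.1 ++ l') ((req li.2).1.2 + j)%N <>
        rep (req li.2).1.1 ((req li.2).2 + j)%N].
  have [pl|nl] := pselect (lpath v0 li.1); last by exists [::].
  by have [l' ?] := lpath_avoid (rep (req li.2).1.1) (req li.2).1.2 (req li.2).2 pl; exists l'.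
have [F hF] := choice ext.
pose st := fix st i := if i is j.+1 then st j ++ F (st j, j) else [::].
have stS i : st i.+1 = st i ++ F (st i, i) by [].
have pst i : lpath v0 (st i).
  by elim: i => [//|i IH]; rewrite stS; have [] := hF (st i, i) IH.
have sst i : (i <= size (st i))%N.
  elim: i => [//|i IH]; rewrite stS; have [_ h _] := hF (st i, i) (pst i).
  exact: leq_ltn_trans IH h.
pose p n := nth e0 (st n.+1) n.
have mono i j n : (i <= j)%N -> (n < size (st i))%N -> nth e0 (st j) n = nth e0 (st i) n.
  move=> /subnK <-; elim: (j - i)%N => [//|d IH] ni.
  have ni' : (n < size (st (d + i)))%N.
    apply: leq_trans ni _; elim: d {IH} => [//|d IH]; apply: leq_trans IH _.
    by rewrite addSn stS size_cat leq_addr.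
  by rewrite addSn stS nth_cat ni' IH.
have pE i n : (n < size (st i))%N -> p n = nth e0 (st i) n.
  move=> ni; rewrite /p; have [le|/ltnW le] := leqP n.+1 i.
    by rewrite (mono _ _ _ le) // sst.
  exact: mono.
have pstep n : live (rge (p n)) /\ rge (p n) = src (p n.+1).
  have n2 := sst n.+2; have [h1 [_ h2]] := lpath_nth e0 (pst n.+2) (ltnW n2).
  by rewrite (pE n.+2 n (ltnW n2)) (pE n.+2 n.+1 n2); split=> //; apply: h2.
exists p; split; first by move=> n; have [] := pstep n.
  case=> [|n]; last by have [h <-] := pstep n.
  have n1 := sst 1%N; have [_ [h _]] := lpath_nth e0 (pst 1%N) n1.
  by rewrite (pE 1%N 0%N n1) h.
move=> n m k; pose i := choice.pickle (n, m, k).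
have ri : req i = (n, m, k) by rewrite /req choice.pickleK.
have [_ _ [j jm h]] := hF (st i, i) (pst i); rewrite /= ri /= in jm h.
by exists j; rewrite (pE i.+1) //.
Qed.

(** For each value of [F] one path carried by a simple module of that value is chosen, if there is
    any. A module carrying the diagonal path is isomorphic to the one chosen for its value, hence
    carries both paths, which would have to share a tail. *)
Lemma bifurcation_not_CIRT : ~ CIRT L.
Proof.
move=> [F hF].
have exrep n : exists rep : nat -> edge E,
    (exists S : rngModule L, simple_module S /\ F S = n /\ exists (x : S) p, carries x p) ->
    exists S : rngModule L, simple_module S /\ F S = n /\ exists x : S, carries x rep.
  have [[S [simS [FS [x [p xp]]]]]|nS] := pselect (exists S : rngModule L,
    simple_module S /\ F S = n /\ exists (x : S) p, carries x p).
    by exists p => _; exists S; split=> //; split=> //; exists x.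
  by have [_ [e0 _]] := bif lv0; exists (fun=> e0) => /nS.
have [rep hrep] := choice exrep.
have [p [ip lp pne]] := diagonal_path rep.
have [S [x [simS xp]]] := path_simple ip lp.
have [|S' [simS' [FS' [x' x'p]]]] := hrep (F S).
  by exists S; split=> //; split=> //; exists x, p.
have [phi [bphi phiD phiM]] := (hF S' S simS' simS).1 FS'.
have yp : carries (phi x') (rep (F S)).
  have [x'0 x'h] := x'p; split; last by move=> n; rewrite -phiM x'h.
  have phi0 : phi 0 = 0 by apply: (addrI (phi 0)); rewrite -phiD !addr0.
  by rewrite -phi0 => /(bij_inj bphi).
have [m [k mk]] := carries_tail simS yp xp.
by have [j] := pne (F S) m k; apply.
Qed.

End Diagonal.
End InfinitePaths.

(** * Simple modules of a layer of the chain *)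

Section FiniteSupport.
Local Open Scope classical_set_scope.
Local Open Scope ring_scope.

Lemma finite_support_ind (U : zmodType) (I : choiceType) (sup : U -> set I)
    (P : U -> Prop) :
  (forall u, finite_set (sup u)) -> (forall u, sup u = set0 -> u = 0) ->
  P 0 -> (forall u v, P u -> P v -> P (u + v)) ->
  (forall u i, sup u i -> exists2 v, P v & sup (u - v) `<=` sup u `\ i) ->
  forall u, P u.
Proof.
move=> fin sup0 P0 PD step u; have [n] := ubnP (#|` fset_set (sup u)|).
elim: n u => // n IH u un.
have [[i ui]|u0] := pselect (sup u !=set0); last first.
  suff -> : u = 0 by [].
  by apply: sup0; rewrite -subset0 => i ui; apply: u0; exists i.
have [v Pv sub] := step u i ui; rewrite -(subrK v u); apply: PD => //.
apply: IH; rewrite ltnS in un; apply: leq_trans un.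
apply: fproper_ltn_card; rewrite fproperE; apply/andP; split.
  by apply/fsubsetP => j; rewrite !in_fset_set // => /set_mem/sub[uj _]; apply: mem_set.
apply/fsubsetPn; exists i; rewrite in_fset_set //; first exact: mem_set.
by apply/negP => /set_mem/sub[_]; apply.
Qed.

End FiniteSupport.

Section MatrixUnits.
Local Open Scope classical_set_scope.
Local Open Scope ring_scope.
Local Open Scope rng_scope.

Section DirectSumInj.
Variables (J : choiceType) (A : J -> rngType).

Definition dinj_fun j (a : A j) j' : A j' :=
  if j =P j' is ReflectT e then ecast i (A i) e a else 0.

Lemma dinj_funE j (a : A j) : dinj_fun a j = a.
Proof. by rewrite /dinj_fun; case: eqP => // e; rewrite eq_axiomK. Qed.
Lemma dinj_fun0 j (a : A j) j' : j <> j' -> dinj_fun a j' = 0.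
Proof. by rewrite /dinj_fun; case: eqP. Qed.

Lemma dinj_fin j (a : A j) : finite_set [set j' | dinj_fun a j' != 0].
Proof.
apply: (@sub_finite_set _ _ [set j]); last exact: finite_set1.
move=> j' /=; have [->//|/eqP jj'] := eqVneq j' j.
by rewrite dinj_fun0 ?eqxx // => /esym.
Qed.
Definition dinj j (a : A j) : direct_sum A := DirectSum (dinj_fin a).

Lemma dinjD j (a b : A j) : dinj (a + b) = dinj a + dinj b.
Proof.
apply: dsumP => i /=; have [<-|/eqP ij] := eqVneq j i.
  by rewrite !dinj_funE.
by rewrite !dinj_fun0 // addr0.
Qed.
Lemma dinj0 j : dinj (0 : A j) = 0.
Proof. by apply: (addrI (dinj (0 : A j))); rewrite -dinjD !addr0. Qed.
Lemma dinjM j (a b : A j) : dinj (a ** b) = dinj a ** dinj b.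
Proof.
apply: dsumP => i /=; have [<-|/eqP ij] := eqVneq j i.
  by rewrite !dinj_funE.
by rewrite !dinj_fun0 // rmul0l.
Qed.
Lemma dinj_mull j (a : A j) (d : direct_sum A) : dinj a ** d = dinj (a ** d j).
Proof.
apply: dsumP => i /=; have [<-|/eqP ij] := eqVneq j i.
  by rewrite !dinj_funE.
by rewrite !dinj_fun0 // rmul0l.
Qed.

Lemma direct_sum_ind (P : direct_sum A -> Prop) : P 0 ->
  (forall f g, P f -> P g -> P (f + g)) -> (forall j (a : A j), P (dinj a)) ->
  forall f, P f.
Proof.
move=> P0 PD Pi.
apply: (@finite_support_ind (direct_sum A) J (fun f : direct_sum A => [set j | f j != 0]) P) => //.
- by move=> f; apply: dsum_fin.
- move=> f f0; apply: dsumP => j; apply/eqP; apply: contrapT => /negP fj.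
  by have : [set j | f j != 0] j by []; rewrite f0.
- move=> f j fj; exists (dinj (f j)) => // i fi.
  have {}fi : f i - dinj_fun (f j) i != 0 by exact: fi.
  have [ji|/eqP ij] := eqVneq j i.
    by move: fi; rewrite -ji dinj_funE subrr eqxx.
  by move: fi; rewrite dinj_fun0 // subr0; split=> //= /esym.
Qed.

End DirectSumInj.

Section MatrixDelta.
Variables (X : choiceType) (R : nzRingType).

Definition mdelta_fun (i j : X) (r : R) (k l : X) : R :=
  if (k == i) && (l == j) then r else 0.
Lemma mdelta_fin i j r : mdelta_fun i j r \in @fin_entries X R.
Proof.
apply/fin_entriesP; exists [fset i; j]%fset => k l; rewrite /mdelta_fun.
have [->|//] := eqVneq k i; have [->|//] := eqVneq l j.
by rewrite fset21 fset22.
Qed.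
Definition mdelta i j r : fin_matrix X R := FinMatrix (mdelta_fin i j r).

Lemma mdeltaD i j r s : mdelta i j (r + s) = mdelta i j r + mdelta i j s.
Proof.
apply: val_inj; apply/funext => k; apply/funext => l.
rewrite [RHS](_ : _ = mdelta_fun i j r k l + mdelta_fun i j s k l) //= /mdelta_fun.
by case: ifP => // _; rewrite addr0.
Qed.

Lemma mdeltaM i j l r s : mdelta i j r ** mdelta j l s = mdelta i l (r * s).
Proof.
apply: val_inj; apply/funext => a; apply/funext => b /=.
rewrite (@fmx_mulE _ _ [fset j]%fset) => [|k]; last first.
  by rewrite in_fset1 /mdelta_fun => /negbTE ->; rewrite andbF mul0r.
rewrite big_seq_fset1 /mdelta_fun eqxx andbT /=.
by have [_|_] := eqVneq a i => /=; rewrite ?mul0r //; case: ifP; rewrite ?mulr0.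
Qed.

Lemma mdelta_corner i r s (A : fin_matrix X R) :
  mdelta i i r ** A ** mdelta i i s = mdelta i i (r * \val A i i * s).
Proof.
apply: val_inj; apply/funext => a; apply/funext => b /=.
rewrite (@fmx_mulE _ _ [fset i]%fset) => [|k]; last first.
  by rewrite in_fset1 /mdelta_fun => /negbTE ->; rewrite mulr0.
rewrite big_seq_fset1 (@fmx_mulE _ _ [fset i]%fset) => [|k]; last first.
  by rewrite in_fset1 /mdelta_fun => /negbTE ->; rewrite andbF mul0r.
rewrite big_seq_fset1 /mdelta_fun eqxx andbT /=.
by have [_|_] := eqVneq a i => /=; rewrite ?mul0r //; case: ifP; rewrite ?mulr0.
Qed.

Lemma mdelta_inj i r s : mdelta i i r = mdelta i i s -> r = s.
Proof.
move=> /(congr1 (fun A : fin_matrix X R => \val A i i)) /=.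
by rewrite /mdelta_fun eqxx.
Qed.

Lemma fin_matrix_ind (P : fin_matrix X R -> Prop) : P 0 ->
  (forall f g, P f -> P g -> P (f + g)) -> (forall i j r, P (mdelta i j r)) ->
  forall A, P A.
Proof.
move=> P0 PD Pi.
apply: (@finite_support_ind (fin_matrix X R) (X * X)%type
  (fun A : fin_matrix X R => [set p | \val A p.1 p.2 != 0]) P) => //.
- by move=> A; have := valP A; rewrite /in_mem /= => /asboolP.
- move=> A A0; apply: val_inj; apply/funext => i; apply/funext => j.
  apply/eqP; apply: contrapT => /negP Aij.
  by have : [set p : X * X | \val A p.1 p.2 != 0] (i, j) by []; rewrite A0.
- move=> A [i j] Aij; exists (mdelta i j (\val A i j)) => // -[k l] Akl.
  have {}Akl : \val A k l - mdelta_fun i j (\val A i j) k l != 0 by exact: Akl.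
  move: Akl; rewrite /mdelta_fun; case: ifP => [/andP[/eqP -> /eqP ->]|ne].
    by rewrite subrr eqxx.
  by rewrite subr0; split=> //= -[ki lj]; rewrite ki lj !eqxx in ne.
Qed.

End MatrixDelta.
End MatrixUnits.

(** * Left ideals of the coefficient rings and the simple modules of one layer *)

Section Blocks.
Local Open Scope classical_set_scope.
Local Open Scope ring_scope.
Local Open Scope rng_scope.

Definition proper_left_ideal (R : nzRingType) (A : set R) : Prop :=
  [/\ A 0, forall x y, A x -> A y -> A (x - y), forall r x, A x -> A (r * x) & ~ A 1].

Definition countable_left_ideals (R : nzRingType) : Prop :=
  exists code : set R -> nat -> Prop,
    (forall A, proper_left_ideal A -> exists n, code A n) /\
    (forall A B n, proper_left_ideal A -> proper_left_ideal B ->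
      code A n -> code B n -> A = B).

Lemma field_countable_left_ideals (K : fieldType) : countable_left_ideals K.
Proof.
exists (fun _ _ => True); split=> [A _|A B n]; first by exists 0%N.
have h (A' : set K) : @proper_left_ideal K A' -> A' = [set 0]; last by move=> /h -> /h ->.
move=> [A0 _ AM A1]; apply/seteqP; split=> [x Ax|_ -> //].
apply/eqP; apply: contrapT => /negP x0; apply: A1.
by rewrite -(mulVf x0); apply: AM.
Qed.

Section PolyIdeals.
Variable K : fieldType.

Lemma poly_ideal_gen (A : set {poly K}) : A 0 ->
  (forall p r, A p -> A r -> A (p - r)) -> (forall p r, A r -> A (p * r)) ->
  exists g, forall p, A p <-> g %| p.
Proof.
move=> A0 AB AM; have [[g0 [Ag0 g00]]|nz] := pselect (exists g, A g /\ g != 0); last first.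
  exists 0 => p; rewrite dvd0p; split=> [Ap|/eqP -> //].
  by apply: contrapT => /negP p0; apply: nz; exists p.
have ex : exists n, `[< exists g, [/\ A g, g != 0 & size g = n] >].
  by exists (size g0); apply/asboolP; exists g0.
case: (ex_minnP ex) => n /asboolP[g [Ag gn0 sg]] nmin; exists g => p; split; last first.
  by move=> /dvdpP[c ->]; apply: AM.
move=> Ap; rewrite /dvdp; apply: contrapT => /negP r0.
have : (n <= size (p %% g)%R)%N.
  apply: nmin; apply/asboolP; exists (p %% g); split=> //.
  have -> : p %% g = p - (p %/ g) * g by rewrite {2}(divp_eq p g) addrC addKr.
  by apply: AB => //; apply: AM.
by rewrite -sg leqNgt ltn_modp gn0.
Qed.

Lemma countable_poly : countable [set: K] -> countable [set: {poly K}].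
Proof.
move=> /countable_injP[f f_inj]; apply/countable_injP.
exists (fun p : {poly K} => choice.pickle (map f p)) => p r _ _.
move/(pcan_inj choice.pickleK)/inj_map => h; apply: poly_inj; apply: h.
by move=> x y; apply: f_inj; rewrite inE.
Qed.

(** A left ideal is determined by its polynomials, because every element becomes a polynomial after
    multiplication by a power of the unit x. These form a principal ideal of K[x], and the code is
    that of a generator. *)
Lemma laurent_countable_left_ideals : countable [set: K] ->
  countable_left_ideals (laurent K).
Proof.
move=> /countable_poly/countable_injP[f f_inj].
pose pl (A : set (laurent K)) p := exists2 a, A a & \val a = @FracField.tofrac {poly K} p.
exists (fun A n => exists2 g, n = f g & forall p, pl A p <-> g %| p); split.
  move=> A [A0 AB AM _]; have [|p r|p r|g gP] := @poly_ideal_gen (pl A).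
  - by exists 0 => //; rewrite tofrac0.
  - move=> [a Aa aE] [b Ab bE]; exists (a - b); first exact: AB.
    by rewrite tofracB -aE -bE.
  - move=> [b Ab bE].
    have h : @FracField.tofrac {poly K} p \in @laurent_pred K.
      by apply/asboolP; exists p, 0%N; rewrite expr0 divr1.
    exists (Laurent h * b); first exact: AM.
    by rewrite tofracM -bE.
  by exists (f g), g.
move=> A B n pA pB [g ng gA] [g' ng' gB].
have gg : g = g' by apply: f_inj; rewrite ?inE // -ng.
subst g'; clear ng ng'.
have h (A' B' : set (laurent K)) : @proper_left_ideal (laurent K) A' ->
    @proper_left_ideal (laurent K) B' ->
    (forall p, pl A' p <-> g %| p) -> (forall p, pl B' p <-> g %| p) -> A' `<=` B'; last first.
  by apply/seteqP; split; apply: h.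
move=> [_ _ A'M _] [_ _ B'M _] gA' gB' a Aa.
have /asboolP[p [m aE]] := valP a.
pose X := @FracField.tofrac {poly K} 'X.
have X0 : X ^+ m != 0 by rewrite expf_neq0 // tofrac_eq0 polyX_eq0.
have hX : X ^+ m \in @laurent_pred K.
  by apply/asboolP; exists 'X^m, 0%N; rewrite expr0 divr1 tofracXn.
have hXV : (X ^+ m)^-1 \in @laurent_pred K.
  by apply/asboolP; exists 1, m; rewrite tofrac1 mul1r.
have [b Bb bE] : pl B' p.
  apply/gB'/gA'; exists (Laurent hX * a); first exact: A'M.
  by rewrite [LHS](_ : _ = X ^+ m * \val a) // aE mulrC divfK.
suff -> : a = Laurent hXV * b by apply: B'M.
apply: val_inj; rewrite [RHS](_ : _ = (X ^+ m)^-1 * \val b) // bE aE.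
by rewrite mulrC.
Qed.

End PolyIdeals.

(** The isomorphism is replaced by a map [w] into the ring itself, additive and multiplicative only
    modulo [I]. On modules killed by [I] its values act as the elements of [M] would. *)
Lemma subquotient_lift (R : rngType) (I J : rngIdeal R) (M : rngType) :
  rng_iso (subquotient J I) M -> exists w : M -> R,
    [/\ forall d, w d \in J, forall d d', w (d + d') - (w d + w d') \in I,
        forall d d', w (d ** d') - w d ** w d' \in I,
        forall y, y \in J -> exists d, y - w d \in I &
        forall d, w d \in I -> d = 0].
Proof.
move=> /rng_iso_sym[h [[f hK fK] hD hM]].
pose r m : ideal_rng J := rng_quot_repr (h m).
have pir m : rng_quot_pi _ (r m) = h m by rewrite rng_quot_reprK.
have inI (x y : ideal_rng J) :
    rng_quot_pi (@ideal_trace R J I) x = rng_quot_pi _ y -> \val x - \val y \in I.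
  by move/rng_quot_piP; rewrite inE.
exists (fun m => \val (r m)); split.
- by move=> d; apply: valP.
- by move=> d d'; apply: (inI _ (r d + r d')); rewrite qD !pir.
- by move=> d d'; apply: (inI _ (r d ** r d')); rewrite qM !pir.
- move=> y yJ; exists (f (rng_quot_pi _ (IdealRng yJ))).
  by apply: (inI (IdealRng yJ)); rewrite pir fK.
- move=> d dI; apply: (can_inj hK).
  have h0 : h 0 = 0 by apply: (addrI (h 0)); rewrite -hD !addr0.
  by rewrite h0 -pir -(q0 (@ideal_trace R J I)); apply/rng_quot_piP; rewrite inE subr0.
Qed.

Section OneSubquotient.
Variables (L : rngType) (I J : rngIdeal L) (C : countType) (X : C -> choiceType)
  (A : C -> nzRingType).
Local Notation D := (direct_sum (fun j => fin_matrix (X j) (A j))).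
Hypotheses (iso : rng_iso (subquotient J I) D)
  (codes : forall j, X j -> countable_left_ideals (A j)).

Definition layer (S : rngModule L) : Prop :=
  [/\ simple_module S, forall a (x : S), a \in I -> act a x = 0 &
      exists2 a, a \in J & exists x : S, act a x <> 0].

Lemma layer_countably_many : countably_many layer.
Proof.
have [w [wJ wD wM wsurj _]] := subquotient_lift iso.
have aI (S : rngModule L) (x : S) a b : layer S -> a - b \in I -> act a x = act b x.
  by move=> [_ h _] /h => /(_ x) /eqP; rewrite actBl subr_eq0 => /eqP.
have awD (S : rngModule L) (x : S) d d' : layer S ->
    act (w (d + d')) x = act (w d) x + act (w d') x.
  by move=> lS; rewrite -actDl; apply: aI.
have awM (S : rngModule L) (x : S) d d' : layer S ->
    act (w (d ** d')) x = act (w d) (act (w d') x).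
  by move=> lS; rewrite -actM; apply: aI.
have aw0 (S : rngModule L) (x : S) : layer S -> act (w 0) x = 0.
  by move=> lS; apply: (addrI (act (w 0) x)); rewrite -awD // !addr0.
pose MA j := (fin_matrix (X j) (A j) : rngType).
pose din j (B : fin_matrix (X j) (A j)) : D := @dinj _ MA j B.
have din0 j : din j 0 = 0 by exact: (@dinj0 _ MA j).
have dinD j B B' : din j (B + B') = din j B + din j B' by exact: (@dinjD _ MA j).
have dinM j B B' : din j (B ** B') = din j B ** din j B' by exact: (@dinjM _ MA j).
have dinl j B (d : D) : din j B ** d = din j (B ** d j) by exact: (@dinj_mull _ MA j).
(* A module of the layer is seen by at least one block, so the blocks can be counted separately. *)
pose Q j S := layer S /\ exists B (x : S), act (w (din j B)) x <> 0.
apply: (@countably_many_bigcup _ _ C Q); first exact: countableP.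
- move=> j; have [[i0]|noX] := pselect (exists i : X j, True); last first.
    exists (fun _ _ => True); split=> [S|S T n [lS [B [x xB]]]]; first by exists 0%N.
    case: xB; elim/fin_matrix_ind: B => [|B B' B0 B'0|i]; last by case: noX; exists i.
      by rewrite din0; apply: aw0.
    by rewrite dinD awD // B0 B'0 addr0.
  move=> _; have [code [codeE codeI]] := codes i0.
  pose theta (r : A j) : D := din j (mdelta i0 i0 r).
  pose eps := theta 1.
  have thetaM r s : theta (r * s) = theta r ** theta s.
    by rewrite /theta -dinM mdeltaM.
  have thetaD r s : theta (r + s) = theta r + theta s.
    by rewrite /theta -dinD mdeltaD.
  have corner d : exists r, eps ** d ** eps = theta r.
    exists (\val (d j) i0 i0); rewrite /eps /theta dinl -dinM mdelta_corner.
    by rewrite mul1r mulr1.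
  have epsK r : theta r ** eps = theta r by rewrite /eps -thetaM mulr1.
  have Keps r : eps ** theta r = theta r by rewrite /eps -thetaM mul1r.
  pose ann (S : rngModule L) (s : S) : set (A j) := [set r | act (w (theta r)) s = 0].
  have annP (S : rngModule L) (s : S) : layer S -> s <> 0 -> act (w eps) s = s ->
      proper_left_ideal (ann S s).
    move=> lS s0 es; split; rewrite /ann /=.
    - have -> : theta 0 = 0 by apply: (addrI (theta 0)); rewrite -thetaD !addr0.
      exact: aw0.
    - move=> r t r0 t0; have : act (w (theta (r - t + t))) s = 0 by rewrite subrK.
      by rewrite thetaD awD // t0 addr0.
    - by move=> r t t0; rewrite thetaM awM // t0 act0r.
    - by rewrite -/eps es.
  apply: (@countably_many_rel _ _ nat (fun S n => exists s : S,
    [/\ s <> 0, act (w eps) s = s & code (ann S s) n])); first exact: countableP.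
    move=> S [lS [B [x Bx]]].
    (* If the diagonal unit [eps] acted as 0, so would every matrix unit of the block, since it
       factors through the index [i0]. *)
    suff [y ey] : exists y : S, act (w eps) y <> 0.
      have [n cn] : exists n, code (ann S (act (w eps) y)) n.
        by apply: codeE; apply: annP => //; rewrite -awM // epsK.
      by exists n, (act (w eps) y); split=> //; rewrite -awM // epsK.
    apply: contrapT => /forallNP noe; apply: Bx.
    elim/fin_matrix_ind: B x => [|B B' B0 B'0|i l r] x.
    - by rewrite din0; apply: aw0.
    - by rewrite dinD awD // B0 B'0 addr0.
    - rewrite -[r]mulr1 -(mdeltaM i i0 l) -[r]mulr1 -(mdeltaM i i0 i0)  !dinM !awM //.
      by rewrite -/(theta 1) -/eps (contrapT (noe _)) act0r.
  move=> S T n [lS _] [lT _] [s [s0 es cs]] [t [t0 et ct]].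
  have annE : ann S s = ann T t by apply: (codeI _ _ n) => //; apply: annP.
  have [simS _ _] := lS; have [simT _ _] := lT.
  (* If [a] killed [t1] but not [s1], some [b] would bring [act a s1] back to [s1]. Then eps b a eps
     is modulo [I] a corner element [theta r], which would annihilate [t1] while fixing [s1]. *)
  have half (S1 T1 : rngModule L) (s1 : S1) (t1 : T1) : layer S1 -> layer T1 ->
      s1 <> 0 -> act (w eps) s1 = s1 -> act (w eps) t1 = t1 ->
      ann S1 s1 = ann T1 t1 -> forall a, act a t1 = 0 -> act a s1 = 0.
    move=> lS1 lT1 s10 es1 et1 annE1 a at0; apply: contrapT => as0.
    have [simS1 _ _] := lS1; have [b bE] := simple_gen s1 simS1 as0.
    have yJ : w eps ** b ** a ** w eps \in J by apply: rng_idealMl.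
    have [d yd] := wsurj _ yJ; have [r rE] := corner d.
    have yE (S2 : rngModule L) (z : S2) : layer S2 -> act (w eps) z = z ->
        act (w (theta r)) z = act (w eps) (act b (act a z)).
      move=> lS2 ez; rewrite -rE !awM // ez -(aI _ _ _ _ lS2 yd) !actM ez.
      by rewrite -awM // epsK.
    have : ann T1 t1 r by rewrite /ann /= yE // at0 !act0r.
    by rewrite -annE1 /ann /= yE // bE es1.
  apply: (@module_iso_of_ann _ _ _ s t) => // a; split.
    by apply: (half T S t s).
  by apply: (half S T s t).
- move=> S lS; have [_ _ [a aJ [x ax]]] := lS.
  have [d ad] := wsurj a aJ; rewrite (aI _ _ _ _ lS ad) in ax.
  apply: contrapT => /forallNP noj; apply: ax.
  elim/direct_sum_ind: d x {ad} => [|f g f0 g0|j B] x; first exact: aw0.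
    by rewrite awD // f0 g0 addr0.
  apply: contrapT => Bx; apply: (noj j); split=> //; by exists B, x.
Qed.

End OneSubquotient.
End Blocks.

(** * Acyclic graphs *)

Section Cycles.
Variable E : graph.
Implicit Types (v w : vertex E) (r c : seq (edge E)).

Definition closed_path c v : Prop := [/\ c != [::], ispath c v & start c v = v].

Lemma ispath_rcons (e f : edge E) c :
  ispath (e :: c) (src f) = path (fun e f => rge e == src f) e (rcons c f).
Proof.
elim: c e => [|g c IH] e; first by rewrite /= andbT.
by rewrite [LHS]/= [RHS]/= -IH.
Qed.

Lemma cycle_closed_path c : graph_cycle c -> exists v, closed_path c v.
Proof.
move=> [c0 cc _]; case: c c0 cc => // e c _ cc; exists (src e); split=> //.
by rewrite ispath_rcons.
Qed.

Lemma nonuniq_src c : ~~ uniq (map (@src E) c) -> exists c1 e c2 f c3,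
  c = c1 ++ (e :: c2) ++ f :: c3 /\ src e = src f.
Proof.
elim: c => //= e c IH; rewrite negb_and negbK => /orP[/mapP[f fc ef]|/IH].
  have [c2 c3] := splitPr fc.
  by exists [::], e, c2, f, c3.
by move=> [c1 [g [c2 [f [c3 [-> gf]]]]]]; exists (e :: c1), g, c2, f, c3.
Qed.

Lemma nonuniq_closed_path r w : ispath r w -> ~~ uniq (map (@src E) r) ->
  exists c v, closed_path c v /\ (size c < size r)%N.
Proof.
move=> pr /nonuniq_src[c1 [e [c2 [f [c3 [rE ef]]]]]].
exists (e :: c2), (src f); split; last first.
  rewrite rE !size_cat /=; apply: leq_trans (leq_addl _ _).
  by rewrite addnS ltnS leq_addr.
by move: pr; rewrite rE !ispath_cat => /andP[_ /andP[]].
Qed.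

(** A repeated source cuts out a shorter closed path; descent on the length ends at a cycle. *)
Lemma closed_path_cycle c v : closed_path c v -> exists c', graph_cycle c'.
Proof.
have [n] := ubnP (size c); elim: n c v => // n IH c v cn cpc.
have [c0 pc sc] := cpc.
have [uc|nuc] := boolP (uniq (map (@src E) c)); last first.
  have [c' [v' [cpc' c'c]]] := nonuniq_closed_path pc nuc.
  by apply: (IH c' v') => //; apply: leq_trans c'c _.
exists c; split=> //; case: c c0 pc sc {cn cpc uc} => // e c _ pc /= sc.
by rewrite -ispath_rcons sc.
Qed.

End Cycles.

(** * Strong pi-regularity for acyclic graphs *)

Section PiRegular.
Local Open Scope ring_scope.
Local Open Scope rng_scope.
Variables (K : fieldType) (E : graph).
Local Notation L := (leavitt K E).
Local Notation mon := (@mon K E).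

(** Without a unit there is no power 0, so [npow a n] is the power n + 1 of [a]. *)
Definition npow (R : rngType) (a : R) n : R := iter n (rmul a) a.

Lemma npowD (R : rngType) (a : R) m n : npow a m ** npow a n = npow a (m + n).+1.
Proof. by elim: m => [|m IH] //; rewrite [npow a m.+1]/= -rmulA IH. Qed.

Definition in_span (B : seq L) (x : L) : Prop :=
  exists c : nat -> K, x = \sum_(i < size B) c i *: nth 0 B i.

Lemma in_span0 B : in_span B 0.
Proof. by exists (fun=> 0); rewrite big1 // => i _; rewrite scale0r. Qed.
Lemma in_spanD B x y : in_span B x -> in_span B y -> in_span B (x + y).
Proof.
move=> [c ->] [d ->]; exists (fun i => c i + d i).
by rewrite -big_split; apply: eq_bigr => i _; rewrite scalerDl.
Qed.
Lemma in_spanZ B k x : in_span B x -> in_span B (k *: x).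
Proof.
move=> [c ->]; exists (fun i => k * c i).
by rewrite scaler_sumr; apply: eq_bigr => i _; rewrite scalerA.
Qed.
Lemma in_span_mem B x : x \in B -> in_span B x.
Proof.
move=> /(nthP 0)[i iB <-]; exists (fun j => (j == i)%:R).
rewrite (bigD1 (Ordinal iB)) //= eqxx scale1r big1 ?addr0 // => j ji.
rewrite (_ : (nat_of_ord j == i) = false) ?scale0r //.
by apply: contra_neqF ji => /eqP ?; apply: val_inj.
Qed.
Lemma in_span_ind B (P : L -> Prop) : P 0 -> (forall x y, P x -> P y -> P (x + y)) ->
  (forall k x, x \in B -> P (k *: x)) -> forall x, in_span B x -> P x.
Proof.
move=> P0 PD PZ _ [c ->]; apply: big_ind => // i _.
by apply: PZ; apply: mem_nth.
Qed.

Lemma span_dependent B (y : nat -> L) : (forall n, in_span B (y n)) ->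
  exists (N : nat) (al : nat -> K), (exists2 n, (n < N)%N & al n != 0) /\
    \sum_(n < N) al n *: y n = 0.
Proof.
move=> /choice[c yE]; pose N := (size B).+1.
pose A : 'M[K]_(N, size B) := \matrix_(n < N, i < size B) c n i.
have [a aA a0] := wide_kernel A (ltnSn _).
pose al n := if insub n is Some n' then a 0 (n' : 'I_N) else 0.
have alE (n : 'I_N) : al n = a 0 n by rewrite /al valK.
exists N, al; split.
  apply: contrapT => nal; move/eqP: a0; apply; apply/rowP => m; rewrite mxE.
  by apply/eqP; apply: contrapT => am; apply: nal; exists m => //; rewrite alE; apply/negP.
under eq_bigr => n _ do rewrite yE scaler_sumr.
rewrite exchange_big big1 // => i _.
under eq_bigr => n _ do rewrite scalerA.
rewrite -scaler_suml [X in X *: _](_ : _ = 0) ?scale0r //.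
have := congr1 (fun B : 'rV[K]_(size B) => B 0 i) aA; rewrite !mxE => h.
by rewrite -[RHS]h; apply: eq_bigr => n _; rewrite mxE alE.
Qed.

Lemma lowest_term (U : zmodType) (F : nat -> U) m N : (m < N)%N ->
  (forall n, (n < m)%N -> F n = 0) -> \sum_(n < N) F n = 0 ->
  F m = - \sum_(i < N - m.+1) F (m.+1 + i)%N.
Proof.
move=> mN F0; have -> : N = (m + (N - m.+1).+1)%N by rewrite addnS -addSn subnKC.
rewrite big_split_ord /= big1 ?add0r => [|i _]; last exact: F0.
rewrite big_ord_recl /= addn0 => /eqP; rewrite addr_eq0 => /eqP ->.
rewrite addnS -addSn addKn; congr (- _); apply: eq_bigr => i _.
by rewrite /bump /= add1n addnS addSn.
Qed.

(* A relation with lowest term a^(m+1) gives a^(m+1) = a^(m+1) t with t a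
   combination of positive powers of a, and then a^(m+1) = a^(m+1) t t. *)
Lemma span_pi_regular B a : (forall n, in_span B (npow a n)) ->
  exists n y, npow a n = npow a n.+1 ** y.
Proof.
move=> /span_dependent[N [al [exn sum0]]].
have exm : exists m, (m < N)%N && (al m != 0) by have [n nN an] := exn; exists n; rewrite nN.
case: (ex_minnP exm) => m /andP[mN am] mmin; exists m.
pose be (i : 'I_(N - m.+1)) : K := - (al m)^-1 * al (m.+1 + i)%N.
have bE : npow a m = \sum_(i < N - m.+1) be i *: npow a (m.+1 + i).
  have low n : (n < m)%N -> al n *: npow a n = 0.
    move=> nm; have [->|an] := eqVneq (al n) 0; first by rewrite scale0r.
    have nN : (n < N)%N by apply: ltn_trans mN.
    by have := mmin n; rewrite an nN => /(_ isT); rewrite leqNgt nm.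
  have := lowest_term mN low sum0 => /(congr1 (fun x => (al m)^-1 *: x)).
  rewrite scalerA mulVf // scale1r => ->.
  rewrite -sumrN scaler_sumr; apply: eq_bigr => i _.
  by rewrite /be scalerN scalerA mulNr scaleNr.
pose t := \sum_(i < N - m.+1) be i *: npow a i.
(* [t2] is made to satisfy [t ** t = a ** t2]: a term of the left factor [t] with [i] positive gives
   up one factor [a], and in the term with [i = 0] the power is [a] itself. *)
pose t2 := \sum_(i < N - m.+1) be i *: (if i == 0%N :> nat then t else npow a i.-1 ** t).
have bt : npow a m = npow a m ** t.
  rewrite rmul_sumr {1}bE; apply: eq_bigr => i _.
  by rewrite lscaleAr npowD addSn.
have tt : t ** t = a ** t2.
  rewrite {1}/t rmul_suml rmul_sumr; apply: eq_bigr => i _.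
  rewrite lscaleAl lscaleAr; case: eqP => [->|/eqP i0] //.
  by rewrite rmulA -{1}(prednK (_ : 0 < i)%N) // lt0n.
exists t2; rewrite {1}bt {1}bt -rmulA tt rmulA.
by congr (_ ** _); have := npowD a m 0; rewrite addn0.
Qed.

Hypothesis acyclic : forall c : seq (edge E), ~ graph_cycle c.

Fixpoint words (F : seq (edge E)) n : seq (seq (edge E)) :=
  if n is n'.+1 then [::] :: [seq e :: r | e <- F, r <- words F n'] else [:: [::]].

Lemma mem_words F n r : {subset r <= F} -> (size r <= n)%N -> r \in words F n.
Proof.
elim: n r => [|n IH] [|e r] //= rF rn.
rewrite inE /=; apply/allpairsP; exists (e, r); split=> //=.
  by apply: rF; rewrite mem_head.
by apply: IH => // f fr; apply: rF; rewrite inE fr orbT.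
Qed.

(** Without cycles a path never leaves the same vertex twice, so its edges are distinct and their
    number is at most the length of [F]. *)
Lemma acyclic_mem_words F r w : ispath r w -> {subset r <= F} ->
  r \in words F (size F).
Proof.
move=> pr rF; apply: mem_words => //; apply: uniq_leq_size => //.
apply: (@map_uniq _ _ (@src E)); apply: contrapT => /negP nu.
have [c [v [cp _]]] := nonuniq_closed_path pr nu.
by have [c' /acyclic] := closed_path_cycle cp.
Qed.

Definition mons (F : seq (edge E)) (W : seq (vertex E)) : seq L :=
  [seq mon r ws.1 ws.2 | r <- words F (size F),
     ws <- [seq (w, s) | w <- W, s <- words F (size F)]].

Lemma in_span_mon F W r w s : {subset r <= F} -> {subset s <= F} -> w \in W ->
  in_span (mons F W) (mon r w s).
Proof.
move=> rF sF wW; rewrite /mon.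
have [pr|/(ispath_pth0 K) ->] := boolP (ispath r w); last by rewrite rmul0l; exact: in_span0.
have [ps|/(ispath_gth0 K) ->] := boolP (ispath s w); last by rewrite rmul0r; exact: in_span0.
apply: in_span_mem; apply/allpairsP; exists (r, (w, s)); split=> //=.
  exact: acyclic_mem_words pr rF.
by apply/allpairsP; exists (w, s); split=> //; apply: acyclic_mem_words ps sF.
Qed.

Lemma words_sub F n r : r \in words F n -> {subset r <= F}.
Proof.
elim: n r => [|n IH] r /=; first by rewrite inE => /eqP ->.
rewrite inE => /orP[/eqP -> //|/allpairsP[[e s] [/= eF /IH sF ->]]] f.
by rewrite inE => /orP[/eqP -> //|/sF].
Qed.

(** No new edge or vertex arises in a product of monomials, and the bound on path lengths depends on
    [F] alone; the span is thus a finite-dimensional subalgebra. *)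
Lemma mons_mul F W x y : in_span (mons F W) x -> in_span (mons F W) y ->
  in_span (mons F W) (x ** y).
Proof.
move=> sx sy; move: x sx.
apply: (in_span_ind (P := fun x => in_span (mons F W) (x ** y))) =>
  [|x1 x2 h1 h2|k z /allpairsP[[r ws] [/= /words_sub rF]]].
- by rewrite rmul0l; exact: in_span0.
- by rewrite rmulDl; exact: in_spanD.
move=> /allpairsP[[w s] [/= wW /words_sub sF ->]] ->.
rewrite lscaleAl; apply: in_spanZ => /=.
move: y sy.
apply: (in_span_ind (P := fun y => in_span (mons F W) (mon r w s ** y))) =>
  [|x1 x2 h1 h2|l z' /allpairsP[[r' ws'] [/= /words_sub rF']]].
- by rewrite rmul0r; exact: in_span0.
- by rewrite rmulDr; exact: in_spanD.
move=> /allpairsP[[w' s'] [/= wW' /words_sub sF' ->]] ->.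
rewrite lscaleAr; apply: in_spanZ => /=; rewrite /mon -rmulA (rmulA (gth K s w)).
have [->|[t [rE _ wE ->]]|[t [sE _ wE ->]]] := gth_pth_cases K s r' w w'.
- by rewrite rmul0l rmul0r; exact: in_span0.
- rewrite rmulA pth_mul wE eqxx; apply: in_span_mon => // f.
  rewrite mem_cat => /orP[/rF //|ft]; apply: rF'.
  by rewrite rE mem_cat ft orbT.
- rewrite gth_mul wE eqxx; apply: in_span_mon => // f.
  rewrite mem_cat => /orP[/sF' //|ft]; apply: sF.
  by rewrite sE mem_cat ft orbT.
Qed.

Lemma mons_all x : exists (F : seq (edge E)) (W : seq (vertex E)),
  forall (F' : seq (edge E)) (W' : seq (vertex E)),
  {subset F <= F'} -> {subset W <= W'} ->
  in_span (mons F' W') x.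
Proof.
elim/leavitt_ind: x => [|x y [F [W h]] [F1 [W1 h1]]|k r w s].
- by exists [::], [::] => F W _ _; exact: in_span0.
- exists (F ++ F1), (W ++ W1) => F' W' FF WW; apply: in_spanD.
    by apply: h => u uF; [apply: FF | apply: WW]; rewrite mem_cat uF.
  by apply: h1 => u uF; [apply: FF | apply: WW]; rewrite mem_cat uF orbT.
- exists (r ++ s), [:: w] => F W FF WW; apply: in_spanZ; apply: in_span_mon.
  + by move=> u ur; apply: FF; rewrite mem_cat ur.
  + by move=> u ur; apply: FF; rewrite mem_cat ur orbT.
  + by apply: WW; rewrite mem_head.
Qed.

Lemma acyclic_pi_regular (a : L) : exists n y, npow a n = npow a n.+1 ** y.
Proof.
have [F [W h]] := mons_all a; apply: (@span_pi_regular (mons F W)) => n.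
by elim: n => [|n IH]; [|apply: mons_mul => //]; apply: h.
Qed.

End PiRegular.

Section NoLaurent.
Local Open Scope ring_scope.
Local Open Scope rng_scope.
Variables (L : rngType) (I J : rngIdeal L) (C : countType) (X : C -> choiceType)
  (A : C -> nzRingType).
Local Notation D := (direct_sum (fun j => fin_matrix (X j) (A j))).
Hypotheses (iso : rng_iso (subquotient J I) D)
  (pi_reg : forall a : L, exists n y, npow a n = npow a n.+1 ** y).

Lemma block_pi_regular j (i : X j) (r : A j) :
  exists n s, r ^+ n.+1 = r ^+ n.+2 * s.
Proof.
have [w [wJ wD wM wsurj winj]] := subquotient_lift iso.
pose MA j := (fin_matrix (X j) (A j) : rngType).
pose th (s : A j) : D := @dinj _ MA j (mdelta i i s).
have thM s t : th (s * t) = th s ** th t.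
  by rewrite /th -(mdeltaM i i i); exact: (@dinjM _ MA j).
have thinj s t : th s = th t -> s = t.
  move=> /(congr1 (fun d : D => d j)) /=.
  by rewrite !(@dinj_funE _ MA) => /mdelta_inj.
pose q := rng_quot_pi I.
have qmul x y : q (x ** y) = q x ** q y by exact: qM.
have qwM d d' : q (w (d ** d')) = q (w d) ** q (w d').
  by rewrite -qmul; apply/rng_quot_piP.
have qwinj d d' : q (w d) = q (w d') -> d = d'.
  move=> h; apply/eqP; rewrite -subr_eq0; apply/eqP; apply: winj; apply/q_eq0.
  have wDq x y : q (w (x + y)) = q (w x) + q (w y) by rewrite -qD; apply/rng_quot_piP.
  apply: (addIr (q (w d'))); rewrite -wDq subrK add0r; exact: h.
have pw n : q (npow (w (th r)) n) = q (w (th (r ^+ n.+1))).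
  elim: n => [|n IH]; first by rewrite expr1.
  by rewrite [npow _ _]/= qmul IH -qwM -thM -exprS.
have [n [y yE]] := pi_reg (w (th r)); exists n.
(* The factor [y] given by pi-regularity is an arbitrary element of [L]; multiplication by the
   lifted unit [th 1] brings it into [J], hence modulo [I] into the blocks. *)
have yJ : y ** w (th 1) \in J by apply: rng_idealMl.
have [d /rng_quot_piP dE] := wsurj _ yJ; rewrite -!/(q _) in dE.
exists (\val (d j) i i); apply: thinj.
have h : th (r ^+ n.+1) = th (r ^+ n.+2) ** d.
  apply: qwinj; rewrite qwM -!pw -dE qmul rmulA -qmul -yE pw -qwM.
  by rewrite -thM mulr1.
have d1 : th 1 ** d ** th 1 = th (\val (d j) i i).
  rewrite /th (@dinj_mull _ MA j) -(@dinjM _ MA j); congr (dinj _).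
  by rewrite [LHS]mdelta_corner mul1r mulr1.
rewrite -[in LHS](mulr1 (r ^+ n.+1)) thM h -[r ^+ n.+2 in LHS]mulr1.
by rewrite thM -!rmulA (rmulA _ d) d1 -thM.
Qed.

End NoLaurent.

Section NoLaurentField.
Local Open Scope ring_scope.
Variable K : fieldType.

(** For r = x + 1, cancellation would make r invertible with an inverse p / x^m; then (x + 1) p =
    x^m, which fails at x = -1. *)
Lemma laurent_not_pi_regular :
  ~ forall r : laurent K, exists n s, r ^+ n.+1 = r ^+ n.+2 * s.
Proof.
have h1 : @FracField.tofrac {poly K} ('X + 1) \in @laurent_pred K.
  by apply/asboolP; exists ('X + 1), 0%N; rewrite expr0 divr1.
pose r := Laurent h1; move=> /(_ r)[n [s rs]].
have r0 : \val r != 0 by rewrite tofrac_eq0 -size_poly_eq0 -polyC1 size_XaddC.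
have valM (x y : laurent K) : \val (x * y) = \val x * \val y by [].
have valX (x : laurent K) m : \val (x ^+ m) = \val x ^+ m.
  by elim: m => [//|m IH]; rewrite !exprS valM IH.
have /asboolP[p [m sE]] := valP s.
have : \val r * \val s = 1.
  apply: (mulfI (expf_neq0 n.+1 r0)); rewrite mulr1 mulrA -exprSr.
  by rewrite -!valX -valM -rs.
have X0 := tofracX_neq0 K m.
have rE : \val r = @FracField.tofrac {poly K} ('X + 1) by [].
rewrite rE sE mulrA -tofracM => /(canRL (divfK X0)); rewrite mul1r -tofracXn => /eqP.
rewrite tofrac_eq => /eqP /(congr1 (horner^~ (-1))).
rewrite hornerM hornerD hornerX hornerC addNr mul0r hornerXn => /esym/eqP.
by rewrite expf_eq0 oppr_eq0 oner_eq0 andbF.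
Qed.

End NoLaurentField.

(* L acts on the functions on infinite paths; hence the vertices from which
   some infinite path starts are nonzero in L. *)
Section InfinitePathAction.
Local Open Scope classical_set_scope.
Local Open Scope ring_scope.
Local Open Scope rng_scope.
Variables (K : fieldType) (E : graph).
Implicit Types (p : nat -> edge E) (phi psi : (nat -> edge E) -> K).

Let ip p : bool := `[< inf_path p >].
Definition ptail p : nat -> edge E := fun n => p n.+1.
Definition pcons (e : edge E) p : nat -> edge E := fun n => if n is m.+1 then p m else e.

Let ipP p n : ip p -> rge (p n) = src (p n.+1).
Proof. by move/asboolP. Qed.
Let ip_tail p : ip p -> ip (ptail p).
Proof. by move=> /asboolP h; apply/asboolP => n; apply: h. Qed.
Let ip_cons e p : ip (pcons e p) = ip p && (rge e == src (p 0%N)).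
Proof.
apply/asboolP/andP => [h|[/asboolP h /eqP re] [|n] //=].
  by split; [apply/asboolP => n; apply: (h n.+1) | rewrite (h 0%N)].
Qed.
Let pconsK p : pcons (p 0%N) (ptail p) = p.
Proof. by apply/funext; case. Qed.

(** Functions are defined on all sequences of edges; the test [ip p] makes every generator give 0 at
    a sequence that is not a path. *)
Fixpoint pact (a : term K E) phi : (nat -> edge E) -> K :=
  match a with
  | Tvertex v => fun p => if ip p && (src (p 0%N) == v) then phi p else 0
  | Tedge e => fun p => if ip p && (p 0%N == e) then phi (ptail p) else 0
  | Tghost e => fun p => if ip p && (rge e == src (p 0%N)) then phi (pcons e p) else 0
  | Tzero => fun p => 0
  | Topp a => fun p => - pact a phi p
  | Tadd a b => fun p => pact a phi p + pact b phi p
  | Tscale k a => fun p => k * pact a phi p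
  | Tmul a b => pact a (pact b phi)
  end.

Let eq_pact a phi psi : phi =1 psi -> pact a phi =1 pact a psi.
Proof. by move=> /funext ->. Qed.

Let pactD a phi psi p : pact a (fun r => phi r + psi r) p = pact a phi p + pact a psi p.
Proof.
elim: a phi psi p => [v|e|e||a IH|a IHa b IHb|k a IH|a IHa b IHb] phi psi p /=.
- by case: ifP; rewrite ?addr0.
- by case: ifP; rewrite ?addr0.
- by case: ifP; rewrite ?addr0.
- by rewrite addr0.
- by rewrite IH opprD.
- by rewrite IHa IHb addrACA.
- by rewrite IH mulrDr.
- by rewrite -IHa; apply: eq_pact => m; apply: IHb.
Qed.

Let pactZ a (k : K) phi p : pact a (fun r => k * phi r) p = k * pact a phi p.
Proof.
elim: a phi p => [v|e|e||a IH|a IHa b IHb|l a IH|a IHa b IHb] phi p /=.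
- by case: ifP; rewrite ?mulr0.
- by case: ifP; rewrite ?mulr0.
- by case: ifP; rewrite ?mulr0.
- by rewrite mulr0.
- by rewrite IH mulrN.
- by rewrite IHa IHb mulrDr.
- by rewrite IH mulrCA.
- by rewrite -IHa; apply: eq_pact => m; apply: IHb.
Qed.

Let pact_rel a b : leavitt_rel a b -> forall phi, pact a phi =1 pact b phi.
Proof.
elim=> {a b}.
- by [].
- by move=> a b _ IH g n; rewrite IH.
- by move=> b a c _ IH1 _ IH2 g n; rewrite IH1 IH2.
- by move=> a b _ IH g n /=; rewrite IH.
- by move=> a b c d _ IH1 _ IH2 g n /=; rewrite IH1 IH2.
- by move=> k a b _ IH g n /=; rewrite IH.
- by move=> a b c d _ IH1 _ IH2 g n /=; rewrite IH1; apply: eq_pact => m; apply: IH2.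
- by move=> a b c g n /=; rewrite addrA.
- by move=> a b g n /=; rewrite addrC.
- by move=> a g n /=; rewrite add0r.
- by move=> a g n /=; rewrite addNr.
- by move=> k l a g n /=; rewrite mulrA.
- by move=> a g n /=; rewrite mul1r.
- by move=> k a b g n /=; rewrite mulrDr.
- by move=> k l a g n /=; rewrite mulrDl.
- by [].
- by [].
- by move=> a b c g n /=; rewrite pactD.
- by [].
- by move=> k a b g n /=; rewrite pactZ.
- by move=> v g n /=; case: (ip n && _).
- by move=> v w /eqP vw g n /=; case: ifP => // /andP[-> /eqP ->]; rewrite (negbTE vw).
- by move=> e g n /=; case: ifP => // h; case: ifP => // /andP[ipn /eqP ne];
    rewrite ipn ne eqxx in h.
- move=> e g n /=; case: ifP => // /andP[ipn /eqP ne].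
  by rewrite ip_tail //= -ne (ipP 0 ipn) /ptail eqxx.
- by move=> e g n /=; case: ifP => // h; case: ifP => // /andP[ipn /eqP ne];
    rewrite ipn ne eqxx in h.
- by move=> e g n /=; case: ifP => // /andP[ipn /eqP ne]; rewrite ip_cons ipn ne !eqxx.
- move=> e g n /=; rewrite (eq_sym (rge e)); case: ifP => // /andP[ipn /eqP ne].
  by rewrite ip_cons ipn ne !eqxx.
- move=> e f /eqP ef g n /=; case: ifP => // /andP[ipn /eqP ne].
  by rewrite (negbTE ef) andbF.
- move=> v [_ fin] g n /=.
  have mem e : (e \in fset_set (out_edges v)) = (src e == v).
    by rewrite in_fset_set //; apply/idP/eqP => [/set_mem|/mem_set].
  have sumE (s : seq (edge E)) : uniq s ->
      pact (\big[@Tadd K E/Tzero K E]_(e <- s) Tmul (Tedge K e) (Tghost K e)) g n =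
      if ip n && (n 0%N \in s) then g n else 0.
    elim: s => [|e s IH] /=; first by rewrite big_nil andbF.
    move=> /andP[es us]; rewrite big_cons /= IH // inE.
    have [ipn|] /= := boolP (ip n); last by rewrite addr0.
    have [ne|ne] /= := eqVneq (n 0%N) e; last by rewrite add0r.
    rewrite ne (negbTE es) addr0 ip_tail //= -ne (ipP 0 ipn) /ptail eqxx.
    by rewrite -/(ptail n) pconsK.
  by rewrite sumE ?fset_uniq // mem.
Qed.

Lemma vertex_neq0 p : inf_path p -> lvertex K (src (p 0%N)) <> 0.
Proof.
move=> hp /lpiP /pact_rel /(_ (fun=> 1) p) /=.
have -> : ip p by apply/asboolP.
by rewrite eqxx /= => /eqP; rewrite oner_eq0.
Qed.

(** Going round [c] forever is an infinite path from [v]. *)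
Lemma closed_path_neq0 (c : seq (edge E)) v : closed_path c v -> lvertex K v <> 0.
Proof.
move=> [c0 pc sc]; case: c c0 pc sc => // e0 c _ pc sc.
pose n := size (e0 :: c); pose p m := nth e0 (e0 :: c) (m %% n).
have step (l : seq (edge E)) w i : ispath l w -> (i < size l)%N ->
    rge (nth e0 l i) = if (i.+1 < size l)%N then src (nth e0 l i.+1) else w.
  elim: l i => // e l IH [|i] /= /andP[/eqP re pl] il.
    by case: l re {IH pl il}.
  by rewrite IH // ltnS.
have hp : inf_path p.
  move=> m; have mn : (m %% n < size (e0 :: c))%N by rewrite ltn_pmod.
  have mS : (m.+1 %% n = (m %% n).+1 %% n)%N.
    by rewrite -[m.+1]addn1 -[(m %% n).+1]addn1 modnDml.
  rewrite /p mS (step _ _ _ pc mn); case: ltnP => h; first by rewrite (modn_small (h : _ < n)%N).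
  have -> : (m %% n).+1 = n by apply/eqP; rewrite eqn_leq h andbT.
  by rewrite modnn /= -sc.
have := vertex_neq0 hp; rewrite /p mod0n /=.
by move: sc => /= ->.
Qed.

End InfinitePathAction.

(** * The chain of ideals *)

Section SetIdeals.
Local Open Scope classical_set_scope.
Local Open Scope ring_scope.
Local Open Scope rng_scope.
Variable R : rngType.

Record ideal_set := IdealSet {
  iset : set R;
  iset0 : iset 0;
  isetB : forall x y, iset x -> iset y -> iset (x - y);
  isetMl : forall r x, iset x -> iset (r ** x);
  isetMr : forall r x, iset x -> iset (x ** r)
}.

Definition iset_pred (A : ideal_set) : {pred R} := fun x => `[< iset A x >].

Section OneSet.
Variable A : ideal_set.
Lemma iset_zmod_closed : zmod_closed (iset_pred A).
Proof.
split=> [|x y /asboolP Ax /asboolP Ay]; apply/asboolP; first exact: iset0.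
exact: isetB.
Qed.
HB.instance Definition _ := GRing.isZmodClosed.Build R (iset_pred A) iset_zmod_closed.
Lemma iset_predMl r x : x \in iset_pred A -> r ** x \in iset_pred A.
Proof. by move=> /asboolP Ax; apply/asboolP; apply: isetMl. Qed.
Lemma iset_predMr r x : x \in iset_pred A -> x ** r \in iset_pred A.
Proof. by move=> /asboolP Ax; apply/asboolP; apply: isetMr. Qed.
HB.instance Definition _ := isRngIdeal.Build R (iset_pred A) iset_predMl iset_predMr.
End OneSet.

Lemma ideal_of_set (A : set R) : A 0 -> (forall x y, A x -> A y -> A (x - y)) ->
  (forall r x, A x -> A (r ** x)) -> (forall r x, A x -> A (x ** r)) ->
  exists I : rngIdeal R, forall x, x \in I <-> A x.
Proof.
move=> A0 AB Al Ar; exists (iset_pred (IdealSet A0 AB Al Ar) : rngIdeal R) => x.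
by split=> [/asboolP|Ax]; [|apply/asboolP].
Qed.

(** The ideals of the chain are recovered from sets, so their agreement with the ideals [add_ideal]
    is known only elementwise. *)
Lemma subquotient_eq (I J J' : rngIdeal R) : (forall x, x \in I -> x \in J) ->
  (forall x, x \in J <-> x \in J') -> rng_iso (subquotient J I) (subquotient J' I).
Proof.
move=> IJ JJ'.
pose h (m : subquotient J' I) : rng_quot I := rng_quot_pi I (\val (rng_quot_repr m)).
have hE z : h (rng_quot_pi _ z) = rng_quot_pi I (\val z).
  apply/rng_quot_piP.
  have : rng_quot_pi (@ideal_trace R J' I) (rng_quot_repr (rng_quot_pi (@ideal_trace R J' I) z)) =
      rng_quot_pi (@ideal_trace R J' I) z by rewrite rng_quot_reprK.
  by move/rng_quot_piP; rewrite inE.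
apply: (subquotient_iso (h := h)).
- move=> m n; have [x ->] := q_surj m; have [y ->] := q_surj n.
  by rewrite -qD !hE -qD.
- move=> m n; have [x ->] := q_surj m; have [y ->] := q_surj n.
  by rewrite -qM !hE -qM.
- move=> m; have [x ->] := q_surj m; rewrite hE => /q_eq0 xI.
  by apply/q_eq0; rewrite inE.
- move=> y; split=> [/JJ' yJ|[m]].
    by exists (rng_quot_pi _ (IdealRng yJ)); rewrite hE.
  have [x ->] := q_surj m; rewrite hE => /rng_quot_piP yx.
  rewrite -(subrK (\val x) y); apply: rpredD; first exact: IJ.
  by apply/JJ'; apply: valP.
Qed.

End SetIdeals.

(** * From CIRT to the chain and to the countability of K *)

Section Forward.
Local Open Scope classical_set_scope.
Local Open Scope ring_scope.
Local Open Scope rng_scope.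
Variables (K : fieldType) (E : graph).
Local Notation L := (leavitt K E).
Local Notation V := (@lvertex K E).

Lemma add_ideal_graded (I : rngIdeal L) (e : L) : graded_ideal I ->
  homogeneous 0 e -> graded_ideal (add_ideal I e).
Proof.
move=> gI he x /asboolP[s xs].
pose P (y : L) := exists t : seq L, (forall z, z \in t -> z \in add_ideal I e /\
  exists n, homogeneous n z) /\ y = \sum_(z <- t) z.
have P0 : P 0 by exists [::]; rewrite big_nil.
have PD y z : P y -> P z -> P (y + z).
  move=> [t [ht ->]] [t' [ht' ->]]; exists (t ++ t'); rewrite big_cat; split=> // u.
  by rewrite mem_cat => /orP[/ht|/ht'].
rewrite -/(P x) -(subrK (\sum_(p <- s) p.1 ** e ** p.2) x); apply: (PD).
  have [t [tI ->]] := gI _ xs; exists t; split=> // z /tI[zI hz]; split=> //.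
  exact: add_ideal_sub.
apply: (big_ind P P0 PD) => -[u v] _ /=.
elim/leavitt_ind: u => [|u u' Pu Pu'|k r w t].
- by rewrite !rmul0l.
- by rewrite !rmulDl; apply: PD.
elim/leavitt_ind: v => [|v v' Pv Pv'|k' r' w' t'].
- by rewrite rmul0r.
- by rewrite rmulDr; apply: PD.
exists [:: (k *: mon K r w t) ** e ** (k' *: mon K r' w' t')]; rewrite big_seq1.
split=> // z; rewrite inE => /eqP ->; split; first exact: add_ideal_gen.
eexists; apply: hom_mul; last by apply: hom_scale; apply: hom_mon.
by apply: hom_mul he; apply: hom_scale; apply: hom_mon.
Qed.

Lemma vertices_generate (I : rngIdeal L) : (forall v, V v \in I) -> forall x, x \in I.
Proof.
move=> VI; elim/leavitt_ind => [|x y xI yI|k r w s]; first exact: rpred0.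
  exact: rpredD.
by apply: ideal_scale; rewrite /mon -(pthV K r w) -rmulA; apply: rng_idealMl; apply: rng_idealMr.
Qed.

Hypothesis cirt : CIRT L.

Lemma good_corner_ex (I : rngIdeal L) : graded_ideal I -> ~ (forall x, x \in I) ->
  exists e, good_corner I e.
Proof.
move=> gI nI; have [//|bif] := step_or_bifurcation gI.
exfalso; apply: nI; apply: vertices_generate => v; apply/negP => /negP vI.
apply: (bifurcation_not_CIRT (v0 := v) _ bif) cirt => /lq_eq0 h.
by rewrite h in vI.
Qed.

Lemma good_corner_mem (I : rngIdeal L) e : good_corner I e ->
  e \in add_ideal I e /\ e \notin I.
Proof.
move=> [_ ee e0 _ _]; split; last by apply/negP => /lq_eq0.
have h : e - e ** e ** e \in add_ideal I e.
  by apply: add_ideal_sub; apply/lq_eq0; rewrite lqB !lqM !ee subrr.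
by have := rpredD h (add_ideal_gen I e e e); rewrite subrK.
Qed.

Definition graded_set (A : set L) : Prop :=
  exists I : rngIdeal L, graded_ideal I /\ forall x, x \in I <-> A x.

Lemma to_ideal_ex (A : set L) : exists I : rngIdeal L,
  graded_set A -> graded_ideal I /\ forall x, x \in I <-> A x.
Proof.
have [[I hI]|nA] := pselect (graded_set A); first by exists I.
have [I _] : exists I : rngIdeal L, forall x, x \in I <-> (@setT L) x by exact: ideal_of_set.
by exists I => /nA.
Qed.
Definition to_ideal A : rngIdeal L := projT1 (cid (to_ideal_ex A)).
Lemma to_idealP A : graded_set A -> graded_ideal (to_ideal A) /\
  forall x, x \in to_ideal A <-> A x.
Proof. by rewrite /to_ideal; case: cid. Qed.

(** The tower needs a successor for every set; for a set that is not a proper graded ideal only the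
    inclusion is required of it. *)
Lemma next_ex (A : set L) : exists B : set L, A `<=` B /\
  (graded_set A -> A <> setT -> exists2 e, good_corner (to_ideal A) e &
     B = [set x | x \in add_ideal (to_ideal A) e]).
Proof.
have [[gA AT]|nA] := pselect (graded_set A /\ A <> setT); last first.
  by exists A; split=> // gA AT; case: nA.
have [gI IA] := to_idealP gA.
have [|e he] := good_corner_ex gI.
  by move=> h; apply: AT; apply/seteqP; split=> // x _; apply/IA.
exists [set x | x \in add_ideal (to_ideal A) e]; split; last by exists e.
by move=> x /IA xI /=; apply: add_ideal_sub.
Qed.
Definition next A : set L := projT1 (cid (next_ex A)).
Lemma next_ext A : A `<=` next A.
Proof. by rewrite /next; case: cid => B []. Qed.
Lemma nextP A : graded_set A -> A <> setT -> exists2 e, good_corner (to_ideal A) e &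
  next A = [set x | x \in add_ideal (to_ideal A) e].
Proof. by rewrite /next; case: cid => B /= [_ h]; exact: h. Qed.

Local Notation T := (@tower_order L [set 0] next next_ext).

Lemma tower_graded A : tower [set 0] next A -> graded_set A.
Proof.
elim=> [B tB gB|C tC gC].
  have [BT|BT] := pselect (B = setT).
    have -> : next B = B by apply/seteqP; split=> [x _|]; [rewrite BT | exact: next_ext].
    exact: gB.
  have [e [he _ _ _ _] ->] := nextP gB BT; have [gI _] := to_idealP gB.
  by exists (add_ideal (to_ideal B) e : rngIdeal L); split=> //; apply: add_ideal_graded.
pose U := [set 0] `|` \bigcup_(A in C) A.
have UE x : U x -> x = 0 \/ exists2 B, C B & B x.
  by move=> [->|[B CB Bx]]; [left|right; exists B].
have inB B (I : rngIdeal L) x : C B -> (forall x, x \in I <-> B x) -> x \in I -> U x.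
  by move=> CB IB /IB Bx; right; exists B.
have U2 x y : U x -> U y -> U (x - y).
  have one B x' y' : C B -> B x' -> B y' -> U (x' - y').
    move=> CB; have [I [_ IB]] := gC B CB => /IB xI /IB yI.
    by apply: (inB B I) => //; apply: rpredB.
  have zero B : C B -> B 0 by move=> CB; have [I [_ IB]] := gC B CB; apply/IB; rewrite rpred0.
  move=> /UE[->|[B CB Bx]] /UE[->|[B' CB' B'y]].
  - by rewrite subr0; left.
  - by apply: (one B') => //; apply: zero.
  - by apply: (one B) => //; apply: zero.
  (* The tower is totally ordered, so the two elements lie in a common member. *)
  - have [BB|BB] := tower_total next_ext (tC _ CB) (tC _ CB').
      by apply: (one B') => //; apply: BB.
    by apply: (one B) => //; apply: BB.
have [|//|||I IU] := @ideal_of_set L U.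
- by left.
- move=> r x /UE[->|[B CB Bx]]; first by rewrite rmul0r; left.
  have [I [_ IB]] := gC B CB; apply: (inB B I) => //; apply: rng_idealMl; exact/IB.
- move=> r x /UE[->|[B CB Bx]]; first by rewrite rmul0l; left.
  have [I [_ IB]] := gC B CB; apply: (inB B I) => //; apply: rng_idealMr; exact/IB.
exists I; split=> // x /IU/UE[->|[B CB Bx]]; first by exists [::]; rewrite big_nil.
have [I' [gI' IB]] := gC B CB; have [|s [sI xE]] := gI' x; first exact/IB.
exists s; split=> // y /sI[yI' hy]; split=> //; apply/IU; exact: (inB B I').
Qed.

Lemma tower_next_proper A : tower [set 0] next A -> A <> setT -> ~ (next A `<=` A).
Proof.
move=> /tower_graded gA AT; have [e /good_corner_mem[eJ eI] ->] := nextP gA AT.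
by move=> /(_ e eJ) Ae; move/negP: eI; apply; have [_ h] := to_idealP gA; apply/h.
Qed.

Let I (a : T) : rngIdeal L := to_ideal (tower_val a).
Let graded_I (a : T) : graded_ideal (I a).
Proof. by have [] := to_idealP (tower_graded (towerP a)). Qed.
Let in_I (a : T) x : x \in I a <-> tower_val a x.
Proof. by have [] := to_idealP (tower_graded (towerP a)). Qed.

Let lt_full (a b : T) : (a < b)%O -> tower_val a <> setT.
Proof. by move=> /tower_ltP[_ nba] aT; apply: nba; rewrite aT. Qed.

Let next_succ (a b : T) : is_succ a b -> exists2 e, good_corner (I a) e &
  forall x, x \in I b <-> x \in add_ideal (I a) e.
Proof.
move=> ab; have aT : tower_val a <> setT by have [/lt_full] := ab.
have -> := tower_succ (tower_next_proper (towerP a) aT) ab.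
have [e he eE] := nextP (tower_graded (towerP a)) aT; exists e => // x.
by apply: (iff_trans (in_I _ x)); rewrite /= eE.
Qed.

(* Each step of the tower contributes a simple module annihilated by the
   earlier ideals only. *)
Let countable_T : countable [set: T].
Proof.
have [F hF] := cirt.
have ex (a : T) : exists S : rngModule L, tower_val a <> setT ->
    [/\ simple_module S, forall c (y : S), c \in I a -> act c y = 0 &
      exists e (x : S), [/\ next (tower_val a) e, x <> 0 & act e x = x]].
  have [aT|aT] := pselect (tower_val a = setT).
    have : ~ forall S : rngModule L, False.
      by apply; exact: (left_module (N := setT)).
    by move=> /existsNP[S _]; exists S => /(_ aT).
  have [e he eE] := nextP (tower_graded (towerP a)) aT.
  have [_ ee e0 _ _] := he; have [S [x [simS x0 Ix ex]]] := corner_simple ee e0.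
  exists S => _; split=> //; exists e, x; split=> //; rewrite eE /=.
  by have [] := good_corner_mem he.
have [S hS] := choice ex.
(* [e] lies in the successor of [a], hence in the ideal of [b], which kills [S b]; but [e] fixes a
   nonzero vector of [S a]. *)
have ninj (a b : T) : (a < b)%O -> tower_val b <> setT -> F (S a) <> F (S b).
  move=> ab bT; have aT := lt_full ab.
  have [simSa _ [e [x [ne x0 ex']]]] := hS a aT.
  have [simSb Ib _] := hS b bT.
  move=> /(hF _ _ simSa simSb)[phi [bphi phiD phiM]]; apply: x0.
  have phi0 : phi 0 = 0 by apply: (addrI (phi 0)); rewrite -phiD !addr0.
  apply: (bij_inj bphi); rewrite phi0 -ex' phiM; apply: Ib; apply/in_I.
  have /tower_ltP[_ nba] := ab.
  by have [ba|] := tower_cmp next_ext (towerP b) (towerP a); [case: nba | apply].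
apply/countable_injP.
exists (fun a : T => if pselect (tower_val a = setT) then 0%N else (F (S a)).+1).
move=> a b _ _; case: pselect => aT; case: pselect => bT // h.
  by apply: tower_type_inj; rewrite aT bT.
have {}h : F (S a) = F (S b) by case: h.
have [ab|ba|//] := ltgtP a b; first by case: (ninj _ _ ab bT).
by case: (ninj _ _ ba aT).
Qed.

Lemma filtration_of_CIRT :
  exists (d : Order.disp_t) (T : tbOrderType d) (I : T -> rngIdeal (leavitt K E)),
     well_ordered T /\
     countable [set: T] /\
     (forall a, indexes_chain a -> graded_ideal (I a)) /\
     (forall x, (x \in I \bot%O) = (x == 0%R)) /\
     (forall a b, indexes_chain a -> indexes_chain b -> (a < b)%O ->
        [set` I a] `<` [set` I b]) /\
     (forall c, indexes_chain c -> is_limit c ->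
        forall x, x \in I c <-> exists2 a, (a < c)%O & x \in I a) /\
     (forall x : leavitt K E, exists2 a, indexes_chain a & x \in I a) /\
     (forall a b, is_succ a b ->
        exists (J : countType) (X : J -> choiceType) (k : J -> coef_kind),
          rng_iso (subquotient (I b) (I a))
            (direct_sum (fun j => fin_matrix (X j) (coef_ring K (k j))))).
Proof.
have limit (c : T) : is_limit c -> forall x, x \in I c <-> exists2 a, (a < c)%O & x \in I a.
  move=> lc x; apply: (iff_trans (in_I c x)).
  apply: (iff_trans (tower_limit lc x)).
  by split=> -[a ac xa]; exists a => //; apply/in_I.
have top_full x : x \in I \top%O.
  apply/in_I.
  have topE : tower_val (\top%O : T) = setT by exact: (tower_top_full tower_next_proper).
  by rewrite topE.
exists tower_display, T, I; split; first exact: tower_well_ordered.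
split; first exact: countable_T.
split; first by move=> a _; apply: graded_I.
split; first by move=> x; apply/idP/eqP => [/in_I|x0]; [|apply/in_I].
split.
  move=> a b _ _ /tower_ltP[ab nba]; split=> [x /in_I/ab/in_I //|ba].
  by apply: nba => x /in_I/ba/in_I.
split; first by move=> c _; apply: limit.
split.
  move=> x; have [it|nit] := pselect (indexes_chain (\top%O : T)).
    by exists \top%O.
  have /limit h := tower_indexes_top nit.
  have /h[a at' xa] := top_full x.
  by exists a => //; constructor 2.
move=> a b ab; have [e [_ _ _ [k [X iso]] _] eE] := next_succ ab.
exists unit, (fun=> X), (fun=> k).
apply: rng_iso_trans (direct_sum_unit _); apply: rng_iso_trans iso.
by apply: subquotient_eq => // x; have [/tower_ltP[sub _] _] := ab; move/in_I/sub/in_I.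
Qed.

(** A vertex on a cycle is nonzero, so the least ideal of the chain containing it is not the bottom
    one; by smoothness it does not sit at a limit either. At that successor step the last clause of
    [good_corner] applies. *)
Lemma countable_of_CIRT : (exists c : seq (edge E), graph_cycle c) -> countable [set: K].
Proof.
move=> [c /cycle_closed_path[v cpv]].
have Vv0 := @closed_path_neq0 K E c v cpv.
have [c0 pc sc] := cpv.
have wf : well_ordered T by exact: tower_well_ordered.
have ex : exists a : T, V v \in I a.
  exists \top%O; apply/in_I.
  have topE : tower_val (\top%O : T) = setT by exact: (tower_top_full tower_next_proper).
  by rewrite topE.
have [a aE] := ex.
elim/(well_founded_ind wf): a aE => b IH vb.
have [[a [ab va]]|nb] := pselect (exists a, (a < b)%O /\ V v \in I a); first exact: IH va.
have [[a sab]|nsucc] := pselect (exists a, is_succ a b).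
  have [e [_ _ _ _ hc] eE] := next_succ sab.
  apply: (hc c v) => //; first exact/eE.
  by apply/negP => va; apply: nb; exists a; split=> //; have [] := sab.
have [b0|b0] := eqVneq b \bot%O.
  by exfalso; apply: Vv0; move: vb; rewrite b0 => /in_I.
have lb : is_limit b by split.
have /in_I/(tower_limit lb)[a ab va] := vb.
by case: nb; exists a; split=> //; apply/in_I.
Qed.

End Forward.

(** * The equivalence *)

Section Backward.
Local Open Scope classical_set_scope.
Variables (K : fieldType) (E : graph).

Lemma coef_countable_left_ideals (I J : rngIdeal (leavitt K E)) (C : countType)
    (X : C -> choiceType) (k : C -> coef_kind) :
  ((exists c : seq (edge E), graph_cycle c) -> countable [set: K]) ->
  rng_iso (subquotient J I) (direct_sum (fun j => fin_matrix (X j) (coef_ring K (k j)))) ->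
  forall j, X j -> countable_left_ideals (coef_ring K (k j)).
Proof.
move=> cycK iso j i.
have [cyc|acyc] := pselect (exists c : seq (edge E), graph_cycle c).
  case: (k j); first exact: field_countable_left_ideals.
  by apply: laurent_countable_left_ideals; apply: cycK.
have pi_reg := acyclic_pi_regular (K := K) (fun c hc => acyc (ex_intro _ c hc)).
have := block_pi_regular iso pi_reg i; case: (k j) => [_|/laurent_not_pi_regular//].
exact: field_countable_left_ideals.
Qed.

Lemma CIRT_of_filtration (d : Order.disp_t) (T : tbOrderType d)
    (I : T -> rngIdeal (leavitt K E)) :
  well_ordered T -> countable [set: T] ->
  (forall x, (x \in I \bot%O) = (x == 0%R)) ->
  (forall c, indexes_chain c -> is_limit c ->
     forall x, x \in I c <-> exists2 a, (a < c)%O & x \in I a) ->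
  (forall x : leavitt K E, exists2 a, indexes_chain a & x \in I a) ->
  (forall a b, is_succ a b ->
     exists (J : countType) (X : J -> choiceType) (k : J -> coef_kind),
       rng_iso (subquotient (I b) (I a))
         (direct_sum (fun j => fin_matrix (X j) (coef_ring K (k j))))) ->
  ((exists c : seq (edge E), graph_cycle c) -> countable [set: K]) ->
  CIRT (leavitt K E).
Proof.
move=> wo cT Ibot Ilim Iall Isucc cycK; apply: CIRT_of_countably_many.
apply: (@countably_many_bigcup _ _ (T * T)%type
  (fun ab S => is_succ ab.1 ab.2 /\ layer (I ab.1) (I ab.2) S)).
- by rewrite -setXTT; apply: countableX.
- move=> [a b] /=; have [ab|nab] := pselect (is_succ a b); last first.
    by exists (fun _ _ => True); split=> [S []|S T' n []].
  have [J [X [k iso]]] := Isucc a b ab.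
  have [code [cE cI]] :=
    layer_countably_many iso (coef_countable_left_ideals cycK iso).
  exists code; split=> [S [_ /cE//]|S S' n [_ lS] [_ lS']]; exact: cI.
(* The least [b] whose ideal acts nontrivially is neither [\bot] nor a limit, so it is the successor
   of some [a], and [S] belongs to the layer between [a] and [b]. *)
- move=> S simS; pose acts a := exists2 x, x \in I a & exists m : S, act x m <> 0%R.
  have [[r [m rm]] _] := simS; have [a0 ia0 ra0] := Iall r.
  have : acts a0 by exists r => //; exists m.
  elim/(well_founded_ind wo): a0 ia0 {ra0} => b IH ib actb.
  have [[a [ab acta]]|na] := pselect (exists a, (a < b)%O /\ acts a).
    (* An element with something above it is below [\top], hence indexes the chain; the descent
       stays within the indices for which smoothness is assumed. *)
    by apply: (IH a ab _ acta); constructor 2; apply: lt_le_trans ab (lex1 _).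
  have [[a sab]|nsucc] := pselect (exists a, is_succ a b).
    exists (a, b); split=> //; split=> //= x y xa; apply: contrapT => xy.
    by apply: na; exists a; split; [have [] := sab | exists x => //; exists y].
  have [x xb [y xy]] := actb.
  have [b0|b0] := eqVneq b \bot%O.
    by exfalso; apply: xy; move: xb; rewrite b0 Ibot => /eqP ->; rewrite act0l.
  have lb : is_limit b by split.
  have [a ab xa] := (Ilim b ib lb x).1 xb.
  by case: na; exists a; split=> //; exists x => //; exists y.
Qed.

End Backward.

Local Open Scope classical_set_scope.

Theorem theorem3p4 (E : graph) (K : fieldType) :
  CIRT (leavitt K E) <->
  (exists (d : Order.disp_t) (T : tbOrderType d)
          (I : T -> rngIdeal (leavitt K E)),
     well_ordered T /\
     countable [set: T] /\
     (forall a, indexes_chain a -> graded_ideal (I a)) /\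
     (forall x, (x \in I \bot%O) = (x == 0%R)) /\
     (forall a b, indexes_chain a -> indexes_chain b -> (a < b)%O ->
        [set` I a] `<` [set` I b]) /\
     (forall c, indexes_chain c -> is_limit c ->
        forall x, x \in I c <-> exists2 a, (a < c)%O & x \in I a) /\
     (forall x : leavitt K E, exists2 a, indexes_chain a & x \in I a) /\
     (forall a b, is_succ a b ->
        exists (J : countType) (X : J -> choiceType) (k : J -> coef_kind),
          rng_iso (subquotient (I b) (I a))
            (direct_sum (fun j => fin_matrix (X j) (coef_ring K (k j)))))) /\
  ((exists c : seq (edge E), graph_cycle c) -> countable [set: K]).
Proof.
split=> [cirt|[[d [T [I [wo [cT [_ [Ibot [_ [Ilim [Iall Isucc]]]]]]]]]] cycK]].
  split; [exact: filtration_of_CIRT | exact: countable_of_CIRT].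
exact: (CIRT_of_filtration wo cT Ibot Ilim Iall Isucc cycK).
Qed.
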